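(* Let $\epsilon\in(0,1]$, $g\in L^\infty_{\mathrm{loc}}(\Omega)$ and $\Omega'\Subset\Omega$. Let $u\in W^{1,p}_{\mathrm{loc}}(\Omega)\cap L^\infty(\mathbb{R}^N)$ be a weak subsolution of $$-H_pu+\epsilon(-\Delta_p)^su=g(x)|u|^{p-2}u\quad\text{in }\Omega$$ such that $u>0$ in $\Omega'$. Then there is a constant $C=C(p)>0$ such that for every $q>p$ and every nonnegative $\eta\in C_c^\infty(\Omega')$, $$\int_{\Omega'}u^{q-p}H(\eta\nabla u)^p\,dx\le\Big(\frac{p}{q-p+1}\Big)^p\int_{\Omega'}u^qH(\nabla\eta)^p\,dx+\frac{p}{q-p+1}\int_{\Omega'}g(x)u^q\eta^p\,dx$$ $$+\frac{C\,p}{q-p+1}\int_{\Omega'}\int_{\Omega'}(u(x)^q+u(y)^q)|\eta(x)-\eta(y)|^p\,d\mu$$ $$+\frac{2p}{q-p+1}\Big(\sup_{x\in\mathrm{spt}\,\eta}\int_{\mathbb{R}^N\setminus\Omega'}\frac{|u(y)|^{p-1}}{|x-y|^{N+ps}}\,dy\Big)\int_{\Omega'}u(x)^{q-p+1}\eta(x)^p\,dx.$$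
   Context: $\Omega\subset\mathbb{R}^N$, $N\ge2$, is a bounded $C^1$ domain, $1<p<\infty$, $0<s<1$, and $d\mu=|x-y|^{-N-ps}\,dx\,dy$. $H:\mathbb{R}^N\to[0,\infty)$ is a Finsler–Minkowski norm: $H\in C^1(\mathbb{R}^N\setminus\{0\})$; $H(x)=0$ iff $x=0$; $H(tx)=|t|H(x)$ for all $t\in\mathbb{R}$, $x\in\mathbb{R}^N$; there are constants $C_1,C_2>0$ with $C_1|x|\le H(x)\le C_2|x|$ for all $x$; and $H$ is strictly convex as a norm, i.e. $H(x+y)<H(x)+H(y)$ for linearly independent $x,y$. The vector field $H(\xi)^{p-1}\nabla H(\xi)$ is understood as $0$ at $\xi=0$. $H_pu=\mathrm{div}(H(\nabla u)^{p-1}\nabla H(\nabla u))$ and $(-\Delta_p)^s$ is the fractional $p$-Laplacian with kernel $|x-y|^{-N-ps}$. For open $\Omega'$, $W_0^{1,p}(\Omega')=\{u\in W^{1,p}(\mathbb{R}^N):u=0\text{ in }\mathbb{R}^N\setminus\Omega'\}$. Let $L^{ps}_{p-1}(\mathbb{R}^N)=\{u\in L^{p-1}_{\mathrm{loc}}(\mathbb{R}^N):\int_{\mathbb{R}^N}\frac{|u(y)|^{p-1}}{(1+|y|)^{N+ps}}\,dy<\infty\}$ (it contains $L^\infty(\mathbb{R}^N)$). A function $u\in W^{1,p}_{\mathrm{loc}}(\Omega)\cap L^{ps}_{p-1}(\mathbb{R}^N)$ is a weak subsolution of the equation if for every open $\Omega'\Subset\Omega$ and every nonnegative $\phi\in W_0^{1,p}(\Omega')$,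 $$\int_{\Omega'}H(\nabla u)^{p-1}\nabla H(\nabla u)\cdot\nabla\phi\,dx+\epsilon\iint_{\mathbb{R}^{2N}}|u(x)-u(y)|^{p-2}(u(x)-u(y))(\phi(x)-\phi(y))\,d\mu-\int_{\Omega'}g|u|^{p-2}u\,\phi\,dx\le0.$$ *)

(* Defs.v *)
From HB Require Import structures.
From mathcomp Require Import all_boot all_order all_algebra.
From mathcomp Require Import all_classical all_reals all_analysis.
From mathcomp Require Import measurable_realfun ess_sup_inf.

Set Implicit Arguments.
Unset Strict Implicit.
Unset Printing Implicit Defensive.

Import Order.TTheory GRing.Theory Num.Theory.
Import numFieldNormedType.Exports.

Local Open Scope classical_set_scope.
Local Open Scope ring_scope.

(* 'rV[R]_n is equipped with its Borel sigma-algebra. *)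
Section borel_rV.
Context (R : realType) (n : nat).

Let B : set (set 'rV[R]_n) := <<s open >>.

Let B0 : B set0. Proof. exact: sigma_algebra0. Qed.

Let BC A : B A -> B (~` A). Proof. exact: sigma_algebraC. Qed.

Let Bbigcup (F : (set 'rV[R]_n)^nat) :
  (forall i, B (F i)) -> B (\bigcup_i F i).
Proof. exact: sigma_algebra_bigcup. Qed.

HB.instance Definition _ := isMeasurable.Build
  (sigma_display (@open 'rV[R]_n)) 'rV[R]_n B0 BC Bbigcup.

Lemma open_measurable_rV (U : set 'rV[R]_n) : open U -> measurable U.
Proof. exact: sub_sigma_algebra. Qed.

Lemma measurable_coord (i : 'I_n) :
  measurable_fun setT (fun v : 'rV[R]_n => v ord0 i).
Proof.
apply: (measurability _ (RGenOpens.measurableE R)) => _ [_ [a [b ->]] <-].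
rewrite setTI; apply: open_measurable_rV; apply: open_comp.
  by move=> v _; exact: coord_continuous.
exact: interval_open.
Qed.

(* The open sets of 'rV[R]_n are countable unions of rational boxes. *)
Lemma measurable_fun_rV d (T : measurableType d) (f : T -> 'rV[R]_n) :
  (forall i, measurable_fun setT (fun x => f x ord0 i)) ->
  measurable_fun setT f.
Proof.
move=> mf; apply: (@measurability _ _ _ _ setT f open) => // _ [U oU <-].
rewrite setTI.
pose box (ck : 'rV[rat]_n * nat) : set 'rV[R]_n :=
  [set v | forall i, `|v ord0 i - ratr (ck.1 ord0 i)| < ck.2.+1%:R^-1].
have mbox ck : measurable (f @^-1` box ck).
  rewrite [X in measurable X](_ : _ = \bigcap_(i in [set: 'I_n])
      ((fun x => f x ord0 i) @^-1`
        [set r | `|r - ratr (ck.1 ord0 i)| < ck.2.+1%:R^-1])); last first.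
    by apply/seteqP; split => [x bx i _|x bx i]; [exact: bx|exact: bx].
  apply: fin_bigcap_measurable => [|i _]; first exact: (sub_finite_set (fun _ _ => isT) (finite_finpred 'I_n)).
  rewrite -[X in measurable X]setTI; apply: mf => //.
  rewrite [X in measurable X](_ : _ =
      ball (ratr (ck.1 ord0 i) : R) ck.2.+1%:R^-1).
    exact: measurable_ball.
  by apply/seteqP; split => r; rewrite -ball_normE /= distrC.
rewrite [X in measurable X](_ : _ = \bigcup_ck
    if `[< box ck `<=` U >] then f @^-1` box ck else set0); last first.
  apply/seteqP; split=> [x Ufx|x [ck _ /=]]; last first.
    by case: asboolP => // bU bx; exact: bU bx.
  have /nbhs_ballP[e /= e0 xeU] : nbhs (f x) U by exact: open_nbhs_nbhs.
  have [k kN0 ke] : exists2 k : nat, True & k.+1%:R^-1 < e / 2.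
    have [k _ /(_ k (leqnn _))/= ke] := near_infty_natSinv_lt (PosNum (divr_gt0 e0 (ltr0n R 2))).
    by exists k.
  have k0 : 0 < k.+1%:R^-1 :> R by rewrite invr_gt0 ltr0n.
  have ratx i : {q : rat | `|f x ord0 i - ratr q| < k.+1%:R^-1}.
    apply: cid; have := @rat_in_itvoo R (f x ord0 i - k.+1%:R^-1) (f x ord0 i + k.+1%:R^-1).
    case; first by rewrite ltrBlDr -addrA ltrDl addr_gt0.
    move=> q; rewrite in_itv/= => /andP[q1 q2]; exists q.
    by rewrite distrC ltr_distl q1 q2.
  exists (\row_i sval (ratx i), k) => //; case: asboolP => [_ /= i|].
    by rewrite mxE; exact: (svalP (ratx i)).
  move=> []; move=> v bv; apply: xeU; split => // j i; rewrite (ord1 j).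
  have := bv i; rewrite /= mxE -ball_normE /= => bvi.
  rewrite (le_lt_trans (ler_distD (ratr (sval (ratx i))) _ _))//.
  rewrite (splitr e) ltrD//; first exact: (lt_trans (svalP (ratx i))).
  by rewrite distrC (lt_trans bvi).
apply: countable_bigcupT_measurable; first exact: countableP.
by move=> ck; case: ifP.
Qed.

End borel_rV.

Section lebesgue_rV.
Context (R : realType).

Definition cons_rV n (z : R * 'rV[R]_n) : 'rV[R]_n.+1 :=
  \row_i oapp (z.2 ord0) z.1 (unlift ord0 i).

Lemma measurable_cons_rV n : measurable_fun setT (@cons_rV n).
Proof.
apply: measurable_fun_rV => i; case: (unliftP ord0 i) => [j|] ->.
  rewrite [X in measurable_fun _ X](_ : _ =
    (fun v : 'rV[R]_n => v ord0 j) \o snd); last first.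
    by apply/funext => z; rewrite /= mxE liftK.
  by apply: measurableT_comp => //; exact: measurable_coord.
rewrite [X in measurable_fun _ X](_ : _ = fst) //.
by apply/funext => z; rewrite /= mxE unlift_none.
Qed.

Section lebesgue_succ.
Local Open Scope ereal_scope.
Context n (m : {sigma_finite_measure set 'rV[R]_n -> \bar R}).

Definition lebesgue_succ : set 'rV[R]_n.+1 -> \bar R :=
  pushforward (@lebesgue_measure R \x m) (@cons_rV n).

Let lebesgue_succ0 : lebesgue_succ set0 = 0.
Proof. by rewrite /lebesgue_succ /pushforward preimage_set0 measure0. Qed.

Let lebesgue_succ_ge0 A : 0 <= lebesgue_succ A.
Proof. by rewrite /lebesgue_succ /pushforward; exact: measure_ge0. Qed.

Let mpre (A : set 'rV[R]_n.+1) :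
  measurable A -> measurable (@cons_rV n @^-1` A).
Proof.
by move=> mA; rewrite -[X in measurable X]setTI; exact: measurable_cons_rV.
Qed.

Let lebesgue_succ_sigma_additive : semi_sigma_additive lebesgue_succ.
Proof.
move=> F mF tF mUF; rewrite /lebesgue_succ /pushforward preimage_bigcup.
apply: measure_semi_sigma_additive.
- by move=> k; exact: mpre.
- apply/trivIsetP => /= i j _ _ ij; rewrite -preimage_setI.
  by move/trivIsetP : tF => /(_ _ _ _ _ ij) ->//; rewrite preimage_set0.
- by rewrite -preimage_bigcup; exact: mpre.
Qed.

HB.instance Definition _ := isMeasure.Build _ _ _ lebesgue_succ
  lebesgue_succ0 lebesgue_succ_ge0 lebesgue_succ_sigma_additive.

Let lebesgue_succ_sigma_finite : sigma_finite setT lebesgue_succ.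
Proof.
have /sigma_finiteP[F [FT ndF Foo]] := sigma_finiteT (@lebesgue_measure R).
have /sigma_finiteP[G [GT ndG Goo]] := sigma_finiteT m.
pose h (v : 'rV[R]_n.+1) : R * 'rV[R]_n :=
  (v ord0 ord0, \row_i v ord0 (lift ord0 i))%R.
have mh : measurable_fun setT h.
  apply/measurable_fun_pairP; split; first exact: measurable_coord.
  apply: measurable_fun_rV => i.
  rewrite [X in measurable_fun _ X](_ : _ =
    (fun v : 'rV[R]_n.+1 => v ord0 (lift ord0 i))).
    exact: measurable_coord.
  by apply/funext => v; rewrite /= mxE.
have consK : cancel (@cons_rV n) h.
  move=> [x v]; rewrite /h /cons_rV; congr pair; first by rewrite mxE unlift_none.
  by apply/rowP => i; rewrite !mxE liftK.
exists (fun k => h @^-1` (F k `*` G k)).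
  apply/esym/seteqP; split => // v _.
  have [i _ Fi] : (\bigcup_i F i) (h v).1 by rewrite -FT.
  have [j _ Gj] : (\bigcup_i G i) (h v).2 by rewrite -GT.
  exists (maxn i j) => //; split.
    by move: Fi; exact/subsetPset/ndF/leq_maxl.
  by move: Gj; exact/subsetPset/ndG/leq_maxr.
move=> k; have [mFk Fkoo] := Foo k; have [mGk Gkoo] := Goo k; split.
  by rewrite -[X in measurable X]setTI; apply: mh => //; exact: measurableX.
rewrite /lebesgue_succ /pushforward -comp_preimage.
rewrite (_ : h \o @cons_rV n = id); last by rewrite funeqE => z; exact: consK.
by rewrite /= product_measure1E// lte_mul_pinfty// ge0_fin_numE.
Qed.

HB.instance Definition _ := @Measure_isSigmaFinite.Build _ _ _ lebesgue_succ
  lebesgue_succ_sigma_finite.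

End lebesgue_succ.

Fixpoint lebesgue_rec n : {sigma_finite_measure set 'rV[R]_n -> \bar R} :=
  match n with
  | 0 => (\d_ (0 : 'rV[R]_0))
  | k.+1 => lebesgue_succ (lebesgue_rec k)
  end.

(* N-dimensional Lebesgue measure on the Borel sets; see lebesgue_rV_box. *)
Definition lebesgue_rV n : set 'rV[R]_n -> \bar R := lebesgue_rec n.

HB.instance Definition _ n := SigmaFiniteMeasure.on (@lebesgue_rV n).

Lemma lebesgue_rV_box n (A : 'I_n -> set R) :
  (forall i, measurable (A i)) ->
  @lebesgue_rV n [set v | forall i, A i (v ord0 i)] =
  (\prod_(i < n) @lebesgue_measure R (A i))%E.
Proof.
rewrite /lebesgue_rV; elim: n A => [|n IH] A mA /=.
  rewrite big_ord0 diracE (_ : _ \in _)//.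
  by apply/mem_set => -[].
rewrite big_ord_recl -IH //.
have mbox : measurable [set v : 'rV[R]_n | forall i, A (lift ord0 i) (v ord0 i)].
  rewrite [X in measurable X](_ : _ = \bigcap_(i in [set: 'I_n])
      ((fun v : 'rV[R]_n => v ord0 i) @^-1` A (lift ord0 i))); last first.
    by apply/seteqP; split => [x bx i _|x bx i]; exact: bx.
  apply: fin_bigcap_measurable => [|i _].
    exact: (sub_finite_set (fun _ _ => isT) (finite_finpred 'I_n)).
  by rewrite -[X in measurable X]setTI; exact: measurable_coord.
rewrite -product_measure1E //; last exact: (mA ord0).
rewrite /lebesgue_succ /pushforward; congr (product_measure1 _ _ _).
apply/seteqP; split => [[x v] /= b|[x v] /= [Ax Av] i].
  split=> [|i]; first by have := b ord0; rewrite mxE unlift_none.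
  by have := b (lift ord0 i); rewrite mxE liftK.
by rewrite mxE; case: (unliftP ord0 i) => [j ->|->] /=; [exact: Av|exact: Ax].
Qed.

End lebesgue_rV.
Arguments lebesgue_rV {R n}.

Section calculus.
Context (R : realType) (N : nat).
Implicit Types (x y : 'rV[R]_N) (f : 'rV[R]_N -> R) (U V K : set 'rV[R]_N).

(* The library norm on row vectors is the sup norm. *)
Definition enorm x : R := Num.sqrt (\sum_i x ord0 i ^+ 2).

Definition dotv x y : R := \sum_i x ord0 i * y ord0 i.

Definition partial (i : 'I_N) f : 'rV[R]_N -> R :=
  fun x => 'D_(delta_mx ord0 i) f x.

Definition grad f x : 'rV[R]_N := \row_i partial i f x.

(* Meant for open U, where it is the usual class C^1(U). *)
Definition C1_on U f :=
  forall x, U x ->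
    differentiable f x /\ forall i, {for x, continuous (partial i f)}.

Definition smooth f :=
  forall (l : seq 'I_N) x, differentiable (foldr partial f l) x.

Definition spt f : set 'rV[R]_N := closure [set x | f x != 0].

Definition test_function U f :=
  [/\ smooth f, compact (spt f) & spt f `<=` U].

Definition compactly_contained V U :=
  compact (closure V) /\ closure V `<=` U.

Record finsler_minkowski (H : 'rV[R]_N -> R) : Prop := {
  finsler_ge0 : forall x, 0 <= H x;
  finsler_C1 : C1_on [set x | x != 0] H;
  finsler_eq0 : forall x, H x = 0 <-> x = 0;
  finslerZ : forall (t : R) x, H (t *: x) = `|t| * H x;
  finsler_equiv : exists C1 C2 : R,
    [/\ 0 < C1, 0 < C2 & forall x, C1 * enorm x <= H x <= C2 * enorm x];
  finsler_strict : forall x y, free [:: x; y] -> H (x + y) < H x + H y }.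

(* H^(p-1) grad H *)
Definition finsler_field (H : 'rV[R]_N -> R) (p : R) xi : 'rV[R]_N :=
  if xi == 0 then 0 else H xi `^ (p - 1) *: grad H xi.

End calculus.

Notation "V '⋐' U" := (compactly_contained V U) (at level 70).

(* Near each boundary point, up to relabelling and reorienting the coordinate
   axes, U is the strict epigraph of a C^1 function of the other coordinates. *)
Definition C1_boundary (R : realType) (N : nat) (U : set 'rV[R]_N) :=
  forall x0, (closure U `\` U°) x0 ->
    exists (i : 'I_N) (b : bool) (gamma : 'rV[R]_(N.-1) -> R),
      C1_on setT gamma /\
      \forall x \near x0, U x <-> gamma (col' i x) < (-1) ^+ b * x ord0 i.

Definition bounded_C1_domain (R : realType) (N : nat) (U : set 'rV[R]_N) :=
  [/\ open U, connected U, U !=set0, bounded_set U & C1_boundary U].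

Section function_spaces.
Context (R : realType) (N : nat).
Notation leb := (@lebesgue_rV R N).
Implicit Types (f g u phi : 'rV[R]_N -> R) (G Du Dphi : 'rV[R]_N -> 'rV[R]_N).
Implicit Types (U V K : set 'rV[R]_N) (p s eps : R).

Definition Lp_on (r : \bar R) U f := f \_ U \in Lfun leb r.

Definition Lp_loc (r : \bar R) U f :=
  forall K, compact K -> K `<=` U -> Lp_on r K f.

Definition weak_gradient U u Du :=
  [/\ Lp_loc 1%E U u,
      forall i, Lp_loc 1%E U (fun x => Du x ord0 i) &
      forall i phi, test_function U phi ->
        (\int[leb]_(x in U) (u x * partial i phi x)%:E =
         - \int[leb]_(x in U) (Du x ord0 i * phi x)%:E)%E].

(* Functions are Borel representatives, defined on all of R^N, of the usual
   almost-everywhere classes; only their values on U matter.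
   u belongs to W^{1,p}(U) and has weak gradient Du; likewise below. *)
Definition W1p U p u Du :=
  [/\ weak_gradient U u Du, Lp_on p%:E U u &
      forall i, Lp_on p%:E U (fun x => Du x ord0 i)].

Definition W1p_loc U p u Du := forall V, open V -> V ⋐ U -> W1p V p u Du.

Definition W1p_0 U p u Du :=
  W1p setT p u Du /\ {ae leb, forall x, ~ U x -> u x = 0}.

(* The space L^{ps}_{p-1}(R^N). *)
Definition tail_space p s u :=
  Lp_loc (p - 1)%:E setT u /\
  (\int[leb]_y (`|u y| `^ (p - 1) / (1 + enorm y) `^ (N%:R + p * s))%:E
     < +oo)%E.

(* Density of mu with respect to dx dy. *)
Definition mu_density p s (z : 'rV[R]_N * 'rV[R]_N) : R :=
  enorm (z.1 - z.2) `^ (- (N%:R + p * s)).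

Definition weak_subsolution (H : 'rV[R]_N -> R) p s eps g (Omega : set 'rV[R]_N)
    u Du :=
  [/\ W1p_loc Omega p u Du, tail_space p s u &
  forall V phi Dphi, open V -> V ⋐ Omega ->
    W1p_0 V p phi Dphi -> {ae leb, forall x, 0 <= phi x} ->
    (\int[leb]_(x in V) (dotv (finsler_field H p (Du x)) (Dphi x))%:E
     + eps%:E * \int[leb \x leb]_z
         (`|u z.1 - u z.2| `^ (p - 2) * (u z.1 - u z.2)
            * (phi z.1 - phi z.2) * mu_density p s z)%:E
     - \int[leb]_(x in V) (g x * `|u x| `^ (p - 2) * u x * phi x)%:E
     <= 0)%E].

End function_spaces.

(* Main.v *)
From HB Require Import structures.
Require Import Defs.
From mathcomp Require Import all_boot all_order all_algebra.
From mathcomp Require Import all_classical all_reals all_analysis.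
From mathcomp Require Import measurable_realfun ess_sup_inf.
From mathcomp Require Import ring lra.

(** The weak inequality is tested with [phi = u `^ beta * eta `^ p], where
    [beta = q - p + 1].  The two principal terms are then bounded below pointwise.

    In the local term, Euler's identity for the homogeneous function [H] and the
    bound of its gradient in the dual norm ([finsler_field_euler],
    [finsler_field_le]) leave [beta * X `^ p - p * X `^ (p - 1) * Y] with
    [X = u `^ ((q - p) / p) * eta * H (Du)] and [Y = u `^ (q / p) * H (grad eta)].
    Young's inequality with weight [beta / p] ([local_lower_bound]) turns it into
    [(beta / p) * X `^ p - (beta / p) `^ (1 - p) * Y `^ p]; division by [beta / p]
    produces the two gradient terms with the stated constants.

    In the nonlocal term, pairs of points of [Omega'] are covered by an algebraic
    inequality ([nonlocal_lower_bound]) whose constant [(p - 1) `^ (p - 1)] does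
    not involve [q].  If one point lies outside [Omega'], where [phi] vanishes,
    then [|a - b| `^ (p - 2) * (a - b) >= - |b| `^ (p - 1)] for [a >= 0]
    ([exterior_lower_bound]), and Tonelli's theorem leaves the tail of [u]
    integrated against [phi]; the two positions of the exterior point give the
    factor 2.  Since only a lower bound is wanted, it suffices to dominate the
    negative part of the integrand ([ae_lower_bound_integral]).

    The remaining work is to show that [phi] belongs to [W_0^{1,p}], with the
    gradient predicted by the chain and product rules ([power_test_function]).
    The chain rule is obtained from difference quotients.  The fundamental theorem
    of calculus along lines, in weak form, says that almost everywhere
    [u (x + h *: e) - u x] is the integral of the weak derivative over the segment
    ([difference_ae]).  Convexity of the power function compares the difference
    quotients of [u `^ beta] with those of [u], from one side; replacing [e] by
    [- e] gives the other side ([chain_rule]).  The passage to the limit needs only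
    dominated convergence, once the averages of a bounded function along segments
    are known to converge almost everywhere ([davg_cvg]), which follows from the
    one-dimensional differentiation theorem and the translation invariance of
    Lebesgue measure.  The weak derivative of [u] is tested only with an explicit
    family of smooth bumps converging to indicators of boxes. *)

Import Order.TTheory GRing.Theory Num.Theory.
Import numFieldNormedType.Exports.
Local Open Scope classical_set_scope.
Local Open Scope ring_scope.
Set Implicit Arguments.
Unset Strict Implicit.
Unset Printing Implicit Defensive.

(** * Young inequalities and the pointwise nonlocal bound *)

Section algebra.
Variable R : realType.
Implicit Types p x y a b s t : R.

Lemma young_powR p x y : 1 < p -> 0 <= x -> 0 <= y ->
  p * (x `^ (p - 1) * y) <= (p - 1) * x `^ p + y `^ p.
Proof.
move=> p1 x0 y0; have p0 : 0 < p by lra.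
have := @conjugate_powR R (x `^ (p - 1)) y (p / (p - 1)) p.
move=> /(_ (powR_ge0 _ _) y0).
have -> : 0 < p / (p - 1) by rewrite divr_gt0//; lra.
move=> /(_ isT p0) h.
have /h : (p / (p - 1))^-1 + p^-1 = 1 by rewrite invf_div; field; lra.
rewrite -powRrM (_ : (p - 1) * (p / (p - 1)) = p); last by field; lra.
move=> {}h; have := ler_wpM2l (ltW p0) h.
rewrite mulrDr [p * (y `^ p / p)]mulrCA mulfV ?mulr1; last by lra.
by rewrite (_ : p * (x `^ p / (p / (p - 1))) = (p - 1) * x `^ p)//; field; lra.
Qed.

(** Rescaling [x] by [l] in Young's inequality and dividing by [l `^ (p - 1)]. *)
Lemma young_powR_scaled p l x y : 1 < p -> 0 < l -> 0 <= x -> 0 <= y ->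
  p * (x `^ (p - 1) * y) <= (p - 1) * l * x `^ p + l `^ (1 - p) * y `^ p.
Proof.
move=> p1 l0 x0 y0.
have := young_powR p1 (mulr_ge0 (ltW l0) x0) y0.
rewrite !powRM ?(ltW l0)// => h.
have lp : 0 < l `^ (1 - p) by exact: powR_gt0.
have := ler_wpM2l (ltW lp) h.
have e1 : l `^ (1 - p) * l `^ (p - 1) = 1.
  by rewrite -powRD ?(gt_eqF l0)// ?implybT// (_ : 1 - p + (p - 1) = 0) ?powRr0//; ring.
have e2 : l `^ (1 - p) * l `^ p = l.
  by rewrite -powRD ?(gt_eqF l0)// ?implybT// (_ : 1 - p + p = 1) ?powRr1 ?ltW//; ring.
rewrite (_ : _ * (p * _) = (l `^ (1 - p) * l `^ (p - 1)) * (p * (x `^ (p - 1) * y))); last by ring.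
rewrite e1 mul1r mulrDr.
have -> : l `^ (1 - p) * ((p - 1) * (l `^ p * x `^ p)) =
    (p - 1) * (l `^ (1 - p) * l `^ p) * x `^ p by ring.
by rewrite e2.
Qed.

Lemma powR_tangent p a b : 1 < p -> 0 <= a -> 0 <= b ->
  p * b `^ (p - 1) * (a - b) <= a `^ p - b `^ p.
Proof.
move=> p1 a0 b0; have := young_powR p1 b0 a0.
have : b * b `^ (p - 1) = b `^ p by rewrite mulr_powRB1//; lra.
move=> <-; nra.
Qed.

Lemma ler_powR_base p a b : 0 <= p -> 0 <= a -> a <= b -> a `^ p <= b `^ p.
Proof.
by move=> p0 a0 ab; apply: ge0_ler_powR => //; rewrite nnegrE ?(le_trans a0).
Qed.

Let nonlocal_wlog p q a b s t : 1 < p -> p < q -> 0 <= a -> 0 <= b ->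
  0 <= s -> 0 <= t -> b <= a ->
  - ((p - 1) `^ (p - 1) * (a `^ q + b `^ q) * `|s - t| `^ p) <=
  `|a - b| `^ (p - 2) * (a - b) *
    (a `^ (q - p + 1) * s `^ p - b `^ (q - p + 1) * t `^ p).
Proof.
move=> p1 pq a0 b0 s0 t0 ba.
have B1 : 1 < q - p + 1 by lra.
have C0 := powR_ge0 (p - 1) (p - 1).
have [ab|ab] := eqVneq a b.
  rewrite ab subrr mulr0 mul0r oppr_le0.
  by rewrite mulr_ge0 ?mulr_ge0 ?addr_ge0 ?powR_ge0.
have {ab}ab : b < a by rewrite lt_neqAle eq_sym ab.
have d0 : 0 < a - b by lra.
have a00 : 0 < a by lra.
have -> : `|a - b| `^ (p - 2) * (a - b) = (a - b) `^ (p - 1).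
  rewrite gtr0_norm// mulrC (_ : p - 2 = (p - 1) - 1); last by ring.
  by rewrite mulr_powRB1//; lra.
have bB : b `^ (q - p + 1) <= a `^ (q - p + 1) by apply: ler_powR_base => //; lra.
have [ts|st] := leP t s.
  have tp : t `^ p <= s `^ p by apply: ler_powR_base => //; lra.
  apply: (@le_trans _ _ 0).
    by rewrite oppr_le0 mulr_ge0 ?mulr_ge0 ?addr_ge0 ?powR_ge0.
  rewrite mulr_ge0 ?powR_ge0// subr_ge0 ler_pM ?powR_ge0//.
(* This Young weight makes the coefficient of [t `^ p] equal to [(a - b) / a]. *)
pose e := (a - b) / a / (p - 1).
have e0 : 0 < e by rewrite !divr_gt0//; lra.
have H1 : t `^ p - s `^ p <= (a - b) / a * t `^ p + e `^ (1 - p) * (t - s) `^ p.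
  have h1 := powR_tangent p1 s0 t0.
  have h2 : p * (t `^ (p - 1) * (t - s)) <=
      (p - 1) * e * t `^ p + e `^ (1 - p) * (t - s) `^ p.
    by apply: young_powR_scaled => //; lra.
  have <- : (p - 1) * e = (a - b) / a by rewrite /e; field; lra.
  by apply: le_trans h2; lra.
have H2 : a `^ (q - p + 1) * ((a - b) / a) <= a `^ (q - p + 1) - b `^ (q - p + 1).
  have ea : a * a `^ (q - p + 1 - 1) = a `^ (q - p + 1) by rewrite mulr_powRB1//; lra.
  have eb : b * b `^ (q - p + 1 - 1) = b `^ (q - p + 1) by rewrite mulr_powRB1//; lra.
  have : b `^ (q - p + 1 - 1) <= a `^ (q - p + 1 - 1).
    by apply: ler_powR_base => //; lra.
  rewrite -ea -eb => h.
  rewrite (_ : a * _ * _ = a `^ (q - p + 1 - 1) * (a - b)); first by nra.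
  by field; lra.
have H3 : (a - b) `^ (p - 1) * a `^ (q - p + 1) * e `^ (1 - p) =
    (p - 1) `^ (p - 1) * a `^ q.
  have [d0' a0' pp] : [/\ 0 <= a - b, 0 <= a & 0 <= p - 1] by split; lra.
  rewrite /e !powRM ?invr_ge0 ?divr_ge0//.
  rewrite -(powR_inv1 a0') -(powR_inv1 pp).
  rewrite -!powRrM !mulN1r opprB.
  rewrite (_ : _ * _ = ((a - b) `^ (p - 1) * (a - b) `^ (1 - p)) *
    (a `^ (q - p + 1) * a `^ (p - 1)) * (p - 1) `^ (p - 1)); last by ring.
  rewrite -!powRD ?(gt_eqF d0) ?(gt_eqF a00) ?implybT//.
  rewrite (_ : p - 1 + (1 - p) = 0) ?powRr0; last by ring.
  by rewrite (_ : q - p + 1 + (p - 1) = q); [rewrite mul1r mulrC|ring].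
rewrite [`|s - t|]distrC (gtr0_norm (_ : 0 < t - s)); last by lra.
apply: (@le_trans _ _ (- ((p - 1) `^ (p - 1) * a `^ q * (t - s) `^ p))).
  rewrite lerN2 ler_wpM2r ?powR_ge0// ler_wpM2l// lerDl powR_ge0//.
rewrite -H3.
set D := (a - b) `^ (p - 1); set A := a `^ (q - p + 1).
rewrite (_ : - _ = D * - (A * (e `^ (1 - p) * (t - s) `^ p))); last by ring.
rewrite ler_wpM2l ?powR_ge0//.
have A0 : 0 <= A by exact: powR_ge0.
have T0 : 0 <= t `^ p by exact: powR_ge0.
have := ler_wpM2l A0 H1; have := ler_wpM2r T0 H2; rewrite -/A; lra.
Qed.

(** By symmetry [b <= a], and only [s < t] is at stake: for [t <= s] the right-hand
    side is nonnegative.  The tangent inequality and Young bound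
    [t `^ p - s `^ p] by [(a - b) / a * t `^ p] plus a multiple of
    [(t - s) `^ p].  The first summand is absorbed by
    [a `^ (q - p + 1) - b `^ (q - p + 1)], and in the second one the powers of
    [a - b] cancel, which leaves [a `^ q] with a constant independent of [q]. *)
Lemma nonlocal_lower_bound p q a b s t : 1 < p -> p < q -> 0 <= a -> 0 <= b ->
  0 <= s -> 0 <= t ->
  - ((p - 1) `^ (p - 1) * (a `^ q + b `^ q) * `|s - t| `^ p) <=
  `|a - b| `^ (p - 2) * (a - b) *
    (a `^ (q - p + 1) * s `^ p - b `^ (q - p + 1) * t `^ p).
Proof.
move=> p1 pq a0 b0 s0 t0; have [ba|/ltW ab] := leP b a.
  exact: nonlocal_wlog.
have := nonlocal_wlog p1 pq b0 a0 t0 s0 ab.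
rewrite distrC [`|b - a|]distrC [b `^ q + _]addrC.
by rewrite -(opprB a b) mulrN mulNr -mulrN opprB.
Qed.

End algebra.

(** * Finsler norms *)

Section calculus_facts.
Context {R : realType} {N : nat}.
Implicit Types (x y v : 'rV[R]_N) (f : 'rV[R]_N -> R).

Lemma derive_dotv_grad f x v : differentiable f x ->
  'D_v f x = dotv (grad f x) v.
Proof.
move=> df; rewrite deriveE// {1}(row_sum_delta v) linear_sum /dotv.
by apply: eq_bigr => i _; rewrite linearZ /= mxE /partial deriveE// mulrC.
Qed.

Lemma enorm_continuous : continuous (@enorm R N).
Proof.
move=> x; apply: (@continuous_comp _ _ _ (fun x => \sum_i x ord0 i ^+ 2) Num.sqrt).
  have F : Filter (nbhs (x : 'rV[R]_N)) by exact: nbhs_filter.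
  apply: (@cvg_big _ _ +%R 0 _ (@add_continuous R)) => i _.
  by apply: (@continuous_comp _ _ _ (fun x : 'rV[R]_N => x ord0 i) (fun t : R => t ^+ 2));
    [exact: coord_continuous|exact: exprn_continuous].
exact: sqrt_continuous.
Qed.

Lemma enorm0 : enorm (0 : 'rV[R]_N) = 0.
Proof. by rewrite /enorm big1 ?sqrtr0// => i _; rewrite mxE expr0n. Qed.

Lemma dotvDr x y z : dotv x (y + z) = dotv x y + dotv x z.
Proof. by rewrite /dotv -big_split; apply: eq_bigr => i _; rewrite mxE mulrDr. Qed.

Lemma dotvZr a x y : dotv x (a *: y) = a * dotv x y.
Proof. by rewrite /dotv mulr_sumr; apply: eq_bigr => i _; rewrite mxE mulrCA. Qed.

Lemma dotvZl a x y : dotv (a *: x) y = a * dotv x y.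
Proof. by rewrite /dotv mulr_sumr; apply: eq_bigr => i _; rewrite mxE mulrA. Qed.

Lemma dotv0l y : dotv 0 y = 0.
Proof. by rewrite /dotv big1// => i _; rewrite mxE mul0r. Qed.

End calculus_facts.

Section finsler.
Context {R : realType} {N : nat} (H : 'rV[R]_N -> R).
Hypothesis HH : finsler_minkowski H.
Implicit Types (x y xi v : 'rV[R]_N).

Lemma finsler0 : H 0 = 0.
Proof. exact/(finsler_eq0 HH). Qed.

(** Strict convexity speaks of free pairs only; on a dependent pair the inequality
    is the triangle inequality of the scalars. *)
Lemma finsler_subadd x y : H (x + y) <= H x + H y.
Proof.
have [/(finsler_strict HH)/ltW//|] := boolP (free [:: x; y]).
rewrite free_cons seq1_free negb_and !negbK span_seq1 => /orP[/vlineP[c ->]|/eqP ->].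
  rewrite (_ : c *: y + y = (c + 1) *: y); last by rewrite scalerDl scale1r.
  rewrite !(finslerZ HH) -[X in _ <= _ + X]mul1r -mulrDl ler_wpM2r ?(finsler_ge0 HH)//.
  by rewrite (le_trans (ler_normD _ _))// normr1.
by rewrite addr0 finsler0 addr0.
Qed.

Lemma finsler_dist x y : `|H x - H y| <= H (x - y).
Proof.
have sym a b : H (a - b) = H (b - a).
  by rewrite -opprB -scaleN1r (finslerZ HH) normrN1 mul1r.
rewrite ler_distl; apply/andP; split.
  by have := finsler_subadd (y - x) x; rewrite subrK sym; lra.
by have := finsler_subadd (x - y) y; rewrite subrK; lra.
Qed.

Lemma finsler_continuous : continuous H.
Proof.
move=> x; have [C1 [C2 [C10 C20 HC]]] := finsler_equiv HH.
have F : Filter (nbhs (x : 'rV[R]_N)) by exact: nbhs_filter.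
apply/cvgrPdist_le => e e0.
have : enorm (y - x) @[y --> x] --> 0.
  rewrite -(@enorm0 R N) -(subrr x); apply: continuous_comp; last exact: enorm_continuous.
  by apply: cvgB; [exact: cvg_id|exact: cvg_cst].
move/cvgrPdist_le => /(_ (e / C2) (divr_gt0 e0 C20)); apply: filterS => y.
rewrite sub0r normrN ger0_norm ?sqrtr_ge0// ler_pdivlMr// => h.
rewrite distrC (le_trans (finsler_dist _ _))//.
by have /andP[_ /le_trans] := HC (y - x); apply; rewrite mulrC.
Qed.

Let difH xi : xi != 0 -> differentiable H xi.
Proof. by move=> xi0; have [] := finsler_C1 HH xi0. Qed.

(** The difference quotients of a norm in the direction [v] are bounded by the
    norm of [v]: the dual norm of the gradient is at most [1]. *)
Lemma finsler_grad_le xi v : xi != 0 -> `|dotv (grad H xi) v| <= H v.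
Proof.
move=> xi0; rewrite -derive_dotv_grad; last exact: difH.
have dv : derivable H xi v by apply: diff_derivable; exact: difH.
have c := @cvg_norm _ _ _ _ (dnbhs_filter _) _ _ dv; rewrite -/('D_v H xi) in c.
rewrite -(cvg_lim _ c)//; apply: limr_le; first by apply/cvg_ex; eexists; exact: c.
  near=> h; have h0 : h != 0 by near: h; exact: nbhs_dnbhs_neq.
  rewrite normrZ normfV ler_pdivrMl ?normr_gt0// -(finslerZ HH).
  by rewrite (le_trans (finsler_dist _ _))//= addrK.
Unshelve. all: by end_near. Qed.

(** On the ray through [xi] the function [H] is linear near [xi], so the difference
    quotient in the direction [xi] is constant. *)
Lemma finsler_euler xi : xi != 0 -> dotv (grad H xi) xi = H xi.
Proof.
move=> xi0; rewrite -derive_dotv_grad; last exact: difH.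
apply: cvg_lim => //.
apply: (@cvg_trans _ (H xi @[h --> (0 : R)^'])); last exact: cvg_cst.
apply: near_eq_cvg; near=> h.
have h0 : h != 0 by near: h; exact: nbhs_dnbhs_neq.
have h1 : `|h| < 1.
  by near: h; apply: dnbhs0_lt.
rewrite /= -[X in H (_ + X)]scale1r -scalerDl (finslerZ HH) -[X in _ - X]mul1r.
rewrite -mulrBl ger0_norm; last by move: h1; rewrite ltr_norml => /andP[]; lra.
by rewrite addrK /GRing.scale /= mulrA mulVf// mul1r.
Unshelve. all: by end_near. Qed.

End finsler.

(** * Smooth bump functions on boxes *)

Section flat.
Context {R : realType}.
Implicit Types (x : R) (k : nat).

(** The derivatives of [expR (- x^-1)] on the positive half-line are linear
    combinations of these functions, which makes the family stable under
    differentiation. *)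
Definition flat k x : R := if 0 < x then x ^- k * expR (- x^-1) else 0.

Lemma flat_ge0 k x : 0 <= flat k x.
Proof.
rewrite /flat; case: ifPn => // x0.
by rewrite mulr_ge0 ?expR_ge0// invr_ge0 exprn_ge0 ?ltW.
Qed.

Lemma flat0_le1 x : flat 0 x <= 1.
Proof.
rewrite /flat; case: ifPn => // x0; rewrite expr0 invr1 mul1r -expR0 ler_expR.
by rewrite lerNl oppr0 invr_ge0 ltW.
Qed.

Lemma flat_eq0 k x : x <= 0 -> flat k x = 0.
Proof. by rewrite /flat ltNge => ->. Qed.

(** The quadratic bound that makes the difference quotient of [flat k] at [0] tend
    to [0]. *)
Lemma flat_le k x : flat k x <= (k.+2)`!%:R * x ^+ 2.
Proof.
rewrite /flat; case: ifPn => x0; last by rewrite mulr_ge0 ?sqr_ge0.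
have xi0 : 0 < x^-1 by rewrite invr_gt0.
have := expR_ge1Dxn k.+1 (ltW xi0).
have -> : x^-1 ^+ k.+2 = x ^- k * x ^- 2 by rewrite -invfM -exprD addn2 exprVn.
set E := expR _ => h.
have E0 : 0 < E by exact: expR_gt0.
rewrite expRN ler_pdivrMr//.
have k0 : 0 < (k.+2)`!%:R :> R by rewrite ltr0n fact_gt0.
have {}h : x ^- k * x ^- 2 <= E * (k.+2)`!%:R.
  by rewrite -ler_pdivrMr//; apply: le_trans h; rewrite lerDr.
have x2 : 0 < x ^+ 2 by exact: exprn_gt0.
have := ler_wpM2r (ltW x2) h.
rewrite -mulrA mulVf ?gt_eqF// mulr1 => /le_trans; apply.
by rewrite -/E -mulrA mulrC.
Qed.

Lemma is_derive_flat k x :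
  is_derive x 1 (flat k) (- k%:R * flat k.+1 x + flat k.+2 x).
Proof.
have [x0|x0|->] := ltrgtP x 0.
- rewrite !flat_eq0 ?ltW// mulr0 addr0.
  apply: (@near_eq_is_derive _ _ _ (cst 0)).
  by apply: filterS (lt_nbhsl x0) => y y0; rewrite flat_eq0// ltW.
- apply: (@near_eq_is_derive R _ _ (fun y : R => (y^-1) ^+ k * expR (- y^-1))).
    by apply: filterS (lt_nbhsr x0) => y y0; rewrite /flat exprVn y0.
  have dV : is_derive x 1 (fun y : R => y^-1) (- x ^- 2).
    apply: is_derive_eq; first by apply: (@is_deriveV _ id); rewrite ?gt_eqF.
    by rewrite /GRing.scale /= mulr1.
  have dE : is_derive x 1 (expR \o (fun y : R => - y^-1)) (expR (- x^-1) * x ^- 2).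
    apply: is_derive1_comp.
    by have := is_deriveN dV; rewrite opprK.
  have := is_deriveM (is_deriveX k dV) dE.
  rewrite (_ : (fun y : R => y^-1) ^+ k = fun y => y^-1 ^+ k); last by rewrite exprfctE.
  move=> dM.
  apply: (is_derive_eq dM).
  rewrite /flat x0 /GRing.scale /=.
  rewrite -!exprVn.
  case: k {dM} => [|k]; first by rewrite !expr0 oppr0 !mul0r mulr0 addr0 add0r; ring.
  by rewrite /= !exprS; ring.
- rewrite !flat_eq0// mulr0 addr0.
  have c : h^-1 *: ((flat k \o shift 0) (h *: 1) - flat k 0) @[h --> (0 : R)^'] --> (0 : R).
    apply: (@cvg_to_0_linear _ _ (k.+2)`!%:R 1) => // h /andP[h0 _].
    rewrite /= [flat k 0]flat_eq0// subr0 addr0 normrZ normfV ler_pdivrMl//.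
    rewrite [h *: 1]mulr1 ger0_norm ?flat_ge0// (le_trans (flat_le _ _))//.
    by rewrite -(real_normK (num_real h)) expr2 mulrCA.
  by apply: DeriveDef; [apply/cvg_ex; exists 0|exact: cvg_lim].
Qed.

End flat.

Section smooth_functions.
Context {R : realType} {N : nat}.
Implicit Types (f g : 'rV[R]_N -> R).

(** Finite orders of differentiability, set up so that stability under
    sums and products goes by induction on the order. *)
Fixpoint smoothn n f : Prop :=
  (forall x, differentiable f x) /\
  if n is m.+1 then forall i, smoothn m (partial i f) else True.

Lemma smoothn_diff n f x : smoothn n f -> differentiable f x.
Proof. by case: n => [[]|n []]. Qed.

Lemma smoothnW n f : smoothn n.+1 f -> smoothn n f.
Proof.
elim: n f => [f [df _]//|n IH f [df sf]]; split => // i; apply: IH; exact: sf.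
Qed.

Lemma smooth_smoothn f : (forall n, smoothn n f) -> smooth f.
Proof.
move=> sf l; move: (sf (size l)); elim/last_ind: l f {sf} => [f sf x|l i IH f].
  exact: smoothn_diff sf.
by rewrite size_rcons foldr_rcons => -[_ /(_ i)]; exact: IH.
Qed.

Lemma eq_smoothn n f g : f = g -> smoothn n f -> smoothn n g.
Proof. by move=> ->. Qed.

Lemma partialD i f g : (forall x, differentiable f x) ->
  (forall x, differentiable g x) -> partial i (f \+ g) = partial i f \+ partial i g.
Proof.
move=> df dg; apply/funext => x; rewrite /partial.
by apply: deriveD; exact: diff_derivable.
Qed.

Lemma partialM i f g : (forall x, differentiable f x) ->
  (forall x, differentiable g x) ->
  partial i (f \* g) = (f \* partial i g) \+ (g \* partial i f).
Proof.
move=> df dg; apply/funext => x; rewrite /partial.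
by apply: deriveM; exact: diff_derivable.
Qed.

Lemma smoothnD n f g : smoothn n f -> smoothn n g -> smoothn n (f \+ g).
Proof.
elim: n f g => [f g [df _] [dg _]|n IH f g [df sf] [dg sg]].
  by split => // x; exact: differentiableD.
split => [x|i]; first exact: differentiableD.
by rewrite partialD//; apply: IH; [exact: sf|exact: sg].
Qed.

Lemma smoothnM n f g : smoothn n f -> smoothn n g -> smoothn n (f \* g).
Proof.
elim: n f g => [f g [df _] [dg _]|n IH f g sf sg].
  by split => // x; exact: differentiableM.
have [df sf'] := sf; have [dg sg'] := sg.
split => [x|i]; first exact: differentiableM.
rewrite partialM//; apply: smoothnD; apply: IH.
- exact: smoothnW.
- exact: sg'.
- exact: smoothnW.
- exact: sf'.
Qed.

Lemma smoothn_cst n (c : R) : smoothn n (fun _ : 'rV[R]_N => c).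
Proof.
elim: n c => [c|n IH c]; first by split => // x; exact: differentiable_cst.
split => [x|i]; first exact: differentiable_cst.
rewrite (_ : partial i _ = fun=> 0); first exact: IH.
by apply/funext => x; exact: derive_cst.
Qed.

Lemma smoothn_big (I : Type) n (r : seq I) (F : I -> 'rV[R]_N -> R) :
  (forall i, smoothn n (F i)) -> smoothn n (fun x => \prod_(i <- r) F i x).
Proof.
move=> sF; elim: r => [|i r IH].
  by apply: eq_smoothn (smoothn_cst n 1); apply/funext => x; rewrite big_nil.
apply: eq_smoothn (smoothnM (sF i) IH).
by apply/funext => x; rewrite big_cons.
Qed.

(** An affine function of one coordinate inside [flat]: the class is stable under
    partial derivatives up to linear combinations. *)
Definition edge k (c d : R) (i : 'I_N) (x : 'rV[R]_N) : R :=
  flat k (c * x ord0 i + d).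

Lemma is_derive_edge k c d i j x :
  differentiable (edge k c d i) x /\
  partial j (edge k c d i) x =
    c * (i == j)%:R * (- k%:R * edge k.+1 c d i x + edge k.+2 c d i x).
Proof.
pose a (x : 'rV[R]_N) : R := c * x ord0 i + d.
have da y : differentiable a y.
  apply: differentiableD; last exact: differentiable_cst.
  by apply: differentiableM; [exact: differentiable_cst|exact: differentiable_coord].
have df y : differentiable (flat k) y.
  by apply/derivable1_diffP; have [] := is_derive_flat k y.
split; first by apply: (@differentiable_comp _ _ _ _ a (flat k)).
rewrite /partial /edge -/(a x).
have Da : is_derive (0 : R) 1 (fun t => a (t *: delta_mx ord0 j + x)) (c * (i == j)%:R).
  rewrite (_ : (fun t => _) = fun t => c * (i == j)%:R * t + a x); last first.
    by apply/funext => t; rewrite /a !mxE eqxx /=; ring.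
  apply: is_derive_eq.
  by rewrite addr0 /GRing.scale /= mulr1.
have := @is_derive1_comp _ (flat k) _ 0 _ _ _ Da.
rewrite scale0r add0r => /(_ _ (is_derive_flat k (a x)))[_ h].
rewrite mulrC -[in RHS]h /derive; apply: (congr1 (fun F : R -> R => lim (F @ (0 : R)^'))).
by apply/funext => t /=; rewrite scale0r add0r addr0 [t *: 1]mulr1.
Qed.

Lemma smoothn_edge n k c d i : smoothn n (edge k c d i).
Proof.
elim: n k c d i => [k c d i|n IH k c d i].
  by split => // x; have [] := is_derive_edge k c d i i x.
split => [x|j]; first by have [] := is_derive_edge k c d i i x.
rewrite (_ : partial j _ = (fun=> c * (i == j)%:R) \*
    (((fun=> - k%:R) \* edge k.+1 c d i) \+ edge k.+2 c d i)); last first.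
  by apply/funext => x; have [_ ->] := is_derive_edge k c d i j x.
apply: smoothnM; first exact: smoothn_cst.
by apply: smoothnD => //; apply: smoothnM => //; exact: smoothn_cst.
Qed.

End smooth_functions.

Section bump.
Context {R : realType} {N : nat}.
Implicit Types (a b x v : 'rV[R]_N) (V : set 'rV[R]_N).

Definition box a b := [set x : 'rV[R]_N | forall i, a ord0 i < x ord0 i < b ord0 i].

Definition cbox a b := [set x : 'rV[R]_N | forall i, x ord0 i \in `[a ord0 i, b ord0 i]].

(** The two factors in each coordinate vanish at the two faces of the box; the
    factor [n.+1] steepens them, so that the bumps tend to the indicator of the box
    while their supports stay inside the closed box. *)
Definition bump n a b x : R := \prod_(i < N)
  (edge 0 n.+1%:R (- n.+1%:R * a ord0 i) i x *
   edge 0 (- n.+1%:R) (n.+1%:R * b ord0 i) i x).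

Lemma smoothn_bump m n a b : smoothn m (bump n a b).
Proof. by apply: smoothn_big => i; apply: smoothnM; exact: smoothn_edge. Qed.

Lemma bumpE n a b x : bump n a b x = \prod_(i < N)
  (flat 0 (n.+1%:R * (x ord0 i - a ord0 i)) * flat 0 (n.+1%:R * (b ord0 i - x ord0 i))).
Proof. by apply: eq_bigr => i _; congr (flat 0 _ * flat 0 _); ring. Qed.

Lemma bump_ge0 n a b x : 0 <= bump n a b x.
Proof. by rewrite bumpE prodr_ge0// => i _; rewrite mulr_ge0 ?flat_ge0. Qed.

Lemma bump_le1 n a b x : bump n a b x <= 1.
Proof.
rewrite bumpE; apply: prodr_ile1 => i _.
by rewrite mulr_ge0 ?flat_ge0//= mulr_ile1 ?flat_ge0 ?flat0_le1.
Qed.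

Lemma bump_out n a b x : ~ box a b x -> bump n a b x = 0.
Proof.
move=> /existsNP[i /negP]; rewrite negb_and -!leNgt => h.
rewrite bumpE (bigD1 i)//= (_ : _ * _ = 0) ?mul0r//.
case/orP: h => h.
  by rewrite (flat_eq0 0) ?mul0r// mulr_ge0_le0// subr_le0.
by rewrite [X in _ * X * _]flat_eq0 ?mulr0 ?mul0r// mulr_ge0_le0// subr_le0.
Qed.

Lemma bump_shift n a b x v : bump n a b (x - v) = bump n (a + v) (b + v) x.
Proof.
rewrite !bumpE; apply: eq_bigr => i _; rewrite !mxE.
by congr (flat 0 (_ * _) * flat 0 (_ * _)); ring.
Qed.

Let flat_cvg (y : R) : flat 0 (n.+1%:R * y) @[n --> \oo] --> ((0 < y)%R%:R : R).
Proof.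
have [y0|y0] := ltP 0 y; last first.
  rewrite (_ : (fun _ => _) = fun=> 0); first exact: cvg_cst.
  by apply/funext => n; rewrite flat_eq0// mulr_ge0_le0.
rewrite (_ : (fun _ => _) = fun n : nat => expR (- (n.+1%:R^-1 * y^-1))); last first.
  apply/funext => n; rewrite /flat mulr_gt0// expr0 invr1 mul1r invfM//.
rewrite -[X in _ --> X](expR0 R); apply: continuous_cvg; first exact: continuous_expR.
rewrite -oppr0; apply: cvgN; rewrite -[X in _ --> X](mul0r y^-1).
by apply: cvgMl; exact: cvg_harmonic.
Qed.

Lemma bump_cvg a b x : bump n a b x @[n --> \oo] --> (\1_(box a b) x : R).
Proof.
rewrite (_ : \1_(box a b) x = \prod_(i < N)
    (((0 < x ord0 i - a ord0 i)%R%:R : R) * (0 < b ord0 i - x ord0 i)%R%:R)).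
  rewrite (_ : (fun _ => _) = fun n => \prod_(i < N)
    (flat 0 (n.+1%:R * (x ord0 i - a ord0 i)) * flat 0 (n.+1%:R * (b ord0 i - x ord0 i)))); last first.
    by apply/funext => n; rewrite bumpE.
  apply: (@cvg_big R _ *%R 1 xpredT (@mul_continuous R) _ \oo _
    (fun i (n : nat) => flat 0 (n.+1%:R * (x ord0 i - a ord0 i)) *
      flat 0 (n.+1%:R * (b ord0 i - x ord0 i)))) => i _.
  by apply: cvgM; exact: flat_cvg.
rewrite indicE; have [bx|bx] := pselect (box a b x).
  rewrite mem_set// big1// => i _; have /andP[] := bx i.
  by rewrite -[a _ _ < _]subr_gt0 -[_ < b _ _]subr_gt0 => -> ->; rewrite mulr1.
rewrite memNset//; move/existsNP : bx => [i /negP].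
rewrite (bigD1 i)//= !subr_gt0 negb_and => /orP[] /negbTE ->;
 by rewrite ?(mul0r, mulr0).
Qed.

Lemma cbox_compact a b : compact (cbox a b).
Proof. by apply: (@rV_compact _ _ (fun i => `[a ord0 i, b ord0 i]%classic)) => i; exact: segment_compact. Qed.

Lemma box_sub_cbox a b : box a b `<=` cbox a b.
Proof. by move=> x bx i; rewrite in_itv /=; have /andP[/ltW -> /ltW ->] := bx i. Qed.

Lemma closed_cbox a b : closed (cbox a b).
Proof. by apply: compact_closed; [exact: norm_hausdorff|exact: cbox_compact]. Qed.

Lemma spt_bump n a b : spt (bump n a b) `<=` cbox a b.
Proof.
rewrite /spt closureE => x; apply; split; first exact: closed_cbox.
move=> y /=; apply: contra_neqP => by_.
by rewrite bump_out// => /box_sub_cbox.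
Qed.

Lemma bump_test_function n a b V : cbox a b `<=` V -> test_function V (bump n a b).
Proof.
move=> abV; split; last by move=> x /spt_bump /abV.
  by apply: smooth_smoothn => m; exact: smoothn_bump.
apply: (@subclosed_compact 'rV[R]_N _ (cbox a b)).
- exact: closed_closure.
- exact: cbox_compact.
- exact: spt_bump.
Qed.

End bump.

(** * Lebesgue measure on row vectors *)

#[local] Opaque lebesgue_rV.

Section lebesgue_facts.
Context {R : realType} {N : nat}.
Local Notation leb := (@lebesgue_rV R N).
Implicit Types (a b v x : 'rV[R]_N) (A D K U : set 'rV[R]_N).

Definition boxes : set (set 'rV[R]_N) := [set A | exists a b, A = box a b].

Lemma boxI a b a' b' : box a b `&` box a' b' =
  box (\row_i Num.max (a ord0 i) (a' ord0 i)) (\row_i Num.min (b ord0 i) (b' ord0 i)).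
Proof.
apply/seteqP; split => [x [h h'] i|x h].
  by rewrite !mxE gt_max lt_min; have /andP[-> ->] := h i; have /andP[-> ->] := h' i.
by split => i; have := h i; rewrite !mxE gt_max lt_min => /andP[/andP[h1 h2] /andP[h3 h4]]; apply/andP.
Qed.

Lemma setI_closed_boxes : setI_closed boxes.
Proof. by move=> _ _ [a [b ->]] [a' [b' ->]]; rewrite boxI; do 2 eexists. Qed.

Lemma measurable_box a b : measurable (box a b).
Proof.
rewrite (_ : box a b = \bigcap_(i in [set: 'I_N])
    ((fun x : 'rV[R]_N => x ord0 i) @^-1` `]a ord0 i, b ord0 i[)); last first.
  by apply/seteqP; split => [x h i _|x h i]; [rewrite /= in_itv; exact: h|have := h i I; rewrite /= in_itv].
apply: fin_bigcap_measurable => [|i _].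
  exact: (sub_finite_set (fun _ _ => isT) (finite_finpred 'I_N)).
by rewrite -[X in measurable X]setTI; exact: measurable_coord.
Qed.

Definition cube n : set 'rV[R]_N := box (\row_(i < N) - n%:R) (\row_(i < N) n%:R).

Lemma bigcup_cube : \bigcup_n cube n = setT.
Proof.
apply/seteqP; split => // x _.
pose M := \sum_i `|x ord0 i|; have [n nM] : exists n : nat, M < n%:R.
  by exists (Num.bound M); rewrite archi_boundP// sumr_ge0.
exists n => // i; rewrite !mxE -ltr_norml (le_lt_trans _ nM)//.
by rewrite /M (bigD1 i)//= lerDl sumr_ge0.
Qed.

(** Boxes are stable under intersection, so that this presentation of the Borel sets
    opens the way to uniqueness of measures and to Dynkin induction. *)
Lemma measurable_boxes : @measurable _ 'rV[R]_N = <<s boxes >>.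
Proof.
apply/seteqP; split; last first.
  apply: smallest_sub; first exact: sigma_algebra_measurable.
  by move=> _ [a [b ->]]; exact: measurable_box.
pose id' := (id : g_sigma_algebraType boxes -> 'rV[R]_N).
have mid : measurable_fun setT id'.
  apply: measurable_fun_rV => i; apply: (measurability _ (RGenOpens.measurableE R)).
  move=> _ [_ [c [d ->]] <-]; rewrite setTI.
  rewrite (_ : _ @^-1` _ = \bigcup_n box (\row_j (if j == i then c else - n%:R))
       (\row_j (if j == i then d else n%:R))); last first.
    apply/seteqP; split=> [x xcd|x [n _ /(_ i)]]; last first.
      by rewrite !mxE eqxx /= in_itv.
    have [n _ xn] : (\bigcup_n cube n) x by rewrite bigcup_cube.
    exists n => // j; rewrite !mxE; case: eqP => [->|_].
      by move: xcd; rewrite /= in_itv.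
    by have := xn j; rewrite !mxE.
  by apply: bigcupT_measurable => n; apply: sub_sigma_algebra; do 2 eexists.
by move=> A mA; have := mid measurableT A mA; rewrite setTI.
Qed.

Lemma lebesgue_box a b :
  leb (box a b) = (\prod_(i < N) lebesgue_measure `]a ord0 i, b ord0 i[%classic)%E.
Proof.
rewrite -lebesgue_rV_box//; congr (leb _).
Qed.

Lemma lebesgue_box_lty a b : (leb (box a b) < +oo)%E.
Proof.
rewrite lebesgue_box.
suff : ((\prod_(i < N) lebesgue_measure `]a ord0 i, b ord0 i[%classic)%E \is a fin_num).
  by rewrite fin_numElt => /andP[].
elim/big_ind : _ => // [x y|i _]; first exact: fin_numM.
by rewrite lebesgue_measure_itv; case: ifPn.
Qed.

Definition shift_rV v x : 'rV[R]_N := x + v.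

Lemma measurable_shift_rV v : measurable_fun setT (shift_rV v).
Proof.
apply: measurable_fun_rV => i; rewrite (_ : (fun _ => _) = (fun x => x ord0 i + v ord0 i)).
  by apply: measurable_funD => //; exact: measurable_coord.
by apply/funext => x; rewrite mxE.
Qed.

HB.instance Definition _ v := isMeasurableFun.Build _ _ _ _ (shift_rV v)
  (measurable_shift_rV v).

(** Both measures give a box the product of its side lengths. *)
Lemma lebesgue_shift v A : measurable A -> pushforward leb (shift_rV v) A = leb A.
Proof.
move=> mA; apply/esym.
apply: (@measure_unique _ R 'rV[R]_N boxes cube measurable_boxes setI_closed_boxes
  _ bigcup_cube leb (pushforward leb (shift_rV v))) mA.
- by move=> n; do 2 eexists.
- move=> _ [a [b ->]]; rewrite /= /pushforward.
  rewrite (_ : _ @^-1` _ = box (a - v) (b - v)); last first.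
    by apply/seteqP; split => x h i; have := h i; rewrite !mxE ltrBlDr ltrBrDr.
  rewrite !lebesgue_box; apply: eq_bigr => i _; rewrite !mxE.
  rewrite !lebesgue_measure_itv /= !lte_fin ltrD2r; case: ifPn => // _.
  by rewrite -!EFinB; congr EFin; ring.
- by move=> n; exact: lebesgue_box_lty.
Qed.

Lemma ge0_integral_shift v (f : 'rV[R]_N -> \bar R) : measurable_fun setT f ->
  (forall x, 0 <= f x)%E -> (\int[leb]_x f (x + v)%R = \int[leb]_x f x)%E.
Proof.
move=> mf f0.
transitivity (\int[pushforward leb (shift_rV v)]_x f x)%E.
  by rewrite ge0_integral_pushforward.
apply: (@eq_measure_integral _ _ R setT leb (pushforward leb (shift_rV v)) f).
by move=> A mA _; exact: lebesgue_shift.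
Qed.

Lemma integral_shift v (f : 'rV[R]_N -> \bar R) : measurable_fun setT f ->
  (\int[leb]_x f (x + v)%R = \int[leb]_x f x)%E.
Proof.
move=> mf; rewrite integralE [RHS]integralE; congr (_ - _)%E.
  rewrite -[RHS](ge0_integral_shift v (measurable_funepos mf))//.
  by apply: eq_integral => x _; rewrite !funeposE.
rewrite -[RHS](ge0_integral_shift v (measurable_funeneg mf))//.
by apply: eq_integral => x _; rewrite !funenegE.
Qed.

Lemma measurable_fun_shift d (T : measurableType d) v (f : 'rV[R]_N -> T) :
  measurable_fun setT f -> measurable_fun setT (fun x => f (x + v)).
Proof. by move=> mf; apply: measurableT_comp => //; exact: measurable_shift_rV. Qed.

Lemma integrable_shift v (f : 'rV[R]_N -> \bar R) : leb.-integrable setT f ->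
  leb.-integrable setT (fun x => f (x + v)).
Proof.
move=> /integrableP[mf fi]; apply/integrableP; split; first exact: measurable_fun_shift.
by rewrite (integral_shift v (f := fun x => `|f x|)%E)//; exact: measurableT_comp.
Qed.

Lemma measurable_compact_rV K : compact K -> measurable K.
Proof.
move=> /compact_closed cK; rewrite -[K]setCK; apply: measurableC.
by apply: open_measurable_rV; rewrite openC; apply: cK; exact: norm_hausdorff.
Qed.

Lemma coord_le_norm x i : `|x ord0 i| <= `|x|.
Proof.
rewrite [leRHS](mx_normrE x).
exact: (@le_bigmax _ _ _ 0 (fun ij : 'I_1 * 'I_N => `|x ij.1 ij.2|) (ord0, i)).
Qed.

Lemma compact_sub_cube K : compact K -> exists n : nat, K `<=` cube n.
Proof.
move=> /compact_bounded /ex_strict_bound_gt0[M M0 KM]; exists (Num.bound M) => x Kx i.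
rewrite !mxE -ltr_norml (le_lt_trans (coord_le_norm _ _))//.
by rewrite (lt_trans (KM _ Kx))// archi_boundP// ltW.
Qed.

Lemma lebesgue_compact_lty K : compact K -> (leb K < +oo)%E.
Proof.
move=> cK; have [n Kn] := compact_sub_cube cK.
rewrite (le_lt_trans _ (lebesgue_box_lty (\row_i - n%:R) (\row_i n%:R)))// le_measure// inE.
- exact: measurable_compact_rV.
- exact: measurable_box.
Qed.

End lebesgue_facts.

Section fundamental_lemma.
Context {R : realType} {N : nat}.
Local Notation leb := (@lebesgue_rV R N).
Implicit Types (a b x : 'rV[R]_N) (U : set 'rV[R]_N).

Let ae0_box (v : 'rV[R]_N -> R) a b :
  leb.-integrable setT (EFin \o v) ->
  (forall a' b', cbox a' b' `<=` cbox a b -> (\int[leb]_(x in box a' b') (v x)%:E = 0)%E) ->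
  {ae leb, forall x, box a b x -> v x = 0}.
Proof.
move=> iv v0; have mQ := measurable_box a b.
have iv' A : measurable A -> leb.-integrable A (EFin \o v).
  by move=> mA; apply: integrableS iv.
have key A : measurable A -> (\int[leb]_(x in A `&` box a b) (v x)%:E = 0)%E.
  move=> mA; have := mA; rewrite measurable_boxes.
  apply: (@dynkin_induction _ _ boxes
    (fun A => (\int[leb]_(x in A `&` box a b) (v x)%:E = 0)%E)
    measurable_boxes setI_closed_boxes).
  - by rewrite setTI; exact: v0.
  - move=> _ [a' [b' ->]]; rewrite boxI; apply: v0 => x h i.
    by have := h i; rewrite !in_itv /= !mxE ge_max le_min => /andP[/andP[_ ->] /andP[_ ->]].
  - move=> S mS S0; have := v0 a b (fun _ => id).
    rewrite -[X in (\int[_]_(x in X) _)%E](setUIDK (box a b) S).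
    rewrite integral_setU//.
    + by rewrite setIC S0 add0e setDE setIC.
    + exact: measurableI.
    + exact: measurableD.
    + by rewrite setUIDK; exact: measurable_int (iv' _ mQ).
    + by apply/disj_setPS => x [[_ ?] []].
  - move=> F mF tF F0; rewrite setI_bigcupl integral_bigcup//.
    + by apply: eseries0 => n _ _; exact: F0.
    + exact: trivIset_setIr.
    + by move=> k; apply: measurableI.
    + by apply: iv'; apply: bigcup_measurable => k _; exact: measurableI.
have := @integral_ae_eq _ _ _ leb (box a b) mQ (fun=> 0%E) (EFin \o v) (iv' _ mQ).
move=> /(_ (measurable_cst _)) h.
have : ae_eq leb (box a b) (EFin \o v) (fun=> 0%E).
  apply: h => E Eab mE; rewrite integral0 -[RHS](key _ mE).
  by congr (integral _ _ _); rewrite setIidl.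
by apply: filterS => x /[apply] /= -[].
Qed.

(** Fundamental lemma of the calculus of variations, with indicators of boxes as
    test functions.  Inside one box the boxes generate the Borel sets by Dynkin
    induction, and [U] is a countable union of rational boxes with closure in [U]. *)
Lemma ae0_boxes U (v : 'rV[R]_N -> R) : open U ->
  leb.-integrable setT (EFin \o v) ->
  (forall a b, cbox a b `<=` U -> (\int[leb]_(x in box a b) (v x)%:E = 0)%E) ->
  {ae leb, forall x, U x -> v x = 0}.
Proof.
move=> oU iv v0.
pose lo (ck : 'rV[rat]_N * nat) : 'rV[R]_N := \row_i (ratr (ck.1 ord0 i) - ck.2.+1%:R^-1).
pose hi (ck : 'rV[rat]_N * nat) : 'rV[R]_N := \row_i (ratr (ck.1 ord0 i) + ck.2.+1%:R^-1).
have H n : {ae leb, forall x, if unpickle n is Some ck then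
    cbox (lo ck) (hi ck) `<=` U -> box (lo ck) (hi ck) x -> v x = 0 else True}.
  case: (unpickle n) => [ck|]; last exact: aeW.
  have [sU|nU] := pselect (cbox (lo ck) (hi ck) `<=` U); last first.
    by apply: aeW => x /nU.
  have : {ae leb, forall x, box (lo ck) (hi ck) x -> v x = 0}.
    by apply: ae0_box iv _ => a' b' h; apply: v0 => x /h /sU.
  by apply: filterS => x h _.
have := @ae_foralln _ _ _ leb _ H.
apply: filterS => x hx Ux.
have /nbhs_ballP[e /= e0 xeU] : nbhs x U by exact: open_nbhs_nbhs.
have [k _ ke] : exists2 k : nat, True & k.+1%:R^-1 < e / 2.
  have [k _ /(_ k (leqnn _))/= ke] := near_infty_natSinv_lt (PosNum (divr_gt0 e0 (ltr0n R 2))).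
  by exists k.
have k0 : 0 < k.+1%:R^-1 :> R by rewrite invr_gt0 ltr0n.
have ratx i : {q : rat | `|x ord0 i - ratr q| < k.+1%:R^-1}.
  apply: cid; have := @rat_in_itvoo R (x ord0 i - k.+1%:R^-1) (x ord0 i + k.+1%:R^-1).
  case; first by rewrite ltrBlDr -addrA ltrDl addr_gt0.
  move=> q; rewrite in_itv/= => /andP[q1 q2]; exists q.
  by rewrite distrC ltr_distl q1 q2.
pose ck := (\row_i sval (ratx i), k).
have := hx (pickle ck); rewrite pickleK; apply.
  move=> y yb; apply: xeU; split => // j i; rewrite (ord1 j) -ball_normE /=.
  have := yb i; rewrite in_itv /= !mxE -ler_distlC => yi.
  have := svalP (ratx i); rewrite distrC => xi.
  rewrite (le_lt_trans (ler_distD (ratr (sval (ratx i))) _ _))//.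
  by rewrite (splitr e) ltrD// ?(le_lt_trans yi)// distrC (lt_trans xi).
by move=> i; rewrite !mxE -ltr_distlC distrC; exact: svalP (ratx i).
Qed.

End fundamental_lemma.

(** * Averages along segments *)

Section parametric_integral.
Context d1 d2 (T1 : measurableType d1) (T2 : measurableType d2) (R : realType).
Variables (m1 : {sigma_finite_measure set T1 -> \bar R}).

Lemma measurable_Rintegral1 (D : set T1) (F : T1 -> T2 -> R) : measurable D ->
  measurable_fun setT (fun z : T1 * T2 => F z.1 z.2) ->
  measurable_fun setT (fun y => \int[m1]_(x in D) F x y).
Proof.
move=> mD mF; apply: measurableT_comp => //.
pose G (z : T1 * T2) : \bar R := (F z.1 z.2 * \1_D z.1)%:E.
have mG : measurable_fun setT G.
  apply/measurable_EFinP; apply: measurable_funM => //.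
  by apply: measurableT_comp => //; exact: measurable_indic.
rewrite (_ : (fun _ => _) = (fun y => (\int[m1]_x G^\+ (x, y) - \int[m1]_x G^\- (x, y))%E)).
  apply: emeasurable_funB.
    by apply: measurable_fun_fubini_tonelli_G => //; exact: measurable_funepos.
  by apply: measurable_fun_fubini_tonelli_G => //; exact: measurable_funeneg.
apply/funext => y; rewrite integral_mkcond integralE.
by congr (_ - _)%E; apply: eq_integral => x _; rewrite ?funeposE ?funenegE /G patchE /=;
  rewrite indicE; case: ifPn => xD; rewrite ?(mulr1, mulr0).
Qed.

End parametric_integral.

Section translation_line.
Context {R : realType}.

Definition shift_real (c t : R) : measurableTypeR R := t + c.

Lemma measurable_shift_real c : measurable_fun setT (shift_real c : measurableTypeR R -> _).
Proof. exact: (@measurable_funD _ _ _ setT id (cst c)). Qed.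

HB.instance Definition _ c := isMeasurableFun.Build _ _ _ _ (shift_real c : measurableTypeR R -> _)
  (measurable_shift_real c).

Lemma lebesgue_measure_shift (c : R) (A : set R) : measurable A ->
  pushforward (@lebesgue_measure R) (shift_real c) A = lebesgue_measure A.
Proof.
move=> mA; apply/esym.
apply: (@lebesgue_measure_unique R (pushforward lebesgue_measure (shift_real c))) mA.
move=> _ [[a b]] _ <- /=.
rewrite /pushforward (_ : _ @^-1` _ = `]a - c, b - c]%classic); last first.
  by apply/seteqP; split => x; rewrite /= !in_itv /= ltrBlDr lerBrDr.
rewrite !lebesgue_measure_itv /= !lte_fin ltrD2r; case: ifPn => // _.
by rewrite -!EFinB; congr EFin; ring.
Qed.

Lemma Rintegral_itv_shift (f : R -> R) (h c : R) : measurable_fun setT f ->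
  lebesgue_measure.-integrable `[0, h] (fun t => (f (t + c))%:E) ->
  \int[lebesgue_measure]_(t in `[c, c + h]) f t =
  \int[lebesgue_measure]_(t in `[0, h]) f (t + c).
Proof.
move=> mf fi; congr fine.
have e : shift_real c @^-1` `[c, c + h]%classic = `[0, h]%classic.
  by apply/seteqP; split => x; rewrite /= !in_itv /= /shift_real lerDr (addrC c h) lerD2r.
transitivity (\int[pushforward (@lebesgue_measure R) (shift_real c)]_(t in `[c, (c + h)%R]) (f t)%:E)%E.
  apply: (@eq_measure_integral _ _ R _ (pushforward lebesgue_measure (shift_real c)) lebesgue_measure).
  by move=> A mA _; exact/esym/lebesgue_measure_shift.
rewrite -e; apply: (@integral_pushforward _ _ (measurableTypeR R) (measurableTypeR R) R
  (shift_real c) (measurable_shift_real c) lebesgue_measure _ (EFin \o f)) => //.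
- exact/measurable_EFinP.
- by rewrite e.
Qed.

End translation_line.

Section directional_average.
Context {R : realType} {N : nat}.
Local Notation leb := (@lebesgue_rV R N).
Implicit Types (x e : 'rV[R]_N) (b : 'rV[R]_N -> R).

(** Backwards from [x], because this is the average that appears when the difference
    quotient of a function in the direction [e] is moved to a test function. *)
Definition davg e h b x : R := h^-1 * \int[lebesgue_measure]_(t in `[0, h]) b (x - t *: e).

Lemma measurable_line e : measurable_fun setT (fun z : R * 'rV[R]_N => z.2 - z.1 *: e).
Proof.
apply: measurable_fun_rV => i.
rewrite (_ : (fun _ => _) = (fun z : R * 'rV[R]_N => z.2 ord0 i - z.1 * e ord0 i)).
  apply: measurable_funB.
    by apply: (measurableT_comp (measurable_coord _)).
  by apply: measurable_funM.
by apply/funext => z; rewrite !mxE.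
Qed.

Lemma measurable_davg e h b : measurable_fun setT b -> measurable_fun setT (davg e h b).
Proof.
move=> mb; apply: measurable_funM => //.
apply: (@measurable_Rintegral1 _ _ _ _ R lebesgue_measure `[0, h]%classic (fun t x => b (x - t *: e))) => //.
by apply: (measurableT_comp mb); exact: measurable_line.
Qed.

Lemma measurable_on_line e x b : measurable_fun setT b ->
  measurable_fun setT (fun t : R => b (x - t *: e)).
Proof.
move=> mb; apply: (measurableT_comp (f := fun z : R * 'rV[R]_N => b (z.2 - z.1 *: e)) (g := fun t => (t, x))).
  by apply: (measurableT_comp mb); exact: measurable_line.
exact: measurable_pair2.
Qed.

Let bounded_locally (f : R -> R) (M : R) : measurable_fun setT f -> (forall t, `|f t| <= M) ->
  locally_integrable setT f.
Proof.
move=> mf fM; split => //; first exact: openT.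
move=> K _ cK; have mK : measurable K by exact: compact_measurable.
apply: (@le_lt_trans _ _ (\int[lebesgue_measure]_(x in K) M%:E)%E).
  apply: ge0_le_integral => //.
  - by apply/measurable_EFinP; apply: measurableT_comp => //; exact: measurable_funTS.
  - by move=> x _; rewrite lee_fin (le_trans _ (fM x)).
by rewrite integral_cst// lte_mul_pinfty// ?lee_fin ?(le_trans _ (fM 0))// compact_finite_measure.
Qed.

Let ae_line (f : R -> R) (M : R) : measurable_fun setT f -> (forall t, `|f t| <= M) ->
  {ae lebesgue_measure, forall t,
    n.+1%:R * (\int[lebesgue_measure]_(s in `[t, t + n.+1%:R^-1]) f s) @[n --> \oo] --> f t}.
Proof.
move=> mf fM; have lf := bounded_locally mf fM.
pose E (x : R) (n : nat) := `[x, x + n.+1%:R^-1]%classic : set R.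
have EE (x : R) n : (lebesgue_measure (E x n) = (n.+1%:R^-1)%:E)%E.
  rewrite lebesgue_measure_itv /= lte_fin ltrDl invr_gt0 ltr0n /=.
  by rewrite -EFinB addrAC subrr add0r.
have hE (x : R) : nicely_shrinking x (E x).
  split; first by move=> n; exact: measurable_itv.
  exists (4, fun n => (2 * n.+1%:R^-1)%:pos) => /=; split => //.
  - rewrite -(mulr0 2); apply: cvgMr; exact: cvg_harmonic.
  - move=> n y; rewrite /E /= in_itv /= -ball_normE /= => /andP[xy yx].
    have n0 : 0 < n.+1%:R^-1 :> R by [].
    set r := n.+1%:R^-1 in n0 yx *.
    by rewrite distrC ger0_norm; lra.
  - move=> n; rewrite EE lebesgue_measure_ball// -EFinM lee_fin.
    by rewrite -mulrnAl -mulrnA.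
apply: (@filterS _ _ (ae_filter_ringOfSetsType lebesgue_measure) _ _ _
  (lebesgue_differentiation lf)) => t ft.
have := nice_lebesgue_differentiation hE lf ft.
have fi n : lebesgue_measure.-integrable (E t n) (EFin \o f).
  apply: measurable_bounded_integrable => //.
  - exact: measurable_itv.
  - by apply: compact_finite_measure; exact: segment_compact.
  - exact: measurable_funTS.
  - by exists M; split; [exact: num_real|move=> z Mz y _; exact: le_trans (fM y) (ltW Mz)].
rewrite (_ : (fun _ => _) = (fun n => (n.+1%:R * \int[lebesgue_measure]_(s in E t n) f s)%:E)).
  by move/fine_cvgP => [].
apply/funext => n; rewrite EE inver invr_eq0 pnatr_eq0 /= invrK EFinM fineK//.
by apply: (integrable_fin_num _ (fi n)); exact: measurable_itv.
Qed.

(** On each line parallel to [e] the averages converge at almost every point, by the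
    one-dimensional differentiation theorem.  The exceptional set [Z] therefore
    meets every such line in a null set; integrating over [x] first, translation
    invariance gives [leb Z] for each [t], and Fubini in [R * 'rV_N] forces
    [leb Z = 0]. *)
Lemma davg_cvg e b (M : R) : measurable_fun setT b -> (forall x, `|b x| <= M) ->
  {ae leb, forall x, davg e n.+1%:R^-1 b x @[n --> \oo] --> b x}.
Proof.
move=> mb bM.
pose Z := ~` [set x | davg e n.+1%:R^-1 b x @[n --> \oo] --> b x].
have mZ : measurable Z.
  rewrite /Z (_ : [set x | _] = \bigcap_k \bigcup_m \bigcap_(n in [set n | (m <= n)%N])
     [set x | `|b x - davg e n.+1%:R^-1 b x| <= k.+1%:R^-1]).
    apply: measurableC; apply: bigcapT_measurable => k.
    apply: bigcupT_measurable => m; apply: bigcap_measurable => [|n _]; first by exists m => /=.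
    rewrite -[X in measurable X]setTI.
    apply: (@measurable_fun_ler _ _ _ setT (fun x => `|b x - davg e n.+1%:R^-1 b x|) (cst k.+1%:R^-1)) => //.
    apply: measurableT_comp => //; apply: measurable_funB => //; exact: measurable_davg.
  apply/seteqP; split => x /=.
    move=> /cvgrPdist_le h k _; have k0 : 0 < k.+1%:R^-1 :> R by [].
    by have [m _ hm] := h _ k0; exists m.
  move=> h; apply/cvgrPdist_le => ep ep0.
  have [k _ /(_ k (leqnn _))/= ke] := near_infty_natSinv_lt (PosNum ep0).
  have [m _ hm] := h k I; exists m => // n mn /=.
  by rewrite (le_trans (hm n mn))// ltW.
have lines x : {ae lebesgue_measure, forall t : R, ~ Z (x - t *: e)}.
  have mbx := measurable_on_line e x mb.
  have := ae_line mbx (fun t => bM _).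
  apply: (@filterS _ _ (ae_filter_ringOfSetsType lebesgue_measure)) => t h; rewrite /Z; apply: contrapT; apply => /=.
  move: h; rewrite (_ : (fun _ => _) = (fun n => davg e n.+1%:R^-1 b (x - t *: e))); first by move=> h; apply.
  apply/funext => n; rewrite /davg invrK; congr (_ * _).
  rewrite [LHS](@Rintegral_itv_shift R (fun t => b (x - t *: e)) _ t mbx).
    by apply: eq_Rintegral => s _; rewrite scalerDl opprD addrA addrAC.
  apply: measurable_bounded_integrable => //.
  - by apply: compact_finite_measure; exact: segment_compact.
  - apply: measurable_funTS; apply: (measurableT_comp mbx).
    by apply: measurable_funD.
  - by exists M; split; [exact: num_real|move=> z Mz y _; exact: le_trans (bM _) (ltW Mz)].
have : (\int[lebesgue_measure]_t \int[leb]_x (\1_Z (x - t *: e))%:E = 0)%E.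
  have mZ2 : measurable_fun setT (fun z : R * 'rV[R]_N => (\1_Z (z.2 - z.1 *: e))%:E : \bar R).
    apply/measurable_EFinP; apply: (measurableT_comp (measurable_indic mZ)).
    exact: measurable_line.
  transitivity (\int[leb]_x \int[lebesgue_measure]_t (\1_Z (x - t *: e))%:E)%E.
    apply: (@fubini_tonelli _ _ (measurableTypeR R) _ R lebesgue_measure leb _ mZ2) => z.
    by rewrite lee_fin.
  rewrite (eq_integral (fun=> 0%E)) ?integral0// => x _.
  rewrite (ae_eq_integral (cst 0%E))// ?integral0//.
  - apply/measurable_EFinP.
    exact: (measurable_on_line e x (b := fun x => \1_Z x) (measurable_indic mZ)).
  - apply: (@filterS _ _ (ae_filter_ringOfSetsType lebesgue_measure) _ _ _ (lines x)) => t.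
    by rewrite /= indicE => nZ _; rewrite memNset.
rewrite (eq_integral (fun=> leb Z)); last first.
  move=> t _; rewrite (integral_shift (- (t *: e)) (f := fun x => (\1_Z x)%:E)).
    by rewrite integral_indic// setIT.
  by apply/measurable_EFinP; exact: measurable_indic.
rewrite integral_cst//= -set_itvNyy lebesgue_measure_itv /= => /eqP.
rewrite mule_eq0 orbF => /eqP Z0.
by exists Z; split => // x /= nx.
Qed.
End directional_average.

Section Rintegral_facts.
Context d (T : measurableType d) (R : realType) (mu : {measure set T -> \bar R}).
Implicit Types f g : T -> R.

Lemma ae_eq_Rintegral f g : measurable_fun setT f -> measurable_fun setT g ->
  {ae mu, forall x, f x = g x} -> \int[mu]_x f x = \int[mu]_x g x.
Proof.
move=> mf mg fg; congr fine; apply: ae_eq_integral => //.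
- exact/measurable_EFinP.
- exact/measurable_EFinP.
- by apply: filterS fg => x /= -> _.
Qed.

Lemma RintegralN (D : set T) f : \int[mu]_(x in D) (- f x) = - \int[mu]_(x in D) f x.
Proof.
rewrite /Rintegral integralE [X in - fine X]integralE.
have -> : (\int[mu]_(x in D) (fun x => (- f x)%:E)^\+ x = \int[mu]_(x in D) (EFin \o f)^\- x)%E.
  by apply: eq_integral => x _; rewrite funeposE funenegE.
have -> : (\int[mu]_(x in D) (fun x => (- f x)%:E)^\- x = \int[mu]_(x in D) (EFin \o f)^\+ x)%E.
  by apply: eq_integral => x _; rewrite funeposE funenegE /= opprK.
by case: (\int[mu]_(x in D) _)%E => [r||]; case: (\int[mu]_(x in D) _)%E => [s||] /=;
  rewrite ?oppr0 ?opprB.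
Qed.

Lemma EFin_Rintegral f : mu.-integrable setT (EFin \o f) ->
  ((\int[mu]_x f x)%:E = \int[mu]_x (f x)%:E)%E.
Proof. by move=> fi; rewrite fineK//; exact: integrable_fin_num. Qed.

Lemma integrable_sub f g : mu.-integrable setT (EFin \o f) ->
  mu.-integrable setT (EFin \o g) -> mu.-integrable setT (EFin \o (fun x => f x - g x)).
Proof. exact: integrableB. Qed.

Lemma Rintegral_dominated_cvg (f_ : nat -> T -> R) f g :
  (forall n, measurable_fun setT (f_ n)) -> measurable_fun setT f ->
  {ae mu, forall x, f_ n x @[n --> \oo] --> f x} ->
  mu.-integrable setT (EFin \o g) ->
  (forall n x, `|f_ n x| <= g x) ->
  \int[mu]_x f_ n x @[n --> \oo] --> \int[mu]_x f x.
Proof.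
move=> mf_ mf f_f ig f_g.
have [] := @dominated_convergence _ _ _ mu setT measurableT (fun n => EFin \o f_ n)
  (EFin \o f) (EFin \o g).
- by move=> n; exact/measurable_EFinP.
- exact/measurable_EFinP.
- by apply: filterS f_f => x fx _; apply/fine_cvgP; split => //; exact: nearW.
- exact: ig.
- by apply: aeW => x n _; rewrite /= lee_fin.
move=> fi _ h; apply: fine_cvg; rewrite fineK; first exact: h.
exact: integrable_fin_num.
Qed.

Lemma integrable_bounded_mul f g (M : R) : mu.-integrable setT (EFin \o f) ->
  measurable_fun setT g -> (forall x, `|g x| <= M) ->
  mu.-integrable setT (EFin \o (fun x => f x * g x)).
Proof.
move=> fi mg gM.
have mf : measurable_fun setT f by apply/measurable_EFinP; exact: measurable_int fi.
apply: (@le_integrable _ _ _ mu _ measurableT _ (fun x => M%:E * (f x)%:E)%E).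
- by apply/measurable_EFinP; exact: measurable_funM.
- move=> x _; rewrite /= lee_fin !normrM mulrC ler_wpM2r//.
  by rewrite (le_trans (gM x)) ?ler_norm.
- exact: integrableZl.
Qed.

End Rintegral_facts.

Section fubini_Rintegral.
Context d1 d2 (T1 : measurableType d1) (T2 : measurableType d2) (R : realType).
Variables (m1 : {sigma_finite_measure set T1 -> \bar R})
          (m2 : {sigma_finite_measure set T2 -> \bar R}).

Lemma fubini_Rintegral (D : set T1) (F : T1 -> T2 -> R) : measurable D ->
  measurable_fun setT (fun z : T1 * T2 => F z.1 z.2) ->
  (\int[m1]_(t in D) \int[m2]_x `|F t x|%:E < +oo)%E ->
  [/\ m2.-integrable setT (EFin \o (fun x => \int[m1]_(t in D) F t x)),
      {ae m2, forall x, m1.-integrable D (EFin \o F^~ x)} &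
      \int[m1]_(t in D) \int[m2]_x F t x = \int[m2]_x \int[m1]_(t in D) F t x].
Proof.
move=> mD mF Foo.
pose G (z : T1 * T2) : \bar R := (F z.1 z.2 * \1_D z.1)%:E.
have mG : measurable_fun setT G.
  apply/measurable_EFinP; apply: measurable_funM => //.
  by apply: measurableT_comp => //; exact: measurable_indic.
have iG : (m1 \x m2)%E.-integrable setT G.
  apply/integrable12ltyP; first exact: mG.
  move: Foo; rewrite integral_mkcond.
  congr (_ < _)%E; apply: eq_integral => t _; rewrite patchE; case: ifPn => tD.
    by apply: eq_integral => x _; rewrite /G /= indicE tD mulr1.
  by rewrite integral0_eq// => x _; rewrite /G /= indicE (negbTE tD) mulr0 normr0.
have iF := integrable_fubini_F iG.
have iG2 : m2.-integrable setT (fubini_G m1 G).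
  apply/integrableP; split; first exact: measurable_fubini_G iG.
  have Goo : (\int[m2]_y \int[m1]_x `|G (x, y)| < +oo)%E.
    exact: (proj1 (@integrable21ltyP _ _ _ _ _ m1 m2 G mG) iG).
  apply: le_lt_trans Goo; apply: ge0_le_integral => //.
  - by apply: measurableT_comp => //; exact: measurable_fubini_G iG.
  - apply: (measurable_fun_fubini_tonelli_G (abse \o G)) => //.
      by apply: measurableT_comp => //; exact: mG.
    by move=> z; exact: abse_ge0.
  - move=> x _; apply: le_abse_integral => //.
    by apply: (measurableT_comp mG); exact: measurable_pair2.
have mR : measurable_fun setT (fun x => \int[m1]_(t in D) F t x).
  exact: measurable_Rintegral1.
have mR2 : measurable_fun setT (fun t => \int[m2]_x F t x).
  apply: (@measurable_Rintegral1 _ _ T2 T1 R m2 setT (fun x t => F t x)) => //.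
  exact: (measurableT_comp mF (@measurable_swap _ _ T2 T1)).
have GR x : \int[m1]_(t in D) F t x = fine (fubini_G m1 G x).
  rewrite Rintegral_mkcond /Rintegral /fubini_G; congr fine.
  by apply: eq_integral => t _; rewrite /G /= patchE indicE; case: ifPn; rewrite ?mulr1 ?mulr0.
have aeG : {ae m2, forall x, setT x -> (\int[m1]_(t in D) F t x)%:E = fubini_G m1 G x}.
  by have := integrable_ae measurableT iG2; apply: filterS => x h _; rewrite GR fineK//; exact: h.
have FR t : \int[m2]_x (F t x * \1_D t) = fine (fubini_F m2 G t) by [].
have aeF : {ae m1, forall t, setT t -> (\int[m2]_x (F t x * \1_D t))%:E = fubini_F m2 G t}.
  by have := integrable_ae measurableT iF; apply: filterS => x h _; rewrite FR fineK//; exact: h.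
have iR : m2.-integrable setT (EFin \o (fun x => \int[m1]_(t in D) F t x)).
  apply/integrableP; split; first exact/measurable_EFinP.
  move/integrableP : iG2 => [mG2]; apply: le_lt_trans.
  apply: ae_ge0_le_integral => //.
  - by apply: measurableT_comp => //; exact/measurable_EFinP.
  - exact: measurableT_comp.
  - by apply: filterS aeG => x /(_ I) h _; rewrite -h.
split => //.
  apply: filterS (ae_integrable2 iG) => x ix.
  apply: (@eq_integrable _ _ _ m1 D mD (fun t => G (t, x))).
    by move=> t tD; rewrite /G /= indicE tD mulr1.
  exact: integrableS ix.
have e1 : (\int[m1]_(t in D) (\int[m2]_x F t x)%:E = \int[m1]_t fubini_F m2 G t)%E.
  rewrite integral_mkcond; apply: ae_eq_integral => //.
  - apply/(measurable_restrictT (fun t => (\int[m2]_x F t x)%:E) mD).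
    by apply/measurable_EFinP; exact: measurable_funTS mR2.
  - exact: measurable_int iF.
  - apply: filterS aeF => t h _; rewrite -h// patchE indicE; case: ifPn => tD.
      by under [X in _ = X%:E]eq_Rintegral do rewrite mulr1.
    by under [X in _ = X%:E]eq_Rintegral do rewrite mulr0; rewrite Rintegral_cst// mul0r.
have e2 : (\int[m2]_x (\int[m1]_(t in D) F t x)%:E = \int[m2]_x fubini_G m1 G x)%E.
  by apply: ae_eq_integral => //; [exact/measurable_EFinP|exact: measurable_int iG2].
by rewrite /Rintegral e1 e2 integral12_prod_meas1// integral21_prod_meas1.
Qed.

End fubini_Rintegral.

Section line_integrals.
Context {R : realType} {N : nat}.
Local Notation leb := (@lebesgue_rV R N).
Local Notation mu := (@lebesgue_measure R).
Implicit Types (x e : 'rV[R]_N) (b w : 'rV[R]_N -> R) (h M : R).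

Definition dint e h b x : R := \int[mu]_(t in `[0, h]) b (x - t *: e).

Let itv_lty h : (mu `[0%R, h]%classic < +oo)%E.
Proof. by apply: compact_finite_measure; exact: segment_compact. Qed.

Let strip_lty h (F : R -> 'rV[R]_N -> R) (C : R) :
  measurable_fun setT (fun z : R * 'rV[R]_N => F z.1 z.2) ->
  (forall t, \int[leb]_x `|F t x|%:E <= C%:E)%E ->
  (\int[mu]_(t in `[0%R, h]) \int[leb]_x `|F t x|%:E < +oo)%E.
Proof.
move=> mF FC; apply: (@le_lt_trans _ _ (\int[mu]_(t in `[0%R, h]) C%:E)%E).
  apply: ge0_le_integral => //.
  - by move=> t _; apply: integral_ge0 => x _; rewrite lee_fin.
  - apply: measurable_funTS.
    apply: (measurable_fun_fubini_tonelli_F (m2 := leb) (fun z : R * 'rV[R]_N => `|F z.1 z.2|%:E)) => //.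
    by apply/measurable_EFinP; exact: measurableT_comp.
rewrite integral_cst//= lte_mul_pinfty//.
by rewrite (le_trans _ (FC 0))//; apply: integral_ge0 => x _; rewrite lee_fin.
Qed.

Let integrable_abs_fin w : leb.-integrable setT (EFin \o w) ->
  exists2 C : R, 0 <= C & (\int[leb]_x `|w x|%:E = C%:E)%E.
Proof.
move=> /integrableP[_ wi]; exists (fine (\int[leb]_x `|w x|%:E)%E).
  by apply: fine_ge0; apply: integral_ge0 => x _; rewrite lee_fin.
by rewrite fineK// ge0_fin_numE//; apply: integral_ge0 => x _; rewrite lee_fin.
Qed.

Lemma pairing_dint e h b w M : leb.-integrable setT (EFin \o w) ->
  measurable_fun setT b -> (forall x, `|b x| <= M) ->
  \int[leb]_x (w x * dint e h b x) =
  \int[mu]_(t in `[0, h]) \int[leb]_x (w x * b (x - t *: e)).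
Proof.
move=> wi mb bM.
have mw : measurable_fun setT w by apply/measurable_EFinP; exact: measurable_int wi.
have M0 : 0 <= M by rewrite (le_trans _ (bM 0)).
have [C C0 wC] : exists2 C : R, 0 <= C & (\int[leb]_x `|w x * M|%:E = C%:E)%E.
  apply: integrable_abs_fin; exact: (integrable_bounded_mul wi).
have mbt t : measurable_fun setT (fun x => b (x - t *: e)).
  exact: (measurable_fun_shift (- (t *: e)) mb).
have mF : measurable_fun setT (fun z : R * 'rV[R]_N => w z.2 * b (z.2 - z.1 *: e)).
  apply: measurable_funM; first exact: measurableT_comp mw _.
  by apply: (measurableT_comp mb); exact: measurable_line.
have [] := @fubini_Rintegral _ _ (measurableTypeR R) _ R mu leb `[0, h]%classic
  (fun t x => w x * b (x - t *: e)).
- exact: measurable_itv.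
- exact: mF.
- apply: (@strip_lty _ (fun t x => w x * b (x - t *: e)) C mF) => t; rewrite -wC.
  apply: ge0_le_integral => //.
  + by apply/measurable_EFinP; apply: measurableT_comp => //; exact: measurable_funM.
  + by apply/measurable_EFinP; apply: measurableT_comp => //; exact: measurable_funM.
  + by move=> x _; rewrite lee_fin !normrM ler_wpM2l// (ger0_norm M0).
move=> _ _ ->; apply: eq_Rintegral => x _; rewrite RintegralZl//.
apply: measurable_bounded_integrable.
- exact: measurable_itv.
- exact: itv_lty.
- by apply: measurable_funTS; exact: measurable_on_line.
- by exists M; split; [exact: num_real|move=> z Mz y _; exact: le_trans (bM _) (ltW Mz)].
Qed.

Lemma integrable_dint e h w : leb.-integrable setT (EFin \o w) ->
  leb.-integrable setT (EFin \o dint e h w).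
Proof.
move=> wi.
have mw : measurable_fun setT w by apply/measurable_EFinP; exact: measurable_int wi.
have [C C0 wC] := integrable_abs_fin wi.
have mF : measurable_fun setT (fun z : R * 'rV[R]_N => w (z.2 - z.1 *: e)).
  by apply: (measurableT_comp mw); exact: measurable_line.
have [] := @fubini_Rintegral _ _ (measurableTypeR R) _ R mu leb `[0, h]%classic
  (fun t x => w (x - t *: e)).
- exact: measurable_itv.
- exact: mF.
- apply: (@strip_lty _ (fun t x => w (x - t *: e)) C mF) => t; rewrite -wC.
  rewrite (integral_shift (- (t *: e)) (f := fun x => `|w x|%:E))//.
  by apply/measurable_EFinP; exact: measurableT_comp.
by [].
Qed.

(** Integration along segments in the directions [e] and [- e] are adjoint to each
    other, by Fubini and translation invariance. *)
Lemma pairing_dintN e h b w M : leb.-integrable setT (EFin \o w) ->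
  measurable_fun setT b -> (forall x, `|b x| <= M) ->
  \int[leb]_x (dint (- e) h w x * b x) = \int[leb]_x (w x * dint e h b x).
Proof.
move=> wi mb bM; rewrite (pairing_dint _ _ wi mb bM).
have mw : measurable_fun setT w by apply/measurable_EFinP; exact: measurable_int wi.
have M0 : 0 <= M by rewrite (le_trans _ (bM 0)).
have [C C0 wC] : exists2 C : R, 0 <= C & (\int[leb]_x `|w x * M|%:E = C%:E)%E.
  apply: integrable_abs_fin; exact: (integrable_bounded_mul wi).
have mwt t : measurable_fun setT (fun x => w (x - t *: - e)).
  exact: (measurable_fun_shift (- (t *: - e)) mw).
have mF : measurable_fun setT (fun z : R * 'rV[R]_N => w (z.2 - z.1 *: - e) * b z.2).
  apply: measurable_funM; last exact: measurableT_comp mb _.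
  by apply: (measurableT_comp mw); exact: measurable_line.
have mF0 : measurable_fun setT (fun z : R * 'rV[R]_N => w (z.2 - z.1 *: - e)).
  by apply: (measurableT_comp mw); exact: measurable_line.
have [C' _ wC'] := integrable_abs_fin wi.
have [] := @fubini_Rintegral _ _ (measurableTypeR R) _ R mu leb `[0, h]%classic
  (fun t x => w (x - t *: - e)).
- exact: measurable_itv.
- exact: mF0.
- apply: (@strip_lty _ (fun t x => w (x - t *: - e)) C' mF0) => t; rewrite -wC'.
  rewrite (integral_shift (- (t *: - e)) (f := fun x => `|w x|%:E))//.
  by apply/measurable_EFinP; exact: measurableT_comp.
move=> iw aei _.
have [] := @fubini_Rintegral _ _ (measurableTypeR R) _ R mu leb `[0, h]%classic
  (fun t x => w (x - t *: - e) * b x).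
- exact: measurable_itv.
- exact: mF.
- apply: (@strip_lty _ (fun t x => w (x - t *: - e) * b x) C mF) => t; rewrite -wC.
  rewrite -(integral_shift (- (t *: - e)) (f := fun x => `|w x * M|%:E)); last first.
    by apply/measurable_EFinP; apply: measurableT_comp => //; exact: measurable_funM.
  apply: ge0_le_integral => //.
  + by apply/measurable_EFinP; apply: measurableT_comp => //; exact: measurable_funM.
  + by apply/measurable_EFinP; apply: measurableT_comp => //; exact: measurable_funM.
  + by move=> x _; rewrite lee_fin !normrM ler_wpM2l// (ger0_norm M0).
move=> ib _ eb.
transitivity (\int[leb]_x \int[mu]_(t in `[0, h]) (w (x - t *: - e) * b x)).
  apply: ae_eq_Rintegral.
  - apply: measurable_funM => //; apply/measurable_EFinP; exact: measurable_int iw.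
  - by apply/measurable_EFinP; exact: measurable_int ib.
  - by apply: filterS aei => x ix; rewrite RintegralZr//; exact: measurable_itv.
rewrite -eb; apply: eq_Rintegral => t _; congr fine.
rewrite -[RHS](integral_shift (t *: e) (f := fun x => (w x * b (x - t *: e))%:E)).
  by apply: eq_integral => x _; rewrite addrK scalerN opprK.
apply/measurable_EFinP; apply: measurable_funM => //.
exact: (measurable_fun_shift (- (t *: e)) mb).
Qed.

Lemma norm_davg_le e h b M x : 0 < h -> measurable_fun setT b ->
  (forall x, `|b x| <= M) -> `|davg e h b x| <= M.
Proof.
move=> h0 mb bM; rewrite /davg normrM gtr0_norm ?invr_gt0// ler_pdivrMl//.
have ib : mu.-integrable `[0, h]%classic (EFin \o (fun t => b (x - t *: e))).
  apply: measurable_bounded_integrable.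
  - exact: measurable_itv.
  - exact: itv_lty.
  - by apply: measurable_funTS; exact: measurable_on_line.
  - by exists M; split; [exact: num_real|move=> z Mz y _; exact: le_trans (bM _) (ltW Mz)].
have le1 : `|\int[mu]_(t in `[0, h]) b (x - t *: e)| <=
    \int[mu]_(t in `[0, h]) `|b (x - t *: e)|.
  by apply: le_normr_Rintegral ib; exact: measurable_itv.
apply: (le_trans le1).
have -> : h * M = \int[mu]_(t in `[0, h]) M.
  by rewrite Rintegral_cst//= lebesgue_measure_itv /= lte_fin h0 /= subr0 mulrC.
apply: le_Rintegral.
- exact: measurable_itv.
- exact: (integrable_norm ib).
- apply: measurable_bounded_integrable.
  + exact: measurable_itv.
  + exact: itv_lty.
  + exact: measurable_cst.
  + by exists `|M|; split; [exact: num_real|move=> z Mz y _; exact: ltW].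
- by move=> t _; exact: bM.
Qed.

End line_integrals.

(** * Difference quotients of weakly differentiable functions *)

Section smooth_calculus.
Context {R : realType} {N : nat}.
Local Notation leb := (@lebesgue_rV R N).
Local Notation mu := (@lebesgue_measure R).
Implicit Types (x y e v : 'rV[R]_N) (f : 'rV[R]_N -> R) (K U : set 'rV[R]_N).

Lemma Rintegral_shift v f : measurable_fun setT f ->
  \int[leb]_x f (x + v) = \int[leb]_x f x.
Proof.
by move=> mf; congr fine; apply: (integral_shift v (f := EFin \o f)); exact/measurable_EFinP.
Qed.

Lemma continuous_measurable_rV f : continuous f -> measurable_fun setT f.
Proof.
move=> cf; apply: (measurability _ (RGenOpens.measurableE R)) => _ [_ [a [b ->]] <-].
rewrite setTI; apply: open_measurable_rV; apply: open_comp => [x _|]; first exact: cf.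
exact: interval_open.
Qed.

Lemma bounded_compact_support f K : continuous f -> compact K ->
  (forall x, ~ K x -> f x = 0) -> exists M : R, forall x, `|f x| <= M.
Proof.
move=> cf cK fK.
have : compact (f @` K) by apply: continuous_compact => //; exact: continuous_subspaceT.
move=> /compact_bounded /ex_strict_bound_gt0[M M0 fM]; exists M => x.
have [Kx|nKx] := pselect (K x); last by rewrite fK// normr0 ltW.
by apply/ltW/fM; exists x.
Qed.

Lemma smooth_differentiable f x : smooth f -> differentiable f x.
Proof. by move=> /(_ [::]). Qed.

Lemma smooth_derive_continuous f e : smooth f -> continuous ('D_e f).
Proof.
move=> sf; have -> : 'D_e f = fun x => \sum_i partial i f x * e ord0 i.
  apply/funext => x; rewrite derive_dotv_grad; last exact: smooth_differentiable.
  by apply: eq_bigr => i _; rewrite mxE.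
move=> x; have F : Filter (nbhs (x : 'rV[R]_N)) by exact: nbhs_filter.
apply: (@cvg_big _ _ +%R 0 _ (@add_continuous R)) => i _.
apply: cvgMl; apply: differentiable_continuous; exact: (sf [:: i] x).
Qed.

Lemma is_derive_line f e x (t : R) : differentiable f (x + t *: e) ->
  is_derive t 1 (fun t => f (x + t *: e)) ('D_e f (x + t *: e)).
Proof.
move=> dfx; have df := diff_derivable (v := e) dfx.
have E : (fun h : R => h^-1 *: (((fun t : R => f (x + t *: e)) \o shift t) (h *: 1) - f (x + t *: e)))
   = (fun h => h^-1 *: ((f \o shift (x + t *: e)) (h *: e) - f (x + t *: e))).
  apply/funext => h /=; congr (_ *: (f _ - _)).
  by rewrite [h *: 1]mulr1 scalerDl addrCA.
apply: DeriveDef; first by rewrite /derivable E.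
by rewrite /derive E.
Qed.

Lemma derive_shift f e v x : 'D_e (fun y => f (y - v)) x = 'D_e f (x - v).
Proof.
rewrite /derive; apply: (congr1 (fun F : R -> R => lim (F @ (0 : R)^'))).
by apply/funext => h /=; rewrite addrA.
Qed.

Lemma deriveNv f e x : differentiable f x -> 'D_(- e) f x = - 'D_e f x.
Proof. by move=> df; rewrite !deriveE// linearN. Qed.

Lemma dint_derive f e (h : R) x : smooth f -> 0 < h ->
  dint e h ('D_e f) x = f x - f (x - h *: e).
Proof.
move=> sf h0; have df y := smooth_differentiable y sf.
pose F (t : R) : R := - f (x + t *: - e).
have dF (t : R) : is_derive t 1 F ('D_e f (x - t *: e)).
  have := is_deriveN (is_derive_line (e := - e) (df (x + t *: - e))).
  by rewrite deriveNv// opprK scalerN.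
have cF : continuous F.
  by move=> t; apply: differentiable_continuous; apply/derivable1_diffP; have [] := dF t.
have := @continuous_FTC2 R (fun t => 'D_e f (x - t *: e)) F 0 h h0.
rewrite /dint /Rintegral => ->.
- by rewrite /= /F scale0r addr0 scalerN opprK addrC.
- apply: continuous_subspaceT => t.
  apply: (@continuous_comp _ _ _ (fun t : R => x - t *: e) ('D_e f)).
    by apply: cvgB; [exact: cvg_cst|apply: cvgZr_tmp; exact: cvg_id].
  exact: smooth_derive_continuous.
- split.
  + by move=> t _; have [] := dF t.
  + by apply: cvg_at_right_filter; exact: cF.
  + by apply: cvg_at_left_filter; exact: cF.
- by move=> t _; rewrite derive1E; have [] := dF t.
Qed.

Lemma off_spt f x : ~ spt f x -> f x = 0.
Proof.
by move=> nx; apply: contrapT => /eqP fx; apply: nx; exact: subset_closure.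
Qed.

Lemma derive_off_spt f e x : ~ spt f x -> 'D_e f x = 0.
Proof.
move=> nx; have oc : open (~` spt f) by rewrite openC; exact: closed_closure.
have nf : \forall y \near x, f y = cst 0 y.
  by apply: filterS (open_nbhs_nbhs (conj oc nx)) => y; exact: off_spt.
by rewrite (near_eq_derive _ nf); exact: derive_cst.
Qed.

Lemma derive_bounded f e : smooth f -> compact (spt f) ->
  exists M : R, forall x, `|'D_e f x| <= M.
Proof.
move=> sf cf; apply: bounded_compact_support cf _; first exact: smooth_derive_continuous.
by move=> x; exact: derive_off_spt.
Qed.

End smooth_calculus.

#[local] Opaque bump.

Section difference_identity.
Context {R : realType} {N : nat}.
Local Notation leb := (@lebesgue_rV R N).
Local Notation mu := (@lebesgue_measure R).
Implicit Types (x y a b e : 'rV[R]_N) (u w : 'rV[R]_N -> R) (U V : set 'rV[R]_N).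

(** Restricting the test functions to bumps is enough below: translates of bumps are
    bumps, and their limits are the indicators of boxes. *)
Definition weak_derivative_bumps V e u w := forall n a b, cbox a b `<=` V ->
  \int[leb]_x (u x * 'D_e (bump n a b) x) = - \int[leb]_x (w x * bump n a b x).

Lemma smooth_bump n a b : smooth (bump n a b).
Proof. by apply: smooth_smoothn => m; exact: smoothn_bump. Qed.

Lemma measurable_bump n a b : measurable_fun setT (bump n a b).
Proof.
apply: continuous_measurable_rV => x; apply: differentiable_continuous.
exact: smooth_differentiable (smooth_bump n a b).
Qed.

Lemma norm_bump_le1 n a b x : `|bump n a b x| <= 1.
Proof. by rewrite ger0_norm ?bump_ge0 ?bump_le1. Qed.

(** For each [t] in `[0, h] the translate of the bump by [t *: e] is an admissible
    test function.  Integrating the weak identity over [t], the derivatives of the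
    translates add up to a difference of bumps by the fundamental theorem of
    calculus, and a change of variable moves the difference to [u]. *)
Lemma difference_bump V e u w h n a b : 0 < h ->
  leb.-integrable setT (EFin \o u) -> leb.-integrable setT (EFin \o w) ->
  weak_derivative_bumps V e u w ->
  (forall x t, cbox a b x -> 0 <= t <= h -> V (x + t *: e)) ->
  \int[leb]_x ((u (x + h *: e) - u x - dint (- e) h w x) * bump n a b x) = 0.
Proof.
move=> h0 iu iw uw abV; set psi := bump n a b.
have spsi : smooth psi by exact: smooth_bump.
have cD := @smooth_derive_continuous _ _ psi e spsi.
have mD := continuous_measurable_rV cD.
have mpsi : measurable_fun setT psi by exact: measurable_bump.
have psi1 x : `|psi x| <= 1 by exact: norm_bump_le1.
have mpsih : measurable_fun setT (fun x => psi (x - h *: e)).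
  exact: (measurable_fun_shift (- (h *: e)) mpsi).
have cspt : compact (spt psi) by have [] := bump_test_function n (fun x : 'rV[R]_N => id : cbox a b x -> cbox a b x).
have [M DM] := derive_bounded e spsi cspt.
have iuh : leb.-integrable setT (EFin \o (fun x => u (x + h *: e))).
  exact: integrable_shift iu.
have idw := integrable_dint (- e) h iw.
have ipsi f : leb.-integrable setT (EFin \o f) ->
    leb.-integrable setT (EFin \o (fun x => f x * psi x)).
  by move=> fi; exact: (integrable_bounded_mul fi mpsi psi1).
have ipsih f : leb.-integrable setT (EFin \o f) ->
    leb.-integrable setT (EFin \o (fun x => f x * psi (x - h *: e))).
  by move=> fi; exact: (integrable_bounded_mul fi mpsih (fun x => psi1 _)).
transitivity (\int[leb]_x (u (x + h *: e) * psi x) - \int[leb]_x (u x * psi x) -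
    \int[leb]_x (dint (- e) h w x * psi x)).
  rewrite -RintegralB//; [|exact: ipsi|exact: ipsi].
  rewrite -RintegralB//; [|exact: (integrableB measurableT (ipsi _ iuh) (ipsi _ iu))|exact: ipsi].
  by apply: eq_Rintegral => x _; rewrite !mulrBl.
rewrite (pairing_dintN e h iw mpsi psi1) (pairing_dint e h iw mpsi psi1).
have -> : \int[mu]_(t in `[0, h]) \int[leb]_x (w x * psi (x - t *: e)) =
    - \int[leb]_x (u x * dint e h ('D_e psi) x).
  rewrite (pairing_dint e h iu mD DM).
  transitivity (\int[mu]_(t in `[0, h]) (- \int[leb]_x (u x * 'D_e psi (x - t *: e)))); last first.
    by rewrite RintegralN.
  apply: eq_Rintegral => t; rewrite inE /= in_itv /= => t0h.
  have abtV : cbox (a + t *: e) (b + t *: e) `<=` V.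
    move=> x xab; rewrite -(subrK (t *: e) x); apply: abV => // i.
    by have := xab i; rewrite !in_itv /= !mxE lerBrDr lerBlDr.
  have e1 := uw n _ _ abtV.
  have shiftE : bump n (a + t *: e) (b + t *: e) = fun x => psi (x - t *: e).
    by apply/funext => x; rewrite -bump_shift.
  rewrite shiftE in e1.
  have e2 : \int[leb]_x (u x * 'D_e (fun x => psi (x - t *: e)) x) =
      \int[leb]_x (u x * 'D_e psi (x - t *: e)).
    by apply: eq_Rintegral => x _; rewrite derive_shift.
  rewrite e2 in e1.
  rewrite e1.
  by rewrite opprK.
have -> : \int[leb]_x (u (x + h *: e) * psi x) = \int[leb]_x (u x * psi (x - h *: e)).
  rewrite -(Rintegral_shift (h *: e) (f := fun x => u x * psi (x - h *: e))).
    by apply: eq_Rintegral => x _; rewrite addrK.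
  by apply: measurable_funM => //; apply/measurable_EFinP; exact: measurable_int iu.
have idpsi : leb.-integrable setT (EFin \o (fun x => u x * dint e h ('D_e psi) x)).
  rewrite (_ : (fun x => _) = fun x => u x * psi x - u x * psi (x - h *: e)).
    exact: (integrableB measurableT (ipsi _ iu) (ipsih _ iu)).
  by apply/funext => x; rewrite dint_derive// mulrBr.
rewrite opprK -RintegralB//; [|exact: ipsih|exact: ipsi].
rewrite -RintegralD//; last exact: (integrableB measurableT (ipsih _ iu) (ipsi _ iu)).
transitivity (\int[leb]_x (fun=> 0 : R) x); last by rewrite Rintegral_cst// mul0r.
by apply: eq_Rintegral => x _; rewrite dint_derive//; ring.
Qed.
End difference_identity.

Section chain_rule.
Context {R : realType} {N : nat}.
Local Notation leb := (@lebesgue_rV R N).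
Local Notation mu := (@lebesgue_measure R).
Implicit Types (x y a b e : 'rV[R]_N) (u w : 'rV[R]_N -> R) (K U V : set 'rV[R]_N).

(** The fundamental theorem of calculus for weak derivatives: [difference_bump]
    passes to indicators of boxes, and [ae0_boxes] concludes. *)
Lemma difference_ae V U e u w h : 0 < h -> open U ->
  leb.-integrable setT (EFin \o u) -> leb.-integrable setT (EFin \o w) ->
  weak_derivative_bumps V e u w ->
  (forall x t, U x -> 0 <= t <= h -> V (x + t *: e)) ->
  {ae leb, forall x, U x -> u (x + h *: e) - u x = dint (- e) h w x}.
Proof.
move=> h0 oU iu iw uw UV.
pose v x := u (x + h *: e) - u x - dint (- e) h w x.
have iv : leb.-integrable setT (EFin \o v).
  apply: integrable_sub; last exact: integrable_dint.
  by apply: integrable_sub => //; exact: (integrable_shift (h *: e) iu).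
have mv : measurable_fun setT v by apply/measurable_EFinP; exact: measurable_int iv.
have : {ae leb, forall x, U x -> v x = 0}.
  apply: (ae0_boxes oU iv) => a b abU.
  have c : \int[leb]_x (v x * bump n a b x) @[n --> \oo] --> \int[leb]_x (v x * \1_(box a b) x).
    apply: (@Rintegral_dominated_cvg _ _ _ leb _ _ (fun x => `|v x|)).
    - by move=> n; apply: measurable_funM => //; exact: measurable_bump.
    - by apply: measurable_funM => //; apply: measurable_indic; exact: measurable_box.
    - by apply: aeW => x; apply: cvgMr; exact: bump_cvg.
    - exact: integrable_norm.
    - by move=> n x; rewrite normrM ler_piMr// norm_bump_le1.
  have z n : \int[leb]_x (v x * bump n a b x) = 0.
    by apply: (difference_bump n h0 iu iw uw) => x t /abU; exact: UV.
  move: c; under eq_cvg do rewrite z.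
  move/(cvg_unique _ (cvg_cst 0)) => /(_ (@norm_hausdorff _ _)) z0.
  have ib : leb.-integrable setT (EFin \o (fun x => v x * \1_(box a b) x)).
    apply: (integrable_bounded_mul iv (M := 1)).
      by apply: measurable_indic; exact: measurable_box.
    by move=> x; rewrite indicE; case: (_ \in _); rewrite ?normr1 ?normr0.
  rewrite integral_mkcond -[RHS]/(0%:E) z0 EFin_Rintegral//.
  apply: eq_integral => x _; rewrite patchE indicE.
  by case: ifPn; rewrite ?mulr1 ?mulr0.
by apply: filterS => x vx /vx /eqP; rewrite /v subr_eq0 => /eqP.
Qed.

Lemma difference_pairing V U e u w h (b : 'rV[R]_N -> R) (M : R) : 0 < h -> open U ->
  leb.-integrable setT (EFin \o u) -> leb.-integrable setT (EFin \o w) ->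
  weak_derivative_bumps V e u w ->
  (forall x t, U x -> 0 <= t <= h -> V (x + t *: e)) ->
  measurable_fun setT b -> (forall x, `|b x| <= M) -> (forall x, ~ U x -> b x = 0) ->
  \int[leb]_x ((u (x + h *: e) - u x) * b x) = \int[leb]_x (w x * dint e h b x).
Proof.
move=> h0 oU iu iw uw UV mb bM bU.
rewrite -(pairing_dintN e h iw mb bM).
have im f : leb.-integrable setT (EFin \o f) -> measurable_fun setT (fun x => f x * b x).
  by move=> fi; apply: measurable_funM => //; apply/measurable_EFinP; exact: measurable_int fi.
apply: ae_eq_Rintegral.
- by apply: im; apply: integrable_sub => //; exact: (integrable_shift (h *: e) iu).
- exact: (im _ (integrable_dint (- e) h iw)).
- apply: filterS (difference_ae h0 oU iu iw uw UV) => x ux.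
  by have [/ux ->//|/bU ->] := pselect (U x); rewrite !mulr0.
Qed.

Lemma compact_thickening K V : open V -> compact K -> K `<=` V ->
  exists U (d : R), [/\ 0 < d, open U, K `<=` U &
    forall x y, U x -> `|y| <= d -> V (x + y)].
Proof.
move=> oV cK KV.
have : \forall d \near (0 : R)^'+, K `<=` (fun x => ball x d `<=` V).
  apply: (compact_near_coveringP K).1 => // x /KV Vx.
  have /nbhs_ballP[r /= r0 xrV] : nbhs x V by exact: open_nbhs_nbhs.
  have r2 : 0 < r / 2 by rewrite divr_gt0.
  exists (ball x (r / 2), [set d | d < r / 2]) => /=.
    by split; [exact: nbhsx_ballx|exact: nbhs_right_lt].
  move=> [y d] [/= xy dr] z yz; apply: xrV.
  by rewrite (splitr r); apply: ball_triangle xy _; apply: le_ball yz; exact: ltW.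
move=> /(filterI (nbhs_right_gt 0)) /filter_ex[d [/= d0 Kd]].
exists (\bigcup_(x in K) ball x (d / 2)), (d / 2); split.
- by rewrite divr_gt0.
- by apply: bigcup_open => x _; exact: ball_open.
- by move=> x Kx; exists x => //; apply: ballxx; rewrite divr_gt0.
- move=> x y [z Kz zx] yd; apply: (Kd z Kz).
  move: zx; rewrite -!ball_normE /= => zx.
  rewrite opprD addrA (le_lt_trans (ler_normB _ _))// (splitr d).
  by rewrite ltr_leD.
Qed.

(** Let [h] tend to [0] in the pairing of the difference quotient of [u] with
    [dF (u x) * chi x].  By [difference_pairing] it equals the integral of [w]
    against an average along segments, which converges to the left-hand side; by
    convexity, the tangent hypothesis on [dF], it is at most the pairing of the
    difference quotient of [F \o u] with [chi].  There the difference quotient is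
    moved to [chi] by a change of variable, and converges to the right-hand
    side. *)
Lemma chain_rule_le K V e u w (F dF : R -> R) (chi chi' : 'rV[R]_N -> R) (M L : R) :
  open V -> compact K -> K `<=` V ->
  leb.-integrable setT (EFin \o u) -> leb.-integrable setT (EFin \o w) ->
  weak_derivative_bumps V e u w -> (forall x, 0 <= u x) ->
  (forall s t, 0 <= s -> 0 <= t -> dF s * (t - s) <= F t - F s) ->
  leb.-integrable setT (EFin \o (F \o u)) ->
  measurable_fun setT (fun x => dF (u x) * chi x) ->
  (forall x, `|dF (u x) * chi x| <= M) ->
  (forall x, 0 <= chi x <= L) -> measurable_fun setT chi -> measurable_fun setT chi' ->
  (forall x, ~ K x -> chi x = 0) ->
  (forall x t, `|chi (x + t *: e) - chi x| <= L * `|t|) ->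
  (forall x, t^-1 * (chi (x + t *: e) - chi x) @[t --> (0 : R)^'] --> (chi' x : R)) ->
  \int[leb]_x (w x * (dF (u x) * chi x)) <= - \int[leb]_x (F (u x) * chi' x).
Proof.
move=> oV cK KV iu iw uw u0 Fconv iF mb bM chi0L mchi mchi' chiK chiL chiD.
have [U [d [d0 oU KU UV]]] := compact_thickening oV cK KV.
pose b x := dF (u x) * chi x.
pose k (n : nat) : R := n.+1%:R^-1.
have k0 n : 0 < k n by rewrite /k invr_gt0.
have mw : measurable_fun setT w by apply/measurable_EFinP; exact: measurable_int iw.
have mF : measurable_fun setT (F \o u) by apply/measurable_EFinP; exact: measurable_int iF.
have lhs : \int[leb]_x (w x * davg e (k n) b x) @[n --> \oo] --> \int[leb]_x (w x * b x).
  apply: (@Rintegral_dominated_cvg _ _ _ leb _ _ (fun x => `|w x| * M)).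
  - by move=> n; apply: measurable_funM => //; exact: measurable_davg.
  - exact: measurable_funM.
  - by apply: filterS (davg_cvg e mb bM) => x cx; apply: cvgMr.
  - by apply: (integrable_bounded_mul (integrable_norm iw)).
  - move=> n x; by rewrite normrM ler_wpM2l// norm_davg_le.
have rhs : \int[leb]_x (F (u x) * ((k n)^-1 * (chi (x - k n *: e) - chi x))) @[n --> \oo]
    --> \int[leb]_x (F (u x) * - chi' x).
  apply: (@Rintegral_dominated_cvg _ _ _ leb _ _ (fun x => `|F (u x)| * L)).
  - move=> n; apply: measurable_funM => //; apply: measurable_funM => //.
    apply: measurable_funB => //; exact: (measurable_fun_shift (- (k n *: e)) mchi).
  - apply: measurable_funM => //; exact: measurableT_comp.
  - apply: aeW => x; apply: cvgMr.
    have s0 : - k n @[n --> \oo] --> 0 by rewrite -oppr0; apply: cvgN; exact: cvg_harmonic.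
    have sn0 n : - k n != 0 by rewrite oppr_eq0 gt_eqF.
    have /cvgN := (cvgr_dnbhsP _ _ _).1 (chiD x) _ (conj sn0 s0).
    rewrite (_ : - _ = fun n => (k n)^-1 * (chi (x - k n *: e) - chi x))//.
    apply/funext => n; change (- ((- k n)^-1 * (chi (x + - k n *: e) - chi x)) =
      (k n)^-1 * (chi (x - k n *: e) - chi x)).
    by rewrite invrN mulNr opprK scaleNr.
  - by apply: (integrable_bounded_mul (integrable_norm iF)).
  - move=> n x; rewrite normrM ler_wpM2l// normrM gtr0_norm ?invr_gt0//.
    by rewrite ler_pdivrMl// mulrC; have := chiL x (- k n); rewrite scaleNr [`|- k n|]normrN (gtr0_norm (k0 n)).
have -> : (- \int[leb]_x (F (u x) * chi' x)) = \int[leb]_x (F (u x) * - chi' x).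
  by rewrite -RintegralN; apply: eq_Rintegral => x _; rewrite mulrN.
rewrite -(cvg_lim (@Rhausdorff R) lhs) -(cvg_lim (@Rhausdorff R) rhs).
apply: ler_lim; [by apply/cvg_ex; eexists; exact: lhs|by apply/cvg_ex; eexists; exact: rhs|].
have kd : \forall n \near \oo, k n * `|e| <= d.
  have c : k n * `|e| @[n --> \oo] --> 0.
    by rewrite -(mul0r `|e|); apply: cvgMl; exact: cvg_harmonic.
  exact: (cvgr_le _ c _ d0).
apply: filterS kd => n kd.
have UVn x t : U x -> 0 <= t <= k n -> V (x + t *: e).
  move=> Ux /andP[t0 tk]; apply: UV => //.
  by rewrite normrZ ger0_norm// (le_trans _ kd)// ler_wpM2r.
have bU x : ~ U x -> b x = 0.
  by move=> nU; rewrite /b chiK ?mulr0// => /KU.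
have E := difference_pairing (k0 n) oU iu iw uw UVn mb bM bU.
have -> : \int[leb]_x (w x * davg e (k n) b x) =
    (k n)^-1 * \int[leb]_x ((u (x + k n *: e) - u x) * b x).
  rewrite E -RintegralZl//; first by apply: eq_Rintegral => x _; rewrite mulrCA.
  have dintE : dint e (k n) b = fun x => k n * davg e (k n) b x.
    by apply/funext => x; rewrite /davg mulrA mulfV ?mul1r ?gt_eqF.
  rewrite -/b dintE; apply: (integrable_bounded_mul iw (M := k n * M)).
    by apply: measurable_funM => //; exact: measurable_davg.
  by move=> x; rewrite normrM (gtr0_norm (k0 n)) ler_wpM2l ?(ltW (k0 n))// norm_davg_le.
have chiM x : `|chi x| <= L by have /andP[c0 cL] := chi0L x; rewrite ger0_norm.
have iFk : leb.-integrable setT (EFin \o (fun x => F (u (x + k n *: e)))).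
  exact: (integrable_shift (k n *: e) iF).
have mchik : measurable_fun setT (fun x => chi (x - k n *: e)).
  exact: (measurable_fun_shift (- (k n *: e)) mchi).
have -> : \int[leb]_x (F (u x) * ((k n)^-1 * (chi (x - k n *: e) - chi x))) =
    (k n)^-1 * \int[leb]_x ((F (u (x + k n *: e)) - F (u x)) * chi x).
  transitivity ((k n)^-1 * \int[leb]_x (F (u x) * chi (x - k n *: e) - F (u x) * chi x)).
    rewrite -RintegralZl//; first by apply: eq_Rintegral => x _; rewrite -mulrBr mulrCA.
    apply: integrable_sub; first exact: (integrable_bounded_mul iF mchik (fun x => chiM _)).
    exact: (integrable_bounded_mul iF mchi chiM).
  congr (_ * _); rewrite RintegralB//; last 2 first.
  - exact: (integrable_bounded_mul iF mchik (fun x => chiM _)).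
  - exact: (integrable_bounded_mul iF mchi chiM).
  rewrite -(Rintegral_shift (k n *: e) (f := fun x => F (u x) * chi (x - k n *: e))); last first.
    by apply: measurable_funM.
  under [X in X - _]eq_Rintegral do rewrite addrK.
  rewrite -RintegralB//.
  - by apply: eq_Rintegral => x _; rewrite mulrBl.
  - exact: (integrable_bounded_mul iFk mchi chiM).
  - exact: (integrable_bounded_mul iF mchi chiM).
apply: ler_wpM2l; first by rewrite invr_ge0 ltW.
apply: le_Rintegral => //.
- apply: integrable_bounded_mul mb bM; apply: integrable_sub => //.
  exact: (integrable_shift (k n *: e) iu).
- by apply: integrable_bounded_mul mchi chiM; exact: integrable_sub.
- move=> x _; rewrite /b mulrA; have /andP[c0 _] := chi0L x.
  by rewrite ler_wpM2r// mulrC Fconv.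
Qed.
End chain_rule.

(** * The chain rule *)

Section chain_rule_equality.
Context {R : realType} {N : nat}.
Local Notation leb := (@lebesgue_rV R N).
Implicit Types (x y a b e : 'rV[R]_N) (u w chi : 'rV[R]_N -> R) (K U V : set 'rV[R]_N).

(** The regularity in which cut-offs such as [eta `^ p * theta] are available: the power
    is only of class C^1, so that such products need not be smooth. *)
Definition line_derivative e chi (chi' : 'rV[R]_N -> R) (L : R) :=
  (forall x (t : R), is_derive t 1 (fun t => chi (x + t *: e)) (chi' (x + t *: e))) /\
  (forall x, `|chi' x| <= L).

Lemma line_derivativeN e chi chi' L : line_derivative e chi chi' L ->
  line_derivative (- e) chi (fun x => - chi' x) L.
Proof.
move=> [D B]; split; last by move=> x; rewrite normrN.
move=> x t; have dN : is_derive t 1 (fun t : R => - t) (-1) by exact: is_deriveN.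
have := @is_derive1_comp _ (fun t => chi (x + t *: e)) _ t _ _ (D x (- t)) dN.
rewrite mulrN1 scalerN -scaleNr.
congr (is_derive _ _ _ _); apply/funext => s /=; by rewrite scalerN scaleNr.
Qed.

Lemma line_derivative_lip e chi chi' L x (t : R) : line_derivative e chi chi' L ->
  `|chi (x + t *: e) - chi x| <= L * `|t|.
Proof.
move=> [D B].
suff pos s : 0 < s -> forall y, `|chi (y + s *: e) - chi y| <= L * s.
  have [t0|t0|->] := ltrgtP t 0; last by rewrite scale0r addr0 subrr !normr0 mulr0.
    rewrite (ltr0_norm t0) distrC; have := pos (- t) _ (x + t *: e).
    by rewrite oppr_gt0 -addrA -scalerDl subrr scale0r addr0; exact.
  by rewrite (gtr0_norm t0); exact: pos.
move=> s0 y; have dy (r : R) := D y r.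
have [|c _] := @MVT R (fun t => chi (y + t *: e)) (fun t => chi' (y + t *: e)) 0 s s0 (fun r _ => dy r).
  apply: continuous_subspaceT => r; apply: differentiable_continuous.
  by apply/derivable1_diffP; have [] := dy r.
by rewrite scale0r addr0 subr0 => ->; rewrite normrM (gtr0_norm s0) ler_wpM2r// ltW.
Qed.

Lemma line_derivative_cvg e chi chi' L x : line_derivative e chi chi' L ->
  t^-1 * (chi (x + t *: e) - chi x) @[t --> (0 : R)^'] --> (chi' x : R).
Proof.
move=> [D _]; have d := @ex_derive _ _ _ _ _ _ _ (D x 0).
have : (fun h : R => h^-1 *: (((fun t : R => chi (x + t *: e)) \o shift 0) (h *: 1) - chi (x + 0 *: e)))
  @ (0 : R)^' --> 'D_1 (fun t : R => chi (x + t *: e)) (0 : R) by exact: d.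
rewrite (@derive_val _ _ _ _ _ _ _ (D x 0)) scale0r addr0.
apply: cvg_trans; apply: near_eq_cvg; apply: nearW => h /=.
by rewrite addr0 [h *: 1]mulr1.
Qed.

Lemma weak_derivative_bumpsN V e u w : weak_derivative_bumps V e u w ->
  weak_derivative_bumps V (- e) u (fun x => - w x).
Proof.
move=> uw n a b abV.
transitivity (- \int[leb]_x (u x * 'D_e (bump n a b) x)).
  rewrite -RintegralN; apply: eq_Rintegral => x _.
  by rewrite deriveNv ?mulrN//; exact: smooth_differentiable (smooth_bump n a b).
rewrite (uw n a b abV) -RintegralN; congr (- _); apply: eq_Rintegral => x _.
by rewrite mulNr.
Qed.

(** The one-sided inequality [chain_rule_le] holds for [e] and for [- e]; both sides
    change sign, hence equality. *)
Lemma chain_rule K V e u w (F dF : R -> R) chi chi' (M L L' : R) :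
  open V -> compact K -> K `<=` V ->
  leb.-integrable setT (EFin \o u) -> leb.-integrable setT (EFin \o w) ->
  weak_derivative_bumps V e u w -> (forall x, 0 <= u x) ->
  (forall s t, 0 <= s -> 0 <= t -> dF s * (t - s) <= F t - F s) ->
  leb.-integrable setT (EFin \o (F \o u)) ->
  measurable_fun setT (fun x => dF (u x) * chi x) ->
  (forall x, `|dF (u x) * chi x| <= M) ->
  (forall x, 0 <= chi x <= L) -> measurable_fun setT chi -> measurable_fun setT chi' ->
  (forall x, ~ K x -> chi x = 0) -> line_derivative e chi chi' L' ->
  \int[leb]_x (w x * (dF (u x) * chi x)) = - \int[leb]_x (F (u x) * chi' x).
Proof.
move=> oV cK KV iu iw uw u0 Fconv iF mb bM chi0L mchi mchi' chiK D.
pose L2 := Num.max L L'.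
have chi0L2 x : 0 <= chi x <= L2.
  by have /andP[-> cL] := chi0L x; rewrite (le_trans cL)// le_max lexx.
have lip e' c' x (t : R) : line_derivative e' chi c' L' ->
    `|chi (x + t *: e') - chi x| <= L2 * `|t|.
  move=> /line_derivative_lip /le_trans; apply.
  by rewrite ler_wpM2r// le_max lexx orbT.
have DN := line_derivativeN D.
apply/eqP; rewrite eq_le; apply/andP; split.
  apply: (chain_rule_le oV cK KV iu iw uw u0 Fconv iF mb bM chi0L2 mchi mchi' chiK).
    by move=> x t; exact: lip D.
  by move=> x; exact: line_derivative_cvg D.
have iNw : leb.-integrable setT (EFin \o (fun x => - w x)).
  exact: integrableN iw.
have mN : measurable_fun setT (fun x => - chi' x) by exact: measurableT_comp.
have := chain_rule_le oV cK KV iu iNw (weak_derivative_bumpsN uw) u0 Fconv iF mb bM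
  chi0L2 mchi mN chiK
  (fun x t => lip _ _ x t DN) (fun x => line_derivative_cvg DN).
under eq_Rintegral do rewrite mulNr.
under [X in _ <= - X]eq_Rintegral do rewrite mulrN.
by rewrite !RintegralN opprK lerNl.
Qed.

End chain_rule_equality.

Section power_derivative.
Context {R : realType}.

(** The absolute value is there for the two-sided derivative at [0], since [powR] of
    a negative base is not the power function. *)
Lemma is_derive_norm_powR (p y : R) : 1 < p -> 0 <= y ->
  is_derive y 1 (fun y : R => `|y| `^ p) (p * y `^ (p - 1)).
Proof.
move=> p1; rewrite le_eqVlt => /predU1P[<-|y0].
  have c : h^-1 *: (((fun y : R => `|y| `^ p) \o shift 0) (h *: 1) - `|0 : R| `^ p)
      @[h --> (0 : R)^'] --> (0 : R).
    apply/cvgr_dnbhsP => s [s0 sc].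
    have nc : `|s n| `^ (p - 1) @[n --> \oo] --> 0.
      have p1' : 0 < p - 1 by rewrite subr_gt0.
      apply: ((cvg_at_rightP _ _ _).1 (powR_cvg0 p1') (fun n => `|s n|)).
      by split; [move=> n; rewrite normr_gt0|rewrite -(normr0 R); exact: cvg_norm].
    apply/cvgr0Pnorm_le => ep ep0; move/cvgr0Pnorm_le : nc => /(_ ep ep0).
    apply: filterS => n; apply: le_trans => /=.
    rewrite addr0 [s n *: 1]mulr1 normr0 powR0 ?gt_eqF ?(lt_trans _ p1)// subr0.
    rewrite normrZ normfV ler_pdivrMl ?normr_gt0//.
    by rewrite (ger0_norm (powR_ge0 _ p)) (ger0_norm (powR_ge0 _ (p - 1))) mulr_powRB1// (lt_trans _ p1).
  have p10 : p - 1 != 0 by rewrite subr_eq0 gt_eqF.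
  by rewrite powR0// mulr0; apply: DeriveDef; [apply/cvg_ex; exists 0|exact: cvg_lim].
apply: (@near_eq_is_derive R R^o R^o (fun z : R => z `^ p)).
  by apply: filterS (lt_nbhsr y0) => z z0; rewrite gtr0_norm.
apply: DeriveDef; first by apply: derivable_powR; rewrite in_itv /= y0.
by rewrite -derive1E powR_derive1// in_itv /= y0.
Qed.

End power_derivative.

Section power_product.
Context {R : realType} {N : nat}.
Local Notation leb := (@lebesgue_rV R N).
Implicit Types (x e : 'rV[R]_N) (u w eta psi theta : 'rV[R]_N -> R) (V : set 'rV[R]_N).

Lemma measurable_fun_powR u (r : R) : measurable_fun setT u ->
  measurable_fun setT (fun x => u x `^ r).
Proof. by move=> mu; apply: (measurableT_comp (measurable_powR r)). Qed.

Lemma test_function_bounded V eta : test_function V eta ->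
  exists2 B : R, 0 <= B & forall x, `|eta x| <= B.
Proof.
move=> [seta ceta _]; have [B hB] := bounded_compact_support
  (fun x => differentiable_continuous (smooth_differentiable x seta)) ceta (fun x => @off_spt _ _ eta x).
by exists B => //; rewrite (le_trans _ (hB 0)).
Qed.

Lemma measurable_smooth eta : smooth eta -> measurable_fun setT eta.
Proof.
move=> seta; apply: continuous_measurable_rV => x.
exact: differentiable_continuous (smooth_differentiable x seta).
Qed.

Lemma measurable_derive_smooth e eta : smooth eta -> measurable_fun setT ('D_e eta).
Proof. by move=> seta; apply: continuous_measurable_rV; exact: smooth_derive_continuous. Qed.

Lemma line_derivative_smooth V e eta : test_function V eta ->
  exists B : R, line_derivative e eta ('D_e eta) B.
Proof.
move=> [seta ceta _]; have [B hB] := derive_bounded e seta ceta.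
exists B; split => // x t; apply: is_derive_line; exact: smooth_differentiable.
Qed.

Definition bounded_fun u := exists M : R, forall x, `|u x| <= M.

Lemma bounded_cst (c : R) : bounded_fun (fun=> c).
Proof. by exists `|c|. Qed.

Lemma bounded_funM u eta : bounded_fun u -> bounded_fun eta ->
  bounded_fun (fun x => u x * eta x).
Proof.
by move=> [A uA] [B etaB]; exists (A * B) => x; rewrite normrM ler_pM.
Qed.

Lemma bounded_funD u eta : bounded_fun u -> bounded_fun eta ->
  bounded_fun (fun x => u x + eta x).
Proof.
move=> [A uA] [B etaB]; exists (A + B) => x.
by rewrite (le_trans (ler_normD _ _))// lerD.
Qed.

Lemma bounded_powR u (r : R) : 0 <= r -> (forall x, 0 <= u x) -> bounded_fun u ->
  bounded_fun (fun x => u x `^ r).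
Proof.
move=> r0 u0 [A uA]; exists (A `^ r) => x.
rewrite ger0_norm ?powR_ge0// ler_powR_base// (le_trans _ (uA x))//.
exact: ler_norm.
Qed.

Lemma integrable_bounded_fun u w : leb.-integrable setT (EFin \o u) ->
  measurable_fun setT w -> bounded_fun w ->
  leb.-integrable setT (EFin \o (fun x => u x * w x)).
Proof. by move=> iu mw [M wM]; exact: (integrable_bounded_mul iu mw wM). Qed.

Lemma integrable_powR u (r Mu : R) : 1 <= r -> (forall x, 0 <= u x <= Mu) ->
  leb.-integrable setT (EFin \o u) -> leb.-integrable setT (EFin \o (fun x => u x `^ r)).
Proof.
move=> r1 uM iu; have u0 x : 0 <= u x by have /andP[] := uM x.
have mu : measurable_fun setT u by apply/measurable_EFinP; exact: measurable_int iu.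
have : leb.-integrable setT (EFin \o (fun x => u x * u x `^ (r - 1))).
  apply: integrable_bounded_fun => //; first exact: measurable_fun_powR.
  apply: bounded_powR => //; first by rewrite subr_ge0.
  by exists Mu => x; rewrite ger0_norm//; have /andP[] := uM x.
by apply: eq_integrable => // x _ /=; rewrite mulr_powRB1// (lt_le_trans _ r1).
Qed.

(** The chain rule for the power function, with the cut-off [eta `^ p * theta], whose
    derivative along lines is given by the product rule. *)
Let power_identity_ge0 (p beta Mu T T1 : R) V e u w eta theta theta' :
  1 < p -> 1 < beta -> open V ->
  leb.-integrable setT (EFin \o u) -> leb.-integrable setT (EFin \o w) ->
  weak_derivative_bumps V e u w -> (forall x, 0 <= u x <= Mu) ->
  test_function V eta -> (forall x, 0 <= eta x) ->
  measurable_fun setT theta -> measurable_fun setT theta' ->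
  (forall x, 0 <= theta x <= T) -> line_derivative e theta theta' T1 ->
  \int[leb]_x (w x * (beta * u x `^ (beta - 1) * (eta x `^ p * theta x))) =
  - \int[leb]_x (u x `^ beta *
      (eta x `^ p * theta' x + theta x * (p * eta x `^ (p - 1) * 'D_e eta x))).
Proof.
move=> p1 b1 oV iu iw uw uM teta eta0 mth mth' thT Dth.
have [seta ceta etaV] := teta.
have [B B0 etaB] := test_function_bounded teta.
have [B1 [Deta etaB1]] := line_derivative_smooth e teta.
have mu : measurable_fun setT u by apply/measurable_EFinP; exact: measurable_int iu.
have meta := measurable_smooth seta.
have p0 : 0 < p by rewrite (lt_trans _ p1).
have u0 x : 0 <= u x by have /andP[] := uM x.
have Mu0 : 0 <= Mu by have /andP[h] := uM 0; exact: le_trans.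
have T0 : 0 <= T by have /andP[h] := thT 0; exact: le_trans.
have etap x : 0 <= eta x `^ p <= B `^ p.
  rewrite powR_ge0; apply: ler_powR_base; [exact: ltW|exact: eta0|].
  by rewrite (le_trans _ (etaB x))//; exact: ler_norm.
have etap1 x : 0 <= eta x `^ (p - 1) <= B `^ (p - 1).
  rewrite powR_ge0; apply: ler_powR_base; [by rewrite subr_ge0 ltW|exact: eta0|].
  by rewrite (le_trans _ (etaB x))//; exact: ler_norm.
have up r x : 0 <= r -> 0 <= u x `^ r <= Mu `^ r.
  by move=> r0; have /andP[? ?] := uM x; rewrite powR_ge0 ler_powR_base.
apply: (@chain_rule _ _ (spt eta) V e u w (fun s => s `^ beta)
  (fun s => beta * s `^ (beta - 1)) (fun x => eta x `^ p * theta x) _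
  (beta * Mu `^ (beta - 1) * (B `^ p * T)) (B `^ p * T)
  (B `^ p * T1 + T * (p * B `^ (p - 1) * B1))) => //.
- by move=> s t s0 t0; exact: powR_tangent.
- exact: (integrable_powR (ltW b1) uM iu).
- apply: measurable_funM; last by apply: measurable_funM => //; exact: measurable_fun_powR.
  by apply: measurable_funM => //; exact: measurable_fun_powR.
- move=> x; have /andP[t0 tT] := thT x; have /andP[e0 eB] := etap x.
  have /andP[v0 vM] : 0 <= u x `^ (beta - 1) <= Mu `^ (beta - 1).
    by apply: up; rewrite subr_ge0 ltW.
  have be0 : 0 <= beta by rewrite (le_trans _ (ltW b1)).
  rewrite ger0_norm; last by rewrite !mulr_ge0.
  by rewrite ler_pM ?mulr_ge0 ?ler_wpM2l ?ler_pM.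
- move=> x; have /andP[t0 tT] := thT x; have /andP[e0 eB] := etap x.
  by rewrite mulr_ge0//= ler_pM.
- by apply: measurable_funM => //; exact: measurable_fun_powR.
- apply: measurable_funD.
    by apply: measurable_funM => //; exact: measurable_fun_powR.
  apply: measurable_funM => //; apply: measurable_funM; last exact: measurable_derive_smooth.
  by apply: measurable_funM => //; exact: measurable_fun_powR.
- by move=> x nx; rewrite (off_spt nx) powR0 ?gt_eqF// mul0r.
- split.
    move=> x t.
    have dpow : is_derive t 1 (fun t : R => eta (x + t *: e) `^ p)
        (p * eta (x + t *: e) `^ (p - 1) * 'D_e eta (x + t *: e)).
      have := Deta x t; pose k (t : R) := eta (x + t *: e); rewrite -/k => Dk.
      have Dn : is_derive (k t) 1 (fun y : R => `|y| `^ p) (p * k t `^ (p - 1)).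
        exact: (is_derive_norm_powR p1 (eta0 _)).
      have := is_derive1_comp (f := fun y : R => `|y| `^ p) (g := k).
      rewrite (_ : _ \o k = fun t : R => k t `^ p)//; first exact.
      by apply/funext => r /=; rewrite ger0_norm ?eta0.
    exact: (is_deriveM dpow (Dth.1 x t)).
  move=> x; have /andP[t0 tT] := thT x; have /andP[e0 eB] := etap x.
  have /andP[f0 fB] := etap1 x.
  rewrite (le_trans (ler_normD _ _))// !normrM (ger0_norm e0) (ger0_norm t0).
  rewrite (ger0_norm f0) (ger0_norm (ltW p0)) lerD// ler_pM ?mulr_ge0 ?(ltW p0)//.
  + exact: Dth.2.
  + by rewrite ler_pM ?mulr_ge0 ?(ltW p0)// ler_wpM2l ?(ltW p0).
Qed.

(** The product rule is absorbed in the choice of the test function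
    [eta `^ p * psi]; adding to [psi] a constant that makes it nonnegative brings
    the identity within reach of the one-sided argument. *)
Lemma power_identity (p beta Mu : R) V e u w eta psi :
  1 < p -> 1 < beta -> open V ->
  leb.-integrable setT (EFin \o u) -> leb.-integrable setT (EFin \o w) ->
  weak_derivative_bumps V e u w -> (forall x, 0 <= u x <= Mu) ->
  test_function V eta -> (forall x, 0 <= eta x) -> test_function setT psi ->
  \int[leb]_x (w x * (beta * u x `^ (beta - 1) * (eta x `^ p * psi x))) =
  - \int[leb]_x (u x `^ beta *
      (eta x `^ p * 'D_e psi x + psi x * (p * eta x `^ (p - 1) * 'D_e eta x))).
Proof.
move=> p1 b1 oV iu iw uw uM teta eta0 tpsi.
have [p0 pp0 bb0] : [/\ 0 <= p, 0 <= p - 1 & 0 <= beta - 1].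
  by rewrite !subr_ge0 !ltW// (lt_trans _ p1).
have [spsi _ _] := tpsi.
have [M M0 psiM] := test_function_bounded tpsi.
have [M1 Dpsi] := line_derivative_smooth e tpsi.
have mpsi := measurable_smooth spsi.
have mDpsi := measurable_derive_smooth e spsi.
have D1 : line_derivative e (fun x => psi x + M) ('D_e psi) M1.
  split; last exact: Dpsi.2.
  move=> x t; have := is_deriveD (Dpsi.1 x t) (is_derive_cst M t 1).
  by rewrite addr0.
have D2 : line_derivative e (fun=> M) (fun=> 0) 0.
  by split => [x t|x]; [exact: is_derive_cst|rewrite normr0].
have b1' x : 0 <= psi x + M <= M + M.
  have := psiM x; rewrite ler_norml => /andP[h1 h2].
  by rewrite -lerBlDr sub0r h1 lerD2r.
have b2 (x : 'rV[R]_N) : 0 <= M <= M by rewrite M0 lexx.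
have mpsiM : measurable_fun setT (fun x => psi x + M) by exact: measurable_funD.
have E1 := power_identity_ge0 p1 b1 oV iu iw uw uM teta eta0 mpsiM mDpsi b1' D1.
have E2 := power_identity_ge0 p1 b1 oV iu iw uw uM teta eta0 (measurable_cst M) (measurable_cst (0 : R)) b2 D2.
have mu : measurable_fun setT u by apply/measurable_EFinP; exact: measurable_int iu.
have [seta ceta etaV] := teta; have meta := measurable_smooth seta.
have bu : bounded_fun u.
  by exists Mu => x; have /andP[u0 uMx] := uM x; rewrite ger0_norm.
have u0 x : 0 <= u x by have /andP[] := uM x.
have beta_ : bounded_fun eta by have [B _ etaB] := test_function_bounded teta; exists B.
have bDeta : bounded_fun ('D_e eta).
  by have [B [_ etaB]] := line_derivative_smooth e teta; exists B.
have bpsi : bounded_fun psi by exists M.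
have bDpsi : bounded_fun ('D_e psi) by exists M1; exact: Dpsi.2.
have iub := integrable_powR (ltW b1) uM iu.
have mup r := measurable_fun_powR r mu; have metap r := measurable_fun_powR r meta.
have mDeta := measurable_derive_smooth e seta.
have I1 th : measurable_fun setT th -> bounded_fun th ->
    leb.-integrable setT (EFin \o (fun x => w x * (beta * u x `^ (beta - 1) * (eta x `^ p * th x)))).
  move=> mth bth; apply: integrable_bounded_fun => //.
    apply: measurable_funM; first exact: measurable_funM.
    exact: measurable_funM.
  apply: bounded_funM; apply: bounded_funM => //; first exact: bounded_cst.
    exact: bounded_powR.
  exact: bounded_powR.
have I2 th th' : measurable_fun setT th -> bounded_fun th ->
    measurable_fun setT th' -> bounded_fun th' ->
    leb.-integrable setT (EFin \o (fun x => u x `^ beta *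
      (eta x `^ p * th' x + th x * (p * eta x `^ (p - 1) * 'D_e eta x)))).
  move=> mth bth mth' bth'; apply: integrable_bounded_fun => //.
    apply: measurable_funD; first exact: measurable_funM.
    by apply: measurable_funM => //; apply: measurable_funM => //; exact: measurable_funM.
  apply: bounded_funD; first by apply: bounded_funM => //; exact: bounded_powR.
  apply: bounded_funM => //; apply: bounded_funM => //; apply: bounded_funM.
    exact: bounded_cst.
  exact: bounded_powR.
have bpsiM : bounded_fun (fun x => psi x + M) by apply: bounded_funD => //; exact: bounded_cst.
have bM := bounded_cst M.
transitivity (\int[leb]_x (w x * (beta * u x `^ (beta - 1) * (eta x `^ p * (psi x + M)))) -
    \int[leb]_x (w x * (beta * u x `^ (beta - 1) * (eta x `^ p * M)))).
  rewrite -RintegralB//; [|exact: I1|exact: I1].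
  by apply: eq_Rintegral => x _; ring.
rewrite E1 E2 opprK addrC -RintegralB//; last 2 first.
- by apply: I2 => //; exact: bounded_cst.
- exact: I2.
by rewrite -RintegralN; apply: eq_Rintegral => x _; rewrite /cst/=; ring.
Qed.
End power_product.

(** * The test function *)

Section lebesgue_space_facts.
Context {d : measure_display} {T : measurableType d} {R : realType}.
Context (mu : {measure set T -> \bar R}).
Implicit Types (f g : T -> R) (r : R).

Lemma Lfun_measurable (r : \bar R) f : f \in Lfun mu r -> measurable_fun setT f.
Proof. by move=> /sub_Lfun_mfun; rewrite inE. Qed.

Lemma Lfun_powRP r f : 1 <= r -> measurable_fun setT f ->
  (\int[mu]_x (`|f x| `^ r)%:E < +oo)%E -> f \in Lfun mu r%:E.
Proof.
move=> r1 mf fr; rewrite inE; apply/andP; split; rewrite inE//=.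
have r0 : r != 0 by rewrite gt_eqF// (lt_le_trans _ r1).
rewrite /finite_norm; apply: (lty_poweRy r0).
by rewrite poweR_Lnorm.
Qed.

Lemma Lfun_powR_lty r f : 1 <= r -> f \in Lfun mu r%:E ->
  (\int[mu]_x (`|f x| `^ r)%:E < +oo)%E.
Proof.
move=> r1 fr; have /integrableP[_] := Lfun_integrable r1 fr.
by under eq_integral => x _ do rewrite /= ger0_norm ?powR_ge0//.
Qed.

Lemma Lfun_le r f g : 1 <= r -> measurable_fun setT f ->
  (forall x, `|f x| <= `|g x|) -> g \in Lfun mu r%:E -> f \in Lfun mu r%:E.
Proof.
move=> r1 mf fg gr; apply: Lfun_powRP => //.
have mpow (h : T -> R) : measurable_fun setT h -> measurable_fun setT (fun x => (`|h x| `^ r)%:E).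
  move=> mh; apply/measurable_EFinP; apply: (measurableT_comp (measurable_powR r)).
  exact: measurableT_comp.
rewrite (le_lt_trans _ (Lfun_powR_lty r1 gr))//; apply: ge0_le_integral => //.
- exact: mpow.
- exact/mpow/(Lfun_measurable gr).
- by move=> x _; rewrite lee_fin ler_powR_base// (le_trans _ r1).
Qed.

Lemma Lfun_bounded_mul r f g (M : R) : 1 <= r -> f \in Lfun mu r%:E ->
  measurable_fun setT g -> (forall x, `|g x| <= M) ->
  (fun x => f x * g x) \in Lfun mu r%:E.
Proof.
move=> r1 fr mg gM; have := Lfun_scale M r1 fr; apply: Lfun_le => //.
  by apply: measurable_funM => //; exact: Lfun_measurable fr.
move=> x; rewrite /= !normrM ler_wpM2l// (le_trans (gM x))//.
by rewrite ler_norm.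
Qed.

Lemma Lfun_bounded_support r f (M : R) K : 1 <= r -> measurable K ->
  (mu K < +oo)%E -> measurable_fun setT f -> (forall x, `|f x| <= M) ->
  (forall x, ~ K x -> f x = 0) -> f \in Lfun mu r%:E.
Proof.
move=> r1 mK Koo mf fM f0.
have M0 : K !=set0 -> 0 <= M by move=> [x _]; rewrite (le_trans _ (fM x)).
have r0 : r != 0 by rewrite gt_eqF// (lt_le_trans _ r1).
apply: Lfun_powRP => //.
apply: (@le_lt_trans _ _ (\int[mu]_(x in K) (cst (M `^ r)%:E) x)%E).
  rewrite [leRHS]integral_mkcond; apply: ge0_le_integral => //.
  - apply/measurable_EFinP; apply: (measurableT_comp (measurable_powR r)).
    exact: measurableT_comp.
  - by apply/(measurable_restrictT _ mK); exact: measurable_cst.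
  - move=> x _; rewrite patchE; case: ifPn => [/set_mem Kx|/negP nK].
      by rewrite lee_fin ler_powR_base// (le_trans _ r1).
    by rewrite f0 ?normr0 ?powR0//; apply: contra_not nK => /mem_set.
by rewrite integral_cst// lte_mul_pinfty// lee_fin powR_ge0.
Qed.

Lemma Lfun_integrable_support r f K : 1 <= r -> measurable K -> (mu K < +oo)%E ->
  (forall x, ~ K x -> f x = 0) -> f \in Lfun mu r%:E ->
  mu.-integrable setT (EFin \o f).
Proof.
move=> r1 mK Koo f0 fr; have mf := Lfun_measurable fr.
have i1 := Lfun_integrable r1 fr.
have i2 : mu.-integrable setT (EFin \o \1_K).
    apply/integrableP; split; first exact/measurable_EFinP.
    under eq_integral => x _ do rewrite /= ger0_norm ?indicE ?ler0n//.
    by under eq_integral => x _ do rewrite -indicE; rewrite integral_indic// setIT.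
apply: (le_integrable _ _ _ (integrableD measurableT i2 i1)) => //.
  exact/measurable_EFinP.
move=> x _; rewrite [leRHS](_ : _ = (`|\1_K x + `|f x| `^ r|)%:E)// lee_fin indicE.
case: (boolP (x \in K)) => [_|/negP nK] /=; last first.
  by rewrite f0 ?normr0//; apply: contra_not nK => /mem_set.
rewrite [leRHS]ger0_norm ?addr_ge0 ?powR_ge0//.
have [f1|/ltW f1] := leP `|f x| 1; first by rewrite ler_wpDr ?powR_ge0.
by rewrite ler_wpDl// -[leLHS]powRr1// ler_powR.
Qed.

End lebesgue_space_facts.

Section power_test_function.
Context {R : realType} {N : nat}.
#[local] Opaque lebesgue_rV.
Local Notation leb := (@lebesgue_rV R N).
Implicit Types (x : 'rV[R]_N) (u eta : 'rV[R]_N -> R) (V : set 'rV[R]_N).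
Implicit Types (Du : 'rV[R]_N -> 'rV[R]_N).

(** When [0 < u <= M] almost everywhere on [V], this agrees with [u] almost everywhere
    on [V]; being bounded and nonnegative at every point, it spares the pointwise
    estimates their exceptional sets. *)
Definition clip (M : R) V u : 'rV[R]_N -> R :=
  (fun x => Num.min M (Num.max 0 (u x))) \_ V.

Lemma clip_bounds M V u x : 0 <= M -> 0 <= clip M V u x <= M.
Proof.
move=> M0; rewrite /clip patchE; case: ifPn => _; last by rewrite lexx.
by rewrite le_min M0 le_max lexx/= ge_min lexx.
Qed.

Lemma clip_id M V u x : V x -> 0 < u x <= M -> clip M V u x = u x.
Proof.
move=> Vx /andP[u0 uM]; rewrite /clip patchE mem_set//.
by rewrite max_r ?(ltW u0)// min_r.
Qed.

Lemma clip_out M V u x : ~ V x -> clip M V u x = 0.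
Proof. by move=> Vx; rewrite /clip patchE memNset. Qed.

Lemma measurable_clip M V u : measurable V -> measurable_fun setT u ->
  measurable_fun setT (clip M V u).
Proof.
move=> mV mu; apply/(measurable_restrictT _ mV); apply: (measurable_funS measurableT) => //.
by apply: measurable_minr => //; apply: measurable_maxr.
Qed.

Lemma integrable_Lp_loc u : leb.-integrable setT (EFin \o u) -> Lp_loc 1%E setT u.
Proof.
move=> iu K cK _; have mK := measurable_compact_rV cK.
apply/Lfun1_integrable.
have -> : EFin \o u \_ K = (EFin \o u) \_ K.
  by apply/funext => x; rewrite /= !patchE; case: ifP.
by apply/(integrable_mkcond _ mK); exact: integrableS iu.
Qed.

Lemma weak_derivative_bumps_clip M V u Du i : open V ->
  measurable_fun setT u -> {ae leb, forall x, V x -> 0 < u x <= M} ->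
  weak_gradient V u Du ->
  weak_derivative_bumps V (delta_mx ord0 i) (clip M V u)
    ((fun x => Du x ord0 i) \_ V).
Proof.
move=> oV mu uM [_ _ wg] n a b abV.
have mV : measurable V by exact: open_measurable_rV.
have tpsi := bump_test_function n abV.
have mD := measurable_derive_smooth (delta_mx ord0 i) (smooth_bump n a b).
have mDpsi : measurable_fun setT (partial i (bump n a b)) := mD.
have := wg i _ tpsi; rewrite /Rintegral -fineN => E; congr fine.
transitivity (\int[leb]_(x in V) (u x * partial i (bump n a b) x)%:E)%E.
  rewrite [RHS]integral_mkcond; apply: ae_eq_integral => //.
  - apply/measurable_EFinP; apply: measurable_funM => //; exact: measurable_clip.
  - apply/(measurable_restrictT _ mV); apply: (measurable_funS measurableT) => //.
    by apply/measurable_EFinP; exact: measurable_funM.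
  - apply: (@filterS _ _ (ae_filter_ringOfSetsType leb) _ _ _ uM) => x uMx _ /=.
    rewrite patchE; case: ifPn => [/set_mem Vx|/negP nV].
      by rewrite clip_id//; exact: uMx.
    by rewrite clip_out ?mul0r//; apply: contra_not nV => /mem_set.
rewrite E; congr (- _)%E; rewrite [LHS]integral_mkcond. apply: eq_integral => x _.
by rewrite /= !patchE; case: ifPn => //; rewrite mul0r.
Qed.

(** The weak gradient is read off from [power_identity], whose right-hand side splits
    into the derivative of [psi] and the derivative of [eta `^ p].  All coefficients
    are bounded and vanish outside [V], a set of finite measure, so that
    integrability reduces to that of [Du] on [V]. *)
Lemma power_test_function (p beta M : R) V u Du eta :
  1 < p -> 1 < beta -> 0 <= M -> open V -> compact (closure V) ->
  measurable_fun setT u -> {ae leb, forall x, V x -> 0 < u x <= M} ->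
  W1p V p u Du -> test_function V eta -> (forall x, 0 <= eta x) ->
  W1p_0 V p (fun x => clip M V u x `^ beta * eta x `^ p)
    (fun x => (beta * clip M V u x `^ (beta - 1) * eta x `^ p) *: Du x +
              (p * clip M V u x `^ beta * eta x `^ (p - 1)) *: grad eta x).
Proof.
move=> p1 b1 M0 oV cV mu uM [wg _ Lw] teta eta0.
have [p0 pp0 bb0 b0] : [/\ 0 < p, 0 < p - 1, 0 <= beta - 1 & 0 < beta].
  by rewrite !subr_gt0 subr_ge0 (ltW b1) !(lt_trans ltr01).
have mV : measurable V by exact: open_measurable_rV.
have Voo : (leb V < +oo)%E.
  rewrite (le_lt_trans _ (lebesgue_compact_lty cV))// le_measure// ?inE//.
    exact: measurable_compact_rV.
  exact: subset_closure.
have [seta ceta etaV] := teta.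
have [B B0 etaB] := test_function_bounded teta.
have meta := measurable_smooth seta.
set v := clip M V u.
have vM x : 0 <= v x <= M by exact: clip_bounds.
have v0 x : 0 <= v x by have /andP[] := vM x.
have mv : measurable_fun setT v by exact: measurable_clip.
have bv : bounded_fun v.
  by exists M => x; have /andP[? ?] := vM x; rewrite ger0_norm.
have beta_ : bounded_fun eta by exists B.
pose w i := (fun x => Du x ord0 i) \_ V.
have iw i : leb.-integrable setT (EFin \o w i).
  apply: (Lfun_integrable_support (ltW p1) mV Voo _ (Lw i)) => x nV.
  by rewrite patchE memNset.
have eta_out x : ~ V x -> eta x = 0.
  by move=> nV; apply: off_spt; apply: contra_not nV; exact: etaV.
have iv : leb.-integrable setT (EFin \o v).
  apply/Lfun1_integrable; have [Cv vC] := bv.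
  apply: (Lfun_bounded_support (lexx 1) mV Voo mv vC).
  exact: clip_out.
have mvp r := measurable_fun_powR r mv; have metap r := measurable_fun_powR r meta.
set phi := fun x => _.
have mphi : measurable_fun setT phi by exact: measurable_funM.
have [Cphi phiC] : bounded_fun phi.
  by apply: bounded_funM; apply: bounded_powR => //; exact: ltW.
have phi_out x : ~ V x -> phi x = 0.
  by move=> nV; rewrite /phi (eta_out _ nV) [X in _ * X]powR0 ?mulr0// gt_eqF.
have Lphi : phi \in Lfun leb p%:E.
  exact: (Lfun_bounded_support (ltW p1) mV Voo mphi phiC phi_out).
have iphi : leb.-integrable setT (EFin \o phi).
  exact: (Lfun_integrable_support (ltW p1) mV Voo phi_out Lphi).
pose al x := beta * v x `^ (beta - 1) * eta x `^ p.
pose ga i x := p * v x `^ beta * eta x `^ (p - 1) * partial i eta x.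
have mal : measurable_fun setT al.
  by apply: measurable_funM => //; exact: measurable_funM.
have [Cal alC] : bounded_fun al.
  apply: bounded_funM; last by apply: bounded_powR => //; exact: ltW.
  by apply: bounded_funM; [exact: bounded_cst|exact: bounded_powR].
have mDeta i : measurable_fun setT (partial i eta).
  exact: (measurable_derive_smooth (delta_mx ord0 i) seta).
have mga i : measurable_fun setT (ga i).
  apply: measurable_funM => //; apply: measurable_funM => //.
  exact: measurable_funM.
have bga i : bounded_fun (ga i).
  apply: bounded_funM; last first.
    by have [C [_ etaC]] := line_derivative_smooth (delta_mx ord0 i) teta; exists C.
  apply: bounded_funM; last by apply: bounded_powR => //; exact: ltW.
  by apply: bounded_funM; [exact: bounded_cst|apply: bounded_powR => //; exact: ltW].
have ga_out i x : ~ V x -> ga i x = 0.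
  by move=> nV; rewrite /ga (eta_out _ nV) [X in _ * X * _]powR0 ?mulr0 ?mul0r// gt_eqF.
have Lga i : ga i \in Lfun leb p%:E.
  by have [C gaC] := bga i; exact: (Lfun_bounded_support (ltW p1) mV Voo (mga i) gaC (ga_out i)).
have iga i : leb.-integrable setT (EFin \o ga i).
  exact: (Lfun_integrable_support (ltW p1) mV Voo (ga_out i) (Lga i)).
set Dphi := fun x => _.
have DphiE i x : Dphi x ord0 i = w i x * al x + ga i x.
  rewrite /Dphi !mxE /ga /w patchE; case: ifPn => [_|/negP nV]; first by rewrite /al; ring.
  have eta0x : eta x = 0 by apply: eta_out; apply: contra_not nV => /mem_set.
  by rewrite /al eta0x powR0 ?gt_eqF// !mulr0 !mul0r.
have DphiF i : (fun x => Dphi x ord0 i) = (fun x => w i x * al x) \+ ga i.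
  by apply/funext => x; rewrite DphiE.
have p1e : (1 <= p%:E)%E by rewrite lee_fin ltW.
have LDphi i : (fun x => Dphi x ord0 i) \in Lfun leb p%:E.
  rewrite DphiF; apply: (Lfun_addr_closed leb p1e).2 => //.
  exact: (Lfun_bounded_mul (ltW p1) (Lw i) mal alC).
have iwal i : leb.-integrable setT (EFin \o (fun x => w i x * al x)).
  exact: (integrable_bounded_mul (iw i) mal alC).
have iDphi i : leb.-integrable setT (EFin \o (fun x => Dphi x ord0 i)).
  by rewrite DphiF; exact: (integrableD measurableT (iwal i) (iga i)).
split; last by apply: nearW => x; exact: phi_out.
split; last 2 first.
- by rewrite /Lp_on patch_setT.
- by move=> i; rewrite /Lp_on patch_setT.
split; first exact: integrable_Lp_loc.
  by move=> i; exact: integrable_Lp_loc.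
move=> i psi tpsi; have [spsi _ _] := tpsi.
have mpsi := measurable_smooth spsi.
have mDpsi : measurable_fun setT (partial i psi).
  exact: (measurable_derive_smooth (delta_mx ord0 i) spsi).
have [Cpsi _ psiC] := test_function_bounded tpsi.
have [C1psi [_ psiC1]] := line_derivative_smooth (delta_mx ord0 i) tpsi.
have i1 : leb.-integrable setT (EFin \o (fun x => phi x * partial i psi x)).
  exact: (integrable_bounded_mul iphi mDpsi psiC1).
have i2 : leb.-integrable setT (EFin \o (fun x => Dphi x ord0 i * psi x)).
  exact: (integrable_bounded_mul (iDphi i) mpsi psiC).
have i3 : leb.-integrable setT (EFin \o (fun x => w i x * al x * psi x)).
  exact: (integrable_bounded_mul (iwal i) mpsi psiC).
have i4 : leb.-integrable setT (EFin \o (fun x => ga i x * psi x)).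
  exact: (integrable_bounded_mul (iga i) mpsi psiC).
rewrite -(EFin_Rintegral i1) -(EFin_Rintegral i2) -EFinN; congr EFin.
have wdb := weak_derivative_bumps_clip i oV mu uM wg.
have := power_identity p1 b1 oV iv (iw i) wdb vM teta eta0 tpsi.
rewrite [X in X = _ -> _](_ : _ = \int[leb]_x (w i x * al x * psi x)); last first.
  by apply: eq_Rintegral => x _; rewrite /al; ring.
rewrite [X in _ = - X -> _](_ : _ = \int[leb]_x (phi x * partial i psi x) +
    \int[leb]_x (ga i x * psi x)); last first.
  rewrite -RintegralD//; apply: eq_Rintegral => x _.
  by rewrite /ga /phi /partial; ring.
rewrite [X in _ -> _ = - X](_ : _ = \int[leb]_x (w i x * al x * psi x) +
    \int[leb]_x (ga i x * psi x)); last first.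
  by rewrite -RintegralD//; apply: eq_Rintegral => x _; rewrite DphiE; ring.
by move=> ->; rewrite opprD opprK addrK.
Qed.

End power_test_function.

(** * The local term *)

Lemma continuous_norm_powR {R : realType} (r : R) : 0 < r ->
  continuous (fun t : R => `|t| `^ r).
Proof.
move=> r0 t; have [->|t0] := eqVneq t 0.
  rewrite /continuous_at normr0 powR0 ?gt_eqF//; apply/cvgr0Pnorm_lt => e e0.
  have d0 : 0 < e `^ r^-1 by rewrite powR_gt0.
  have hd : \forall h \near (0 : R), `|h| < e `^ r^-1 by exact: nbhs0_lt.
  apply: filterS hd => h hd.
  rewrite ger0_norm ?powR_ge0//.
  have -> : e = (e `^ r^-1) `^ r by rewrite -powRrM mulVf ?gt_eqF// powRr1// ltW.
  by apply: gt0_ltr_powR; rewrite // nnegrE ?powR_ge0.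
apply: (@continuous_comp _ _ _ (fun t : R => `|t|) (fun y : R => y `^ r)); first exact: norm_continuous.
have nt0 : 0 < `|t| by rewrite normr_gt0.
apply: differentiable_continuous; apply/derivable1_diffP.
by apply: derivable_powR; rewrite in_itv /= nt0.
Qed.

Section finsler_field_facts.
Context {R : realType} {N : nat}.
Variables (H : 'rV[R]_N -> R) (p : R).
Hypotheses (HH : finsler_minkowski H) (p1 : 1 < p).
Implicit Types (x v xi : 'rV[R]_N).

Let p0 : 0 < p. Proof. by rewrite (lt_trans ltr01). Qed.

Lemma finsler_field_le xi v :
  `|dotv (finsler_field H p xi) v| <= H xi `^ (p - 1) * H v.
Proof.
rewrite /finsler_field; case: eqVneq => [_|xi0].
  by rewrite dotv0l normr0 mulr_ge0 ?powR_ge0 ?(finsler_ge0 HH).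
rewrite dotvZl normrM (ger0_norm (powR_ge0 _ _)) ler_wpM2l ?powR_ge0//.
exact: finsler_grad_le.
Qed.

Lemma finsler_field_euler xi : dotv (finsler_field H p xi) xi = H xi `^ p.
Proof.
rewrite /finsler_field; case: eqVneq => [->|xi0].
  by rewrite dotv0l (finsler0 HH) powR0 ?gt_eqF.
by rewrite dotvZl (finsler_euler HH xi0) mulrC mulr_powRB1 ?(finsler_ge0 HH).
Qed.

Lemma dotv_delta xi i : dotv xi (delta_mx ord0 i) = xi ord0 i.
Proof.
rewrite /dotv (bigD1 i)//= mxE !eqxx mulr1 big1 ?addr0// => j ji.
by rewrite mxE (negPf ji) andbF mulr0.
Qed.

(** At a nonzero vector this is [H] of class C^1; at [0] it is the squeeze by
    [H xi `^ (p - 1)], which tends to [0] because [1 < p]. *)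
Lemma finsler_field_continuous i :
  continuous (fun xi => finsler_field H p xi ord0 i).
Proof.
move=> xi; have F : Filter (nbhs (xi : 'rV[R]_N)) by exact: nbhs_filter.
have Hp : H y `^ (p - 1) @[y --> xi] --> H xi `^ (p - 1).
  have HpE y : H y `^ (p - 1) = `|H y| `^ (p - 1) by rewrite ger0_norm ?(finsler_ge0 HH).
  under eq_cvg do rewrite HpE; rewrite HpE.
  apply: (@continuous_comp _ _ _ H (fun t : R => `|t| `^ (p - 1))).
    exact: finsler_continuous HH xi.
  by apply: continuous_norm_powR; rewrite subr_gt0.
have [xi0|xi0] := eqVneq xi 0.
  have Fxi : finsler_field H p xi ord0 i = 0 by rewrite /finsler_field xi0 eqxx mxE.
  rewrite /continuous_at Fxi.
  have h0 : H y `^ (p - 1) * H (delta_mx ord0 i) @[y --> xi] --> (0 : R).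
    rewrite -[X in _ --> X](mul0r (H (delta_mx ord0 i))); apply: cvgMl.
    by move: Hp; rewrite {2}xi0 (finsler0 HH) powR0// gt_eqF// subr_gt0.
  have h0N : - (H y `^ (p - 1) * H (delta_mx ord0 i)) @[y --> xi] --> (0 : R).
    by rewrite -oppr0; exact: cvgN.
  apply: (squeeze_cvgr _ h0N h0); apply: nearW => y.
  by rewrite -ler_norml -[X in `|X|]dotv_delta; exact: finsler_field_le.
have [_ cH] := finsler_C1 HH xi0.
apply: (@cvg_trans _ (H y `^ (p - 1) * partial i H y @[y --> xi])).
  apply: near_eq_cvg.
  have : \forall y \near xi, y != 0.
    have Hxi : 0 < H xi.
      rewrite lt_neqAle (finsler_ge0 HH) andbT eq_sym.
      by apply: contra_neq xi0 => /(finsler_eq0 HH).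
    have := cvgr_gt _ (finsler_continuous HH (x := xi)) _ Hxi => /(_ F).
    apply: filterS => y; apply: contraTneq => ->.
    by rewrite (finsler0 HH) ltxx.
  by apply: filterS => y y0; rewrite /finsler_field (negPf y0) !mxE.
have -> : finsler_field H p xi ord0 i = H xi `^ (p - 1) * partial i H xi.
  by rewrite /finsler_field (negPf xi0) !mxE.
exact: (cvgM Hp (cH i)).
Qed.

(** Euler's identity and the bound of [finsler_field] turn the local integrand
    into [beta * X `^ p - p * (X `^ (p - 1) * Y)], to which Young's inequality
    with the weight [beta / p] applies. *)
Lemma local_lower_bound (q beta t e : R) xi n : p < q -> beta = q - p + 1 ->
  0 <= t -> 0 <= e ->
  beta / p * (t `^ (q - p) * H (e *: xi) `^ p) <=
  dotv (finsler_field H p xi) ((beta * t `^ (beta - 1) * e `^ p) *: xi +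
                               (p * t `^ beta * e `^ (p - 1)) *: n) +
  (beta / p) `^ (1 - p) * (t `^ q * H n `^ p).
Proof.
move=> pq betaE t0 e0; have b0 : 0 < beta by rewrite betaE addr_gt0// subr_gt0.
have p10 : 0 < p - 1 by rewrite subr_gt0.
have hx := finsler_ge0 HH xi; have hn := finsler_ge0 HH n.
have l0 : 0 < beta / p by rewrite divr_gt0.
(* The exponents are chosen so that [X `^ (p - 1) * Y] carries [t `^ beta]. *)
set X := t `^ ((q - p) / p) * (e * H xi); set Y := t `^ (q / p) * H n.
have X0 : 0 <= X by rewrite !mulr_ge0 ?powR_ge0.
have Y0 : 0 <= Y by rewrite !mulr_ge0 ?powR_ge0.
have XpE : X `^ p = t `^ (q - p) * (e `^ p * H xi `^ p).
  by rewrite /X !powRM ?mulr_ge0 ?powR_ge0// -powRrM divfK ?gt_eqF.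
have YpE : Y `^ p = t `^ q * H n `^ p.
  by rewrite /Y powRM ?powR_ge0// -powRrM divfK ?gt_eqF.
have XYE : X `^ (p - 1) * Y = t `^ beta * e `^ (p - 1) * (H xi `^ (p - 1) * H n).
  have -> : t `^ beta = t `^ ((q - p) / p * (p - 1)) * t `^ (q / p).
    have E : (q - p) / p * (p - 1) + q / p = beta by rewrite betaE; field; rewrite gt_eqF.
    by rewrite -powRD E// gt_eqF.
  by rewrite /X /Y !powRM ?mulr_ge0 ?powR_ge0// -powRrM; ring.
have := young_powR_scaled p1 l0 X0 Y0.
rewrite dotvDr !dotvZr finsler_field_euler (finslerZ HH) (ger0_norm e0) (powRM p e0 hx) -YpE.
have -> : t `^ (q - p) * (e `^ p * H xi `^ p) = X `^ p by rewrite XpE.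
have -> : beta * t `^ (beta - 1) * e `^ p * H xi `^ p = beta * X `^ p.
  have -> : beta - 1 = q - p by rewrite betaE; ring.
  by rewrite XpE; ring.
have : - (X `^ (p - 1) * Y) <= t `^ beta * e `^ (p - 1) * dotv (finsler_field H p xi) n.
  rewrite XYE -mulrN ler_wpM2l ?mulr_ge0 ?powR_ge0//.
  by have := finsler_field_le xi n; rewrite ler_norml => /andP[].
move=> h1 h2.
have h3 : beta / p * X `^ p = beta * X `^ p - (p - 1) * (beta / p) * X `^ p.
  by field; rewrite gt_eqF.
rewrite h3.
have h4 : - (p * (X `^ (p - 1) * Y)) <= p * t `^ beta * e `^ (p - 1) * dotv (finsler_field H p xi) n.
  by rewrite -!mulrA (mulrA (t `^ beta)) -mulrN; apply: ler_wpM2l h1; exact: ltW.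
lra.
Qed.

End finsler_field_facts.

Section integral_combination.
Context {d : measure_display} {T : measurableType d} {R : realType}.
Variable mu : {measure set T -> \bar R}.

Lemma le_integral_combination (D : set T) (k l : R) (a b c : T -> R) :
  measurable D -> 0 <= k ->
  mu.-integrable D (EFin \o a) -> mu.-integrable D (EFin \o b) ->
  measurable_fun D c -> (forall x, 0 <= c x) ->
  (forall x, k * c x <= a x + l * b x) ->
  (k%:E * \int[mu]_(x in D) (c x)%:E <=
   \int[mu]_(x in D) (a x)%:E + l%:E * \int[mu]_(x in D) (b x)%:E)%E.
Proof.
move=> mD k0 ia ib mc c0 kc.
have mcE : measurable_fun D (fun x => (c x)%:E) by exact/measurable_EFinP.
have ma : measurable_fun D a by apply/measurable_EFinP; exact: measurable_int ia.
have mb : measurable_fun D b by apply/measurable_EFinP; exact: measurable_int ib.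
rewrite -ge0_integralZl//; last by move=> x _; rewrite lee_fin.
rewrite -integralZl// -integralD//; last by apply: integrableZl.
apply: ge0_le_integral => //.
- by move=> x _; rewrite -EFinM lee_fin mulr_ge0.
- by apply/measurable_EFinP; exact: measurable_funM.
- by apply/measurable_EFinP; apply: measurable_funD => //; exact: measurable_funM.
- by move=> x _; rewrite -!EFinM -EFinD lee_fin.
Qed.

End integral_combination.

Section local_term.
Context {R : realType} {N : nat}.
#[local] Opaque lebesgue_rV.
Local Notation leb := (@lebesgue_rV R N).
Implicit Types (x : 'rV[R]_N) (u eta : 'rV[R]_N -> R) (V : set 'rV[R]_N).
Implicit Types (Du : 'rV[R]_N -> 'rV[R]_N).

Lemma integral_clip M V u (k : R -> 'rV[R]_N -> R) : measurable V ->
  measurable_fun setT (fun x => k (u x) x) ->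
  measurable_fun setT (fun x => k (clip M V u x) x) ->
  {ae leb, forall x, V x -> 0 < u x <= M} ->
  (\int[leb]_(x in V) (k (u x) x)%:E = \int[leb]_(x in V) (k (clip M V u x) x)%:E)%E.
Proof.
move=> mV mk mkc uM; apply: ae_eq_integral => //.
- by apply: (measurable_funS measurableT) => //; exact/measurable_EFinP.
- by apply: (measurable_funS measurableT) => //; exact/measurable_EFinP.
- apply: (@filterS _ _ (ae_filter_ringOfSetsType leb) _ _ _ uM) => x uMx Vx.
  by rewrite clip_id//; exact: uMx.
Qed.

Lemma measurable_dotv (f g : 'rV[R]_N -> 'rV[R]_N) :
  (forall i, measurable_fun setT (fun x => f x ord0 i)) ->
  (forall i, measurable_fun setT (fun x => g x ord0 i)) ->
  measurable_fun setT (fun x => dotv (f x) (g x)).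
Proof.
by move=> mf mg; apply: measurable_sum => i; apply: measurable_funM.
Qed.

Section finsler_composition.
Variables (H : 'rV[R]_N -> R) (p : R).
Hypotheses (HH : finsler_minkowski H) (p1 : 1 < p).

Lemma measurable_finsler (f : 'rV[R]_N -> 'rV[R]_N) :
  (forall i, measurable_fun setT (fun x => f x ord0 i)) ->
  measurable_fun setT (fun x => H (f x)).
Proof.
move=> mf; apply: (measurableT_comp (f := H)).
  exact: continuous_measurable_rV (finsler_continuous HH).
exact: measurable_fun_rV.
Qed.

Lemma measurable_finsler_field i (f : 'rV[R]_N -> 'rV[R]_N) :
  (forall i, measurable_fun setT (fun x => f x ord0 i)) ->
  measurable_fun setT (fun x => finsler_field H p (f x) ord0 i).
Proof.
move=> mf; apply: (measurableT_comp (f := fun xi => finsler_field H p xi ord0 i)).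
  by apply: continuous_measurable_rV; exact: (finsler_field_continuous HH p1).
exact: measurable_fun_rV.
Qed.

Lemma finsler_sum_le xi : H xi <= \sum_i `|xi ord0 i| * H (delta_mx ord0 i).
Proof.
rewrite {1}(row_sum_delta xi); elim/big_ind2: _ => [|x a y b xa yb|i _].
- by rewrite (finsler0 HH).
- by rewrite (le_trans (finsler_subadd HH a b))// lerD.
- by rewrite (finslerZ HH).
Qed.

Lemma Lfun_finsler (f : 'rV[R]_N -> 'rV[R]_N) :
  (forall i, (fun x => f x ord0 i) \in Lfun leb p%:E) ->
  (fun x => H (f x)) \in Lfun leb p%:E.
Proof.
move=> Lf; have p1e : (1 <= p%:E)%E by rewrite lee_fin ltW.
have mf i := Lfun_measurable (Lf i).
pose g x := \sum_i `|f x ord0 i| * H (delta_mx ord0 i).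
have Lg : g \in Lfun leb p%:E.
  have -> : g = \sum_i (fun x => `|f x ord0 i| * H (delta_mx ord0 i)).
    by apply/funext => x; rewrite fct_sumE.
  have [L0 LD] := Lfun_addr_closed leb p1e.
  elim/big_ind: _ => [//|a b La Lb|i _]; first exact: LD.
  apply: (Lfun_bounded_mul (ltW p1) (g := fun=> H (delta_mx ord0 i)) (M := `|H (delta_mx ord0 i)|)) => //.
  apply: (Lfun_le (ltW p1) _ _ (Lf i)); first exact: measurableT_comp.
  by move=> x; rewrite normr_id.
apply: (Lfun_le (ltW p1) _ _ Lg); first exact: measurable_finsler.
move=> x; rewrite (ger0_norm (finsler_ge0 HH _)) (le_trans (finsler_sum_le _))//.
exact: ler_norm.
Qed.

Lemma bounded_finsler (f : 'rV[R]_N -> 'rV[R]_N) :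
  (forall i, bounded_fun (fun x => f x ord0 i)) -> bounded_fun (fun x => H (f x)).
Proof.
move=> bf; pose C i := sval (cid (bf i)).
have hC i x : `|f x ord0 i| <= C i by rewrite /C; case: cid.
exists (\sum_i C i * H (delta_mx ord0 i)) => x.
rewrite (ger0_norm (finsler_ge0 HH _)) (le_trans (finsler_sum_le _))//.
by apply: ler_sum => i _; rewrite ler_wpM2r// (finsler_ge0 HH).
Qed.

(** [local_lower_bound] integrated over [V].  Young's inequality also dominates the
    integrand of [A] by [H (Du) `^ p] and a bounded function, so that [A] is finite
    and may be moved to the other side of an inequality. *)
Lemma local_term_estimate (q beta M : R) V u Du eta :
  p < q -> beta = q - p + 1 -> 0 <= M -> open V -> compact (closure V) ->
  measurable_fun setT u -> {ae leb, forall x, V x -> 0 < u x <= M} ->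
  (forall i, Lp_on p%:E V (fun x => Du x ord0 i)) ->
  test_function V eta -> (forall x, 0 <= eta x) ->
  let A := (\int[leb]_(x in V) (dotv (finsler_field H p (Du x))
     ((beta * clip M V u x `^ (beta - 1) * eta x `^ p) *: Du x +
      (p * clip M V u x `^ beta * eta x `^ (p - 1)) *: grad eta x))%:E)%E in
  let I := (\int[leb]_(x in V) (u x `^ q * H (grad eta x) `^ p)%:E)%E in
  [/\ A \is a fin_num, I \is a fin_num &
  ((beta / p)%:E * \int[leb]_(x in V) (u x `^ (q - p) * H (eta x *: Du x) `^ p)%:E
    <= A + ((beta / p) `^ (1 - p))%:E * I)%E].
Proof.
move=> pq betaE M0 oV cV mu uM Lw teta eta0.
have p0 : 0 < p by rewrite (lt_trans ltr01).
have q0 : 0 < q by rewrite (lt_trans p0).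
have b1 : 1 < beta by rewrite betaE ltrDr subr_gt0.
have b0 : 0 < beta by rewrite (lt_trans ltr01).
have mV : measurable V by exact: open_measurable_rV.
have Voo : (leb V < +oo)%E.
  rewrite (le_lt_trans _ (lebesgue_compact_lty cV))// le_measure// ?inE//.
    exact: measurable_compact_rV.
  exact: subset_closure.
have [seta ceta etaV] := teta.
have [B B0 etaB] := test_function_bounded teta.
have meta := measurable_smooth seta.
set v := clip M V u.
have vM x : 0 <= v x <= M by exact: clip_bounds.
have v0 x : 0 <= v x by have /andP[] := vM x.
have mv : measurable_fun setT v by exact: measurable_clip.
have bv : bounded_fun v.
  by exists M => x; have /andP[? ?] := vM x; rewrite ger0_norm.
have beta_ : bounded_fun eta by exists B.
have mvp r := measurable_fun_powR r mv; have metap r := measurable_fun_powR r meta.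
have mDeta i : measurable_fun setT (fun x => grad eta x ord0 i).
  rewrite [X in measurable_fun _ X](_ : _ = partial i eta).
    exact: (measurable_derive_smooth (delta_mx ord0 i) seta).
  by apply/funext => x; rewrite mxE.
have bDeta i : bounded_fun (fun x => grad eta x ord0 i).
  have [C [_ etaC]] := line_derivative_smooth (delta_mx ord0 i) teta.
  by exists C => x; rewrite mxE; exact: etaC.
(* [Du] restricted to [V], whose coordinates are measurable on the whole space. *)
pose W x : 'rV[R]_N := \row_i ((fun x => Du x ord0 i) \_ V) x.
have WE x : x \in V -> W x = Du x.
  by move=> xV; apply/rowP => i; rewrite mxE patchE xV.
have WF i : (fun x => W x ord0 i) = (fun x => Du x ord0 i) \_ V.
  by apply/funext => x; rewrite mxE.
have LW i : (fun x => W x ord0 i) \in Lfun leb p%:E by rewrite WF; exact: Lw.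
have mW i : measurable_fun setT (fun x => W x ord0 i) := Lfun_measurable (LW i).
pose h x := H (W x); have h0 x : 0 <= h x by exact: (finsler_ge0 HH).
have Lh : h \in Lfun leb p%:E by exact: Lfun_finsler.
have ihp : leb.-integrable setT (EFin \o (fun x => h x `^ p)).
  have := Lfun_integrable (ltW p1) Lh; apply: eq_integrable => // x _ /=.
  by rewrite ger0_norm.
pose al x := beta * v x `^ (beta - 1) * eta x `^ p.
pose ga x := p * v x `^ beta * eta x `^ (p - 1).
have mal : measurable_fun setT al.
  by apply: measurable_funM => //; exact: measurable_funM.
have mga : measurable_fun setT ga.
  by apply: measurable_funM => //; exact: measurable_funM.
have al0 x : 0 <= al x by rewrite !mulr_ge0 ?powR_ge0// ltW.
have ga0 x : 0 <= ga x by rewrite !mulr_ge0 ?powR_ge0// ltW.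
have [Cal alC] : bounded_fun al.
  apply: bounded_funM; last by apply: bounded_powR => //; exact: ltW.
  apply: bounded_funM; first exact: bounded_cst.
  by apply: bounded_powR => //; rewrite subr_ge0 ltW.
have bga : bounded_fun ga.
  apply: bounded_funM; last by apply: bounded_powR => //; rewrite subr_ge0 ltW.
  by apply: bounded_funM; [exact: bounded_cst|apply: bounded_powR => //; exact: ltW].
have bHD : bounded_fun (fun x => H (grad eta x)) by exact: bounded_finsler.
have mHD : measurable_fun setT (fun x => H (grad eta x)) by exact: measurable_finsler.
have v_out x : ~ V x -> v x = 0 by exact: clip_out.
pose k x := ga x * H (grad eta x).
have k0 x : 0 <= k x by rewrite mulr_ge0// (finsler_ge0 HH).
have ikp : leb.-integrable setT (EFin \o (fun x => k x `^ p)).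
  have bk : bounded_fun (fun x => k x `^ p).
    by apply: bounded_powR => //; [exact: ltW|exact: bounded_funM].
  have [Ck kC] := bk; apply/Lfun1_integrable.
  apply: (Lfun_bounded_support (lexx 1) mV Voo _ kC) => [|x nV].
    by apply: measurable_fun_powR; exact: measurable_funM.
  rewrite /k /ga (v_out _ nV) [X in _ * X * _ * _]powR0 ?gt_eqF//.
  by rewrite mulr0 !mul0r powR0// gt_eqF.
pose a x := dotv (finsler_field H p (W x)) (al x *: W x + ga x *: grad eta x).
pose b x := v x `^ q * H (grad eta x) `^ p.
pose c x := v x `^ (q - p) * H (eta x *: W x) `^ p.
have ma : measurable_fun setT a.
  apply: measurable_dotv => i; first exact: measurable_finsler_field.
  rewrite [X in measurable_fun _ X](_ : _ = fun x => al x * W x ord0 i + ga x * grad eta x ord0 i).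
    by apply: measurable_funD; exact: measurable_funM.
  by apply/funext => x; rewrite !mxE.
have ia : leb.-integrable setT (EFin \o a).
  have i1 : leb.-integrable setT (EFin \o (fun x => (Cal + (p - 1)) * h x `^ p)).
    by have := integrableZl measurableT (Cal + (p - 1)) ihp; apply: eq_integrable.
  apply: (le_integrable _ _ _ (integrableD measurableT i1 ikp)) => //.
    exact/measurable_EFinP.
  move=> x _; rewrite [leRHS](_ : _ = (`|(Cal + (p - 1)) * h x `^ p + k x `^ p|)%:E)//.
  rewrite lee_fin; apply: le_trans (ler_norm _).
  rewrite /a dotvDr !dotvZr (finsler_field_euler HH p1).
  rewrite (le_trans (ler_normD _ _))// mulrDl -addrA lerD//.
    rewrite normrM (ger0_norm (al0 x)) (ger0_norm (powR_ge0 _ _)) ler_wpM2r ?powR_ge0//.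
    by rewrite (le_trans _ (alC x))// ler_norm.
  rewrite (le_trans _ (young_powR p1 (h0 x) (k0 x)))// normrM (ger0_norm (ga0 x)).
  have : h x `^ (p - 1) * k x <= p * (h x `^ (p - 1) * k x).
    by rewrite ler_peMl ?(ltW p1)// mulr_ge0 ?powR_ge0.
  apply: le_trans; rewrite /k mulrCA ler_wpM2l//.
  exact: finsler_field_le.
have mb : measurable_fun setT b.
  by apply: measurable_funM => //; exact: measurable_fun_powR.
have ib : leb.-integrable setT (EFin \o b).
  have [Cb bC] : bounded_fun b.
    apply: bounded_funM; apply: bounded_powR => //; [exact: ltW|exact: ltW|].
    by move=> x; exact: (finsler_ge0 HH).
  apply/Lfun1_integrable; apply: (Lfun_bounded_support (lexx 1) mV Voo mb bC) => x nV.
  by rewrite /b (v_out _ nV) powR0 ?mul0r// gt_eqF.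
have mHW : measurable_fun setT (fun x => H (eta x *: W x)).
  apply: measurable_finsler => i.
  rewrite [X in measurable_fun _ X](_ : _ = fun x => eta x * W x ord0 i).
    exact: measurable_funM.
  by apply/funext => x; rewrite mxE.
have mc : measurable_fun setT c.
  by apply: measurable_funM => //; exact: measurable_fun_powR.
have iaV : leb.-integrable V (EFin \o a) by exact: integrableS ia.
have ibV : leb.-integrable V (EFin \o b) by exact: integrableS ib.
have mup r := measurable_fun_powR r mu.
have l0 : 0 <= beta / p by rewrite divr_ge0// ltW.
have main : ((beta / p)%:E * \int[leb]_(x in V) (c x)%:E <=
    \int[leb]_(x in V) (a x)%:E + ((beta / p) `^ (1 - p))%:E * \int[leb]_(x in V) (b x)%:E)%E.
  apply: (le_integral_combination mV l0 iaV ibV); first exact: measurable_funS mc.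
    by move=> x; rewrite !mulr_ge0 ?powR_ge0.
  by move=> x; exact: local_lower_bound.
have AE : (\int[leb]_(x in V) (dotv (finsler_field H p (Du x))
     ((beta * v x `^ (beta - 1) * eta x `^ p) *: Du x +
      (p * v x `^ beta * eta x `^ (p - 1)) *: grad eta x))%:E = \int[leb]_(x in V) (a x)%:E)%E.
  by apply: eq_integral => x xV; rewrite /a (WE x xV).
have IE : (\int[leb]_(x in V) (u x `^ q * H (grad eta x) `^ p)%:E = \int[leb]_(x in V) (b x)%:E)%E.
  apply: (integral_clip (k := fun t x => t `^ q * H (grad eta x) `^ p) mV _ mb uM).
  by apply: measurable_funM; [exact: mup|exact: measurable_fun_powR].
have cE : (\int[leb]_(x in V) (u x `^ (q - p) * H (eta x *: Du x) `^ p)%:E =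
    \int[leb]_(x in V) (c x)%:E)%E.
  transitivity (\int[leb]_(x in V) (u x `^ (q - p) * H (eta x *: W x) `^ p)%:E)%E.
    by apply: eq_integral => x xV; rewrite (WE x xV).
  apply: (integral_clip (k := fun t x => t `^ (q - p) * H (eta x *: W x) `^ p) mV _ mc uM).
  by apply: measurable_funM; [exact: mup|exact: measurable_fun_powR].
rewrite AE IE cE; split; [exact: integrable_fin_num|exact: integrable_fin_num|exact: main].
Qed.

End finsler_composition.
End local_term.

(** * The nonlocal term *)

(** If [b <= a] the right-hand side is nonnegative; otherwise it is
    [- (b - a) `^ (p - 1)], and [b - a <= b]. *)
Lemma exterior_lower_bound {R : realType} (p a b : R) : 1 < p -> 0 <= a ->
  - `|b| `^ (p - 1) <= `|a - b| `^ (p - 2) * (a - b).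
Proof.
move=> p1 a0; have [ba|ab] := leP b a.
  by rewrite (@le_trans _ _ 0) ?oppr_le0 ?powR_ge0// mulr_ge0 ?powR_ge0// subr_ge0.
have h : 0 < b - a by rewrite subr_gt0.
have p10 : 0 < p - 1 by rewrite subr_gt0.
have -> : p - 2 = p - 1 - 1 by ring.
rewrite distrC (gtr0_norm h) -(opprB b a) mulrN lerN2 mulrC mulr_powRB1// ?(ltW h)//.
apply: ler_powR_base; [exact: ltW|exact: ltW|].
by rewrite (@le_trans _ _ b) ?ler_norm// gerBl.
Qed.

Section product_integrals.
Context {d1 d2 : measure_display} {T1 : measurableType d1} {T2 : measurableType d2}.
Context {R : realType}.
Variables (m1 : {sigma_finite_measure set T1 -> \bar R})
          (m2 : {sigma_finite_measure set T2 -> \bar R}).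

Lemma ae_fst (P : T1 -> Prop) : {ae m1, forall x, P x} ->
  {ae (m1 \x m2)%E, forall z, P z.1}.
Proof.
move=> [A [mA A0 PA]]; exists (A `*` setT); split; first exact: measurableX.
  by rewrite [LHS]product_measure1E// [X in (X * _)%E]A0 mul0e.
by move=> z nP; split => //; exact: PA.
Qed.

Lemma ae_snd (P : T2 -> Prop) : {ae m2, forall x, P x} ->
  {ae (m1 \x m2)%E, forall z, P z.2}.
Proof.
move=> [A [mA A0 PA]]; exists (setT `*` A); split; first exact: measurableX.
  by rewrite [LHS]product_measure1E// [X in (_ * X)%E]A0 mule0.
by move=> z nP; split => //; exact: PA.
Qed.

End product_integrals.

Lemma ge0_integral_restrict_scale {d : measure_display} {T : measurableType d}
    {R : realType} (mu : {measure set T -> \bar R}) (D : set T) (k : T -> R) (C : R) :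
  measurable D -> measurable_fun setT k -> (forall x, 0 <= k x) -> 0 <= C ->
  (\int[mu]_x (C * (k \_ D) x)%:E = C%:E * \int[mu]_(x in D) (k x)%:E)%E.
Proof.
move=> mD mk k0 C0; rewrite -ge0_integralZl//; last 2 first.
- by apply: (measurable_funS measurableT) => //; exact/measurable_EFinP.
- by move=> x _; rewrite lee_fin.
rewrite [RHS]integral_mkcond; apply: eq_integral => x _.
by rewrite !patchE; case: ifP => // _; rewrite mulr0.
Qed.

Lemma ge0_integral_EFinD {d : measure_display} {T : measurableType d}
    {R : realType} (mu : {measure set T -> \bar R}) (f g : T -> R) :
  measurable_fun setT f -> measurable_fun setT g ->
  (forall x, 0 <= f x) -> (forall x, 0 <= g x) ->
  (\int[mu]_x (f x + g x)%:E = \int[mu]_x (f x)%:E + \int[mu]_x (g x)%:E)%E.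
Proof.
move=> mf mg f0 g0; rewrite -ge0_integralD//.
- by move=> x _; rewrite lee_fin.
- exact/measurable_EFinP.
- by move=> x _; rewrite lee_fin.
- exact/measurable_EFinP.
Qed.

(** The negative part of [f] is dominated by [g], whatever the positive part is. *)
Lemma ae_lower_bound_integral {d : measure_display} {T : measurableType d}
    {R : realType} (mu : {measure set T -> \bar R}) (f g : T -> R) :
  measurable_fun setT f -> measurable_fun setT g -> (forall x, 0 <= g x) ->
  {ae mu, forall x, - g x <= f x} ->
  ((- \int[mu]_x (g x)%:E) <= \int[mu]_x (f x)%:E)%E.
Proof.
move=> mf mg g0 gf; rewrite [leRHS]integralE.
have mfE : measurable_fun setT (EFin \o f) by exact/measurable_EFinP.
apply: (@le_trans _ _ (- (\int[mu]_x ((fun x => (f x)%:E)^\- x)))%E); last first.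
  by rewrite leeDr// integral_ge0.
rewrite leeN2; apply: ae_ge0_le_integral => //.
- exact: measurable_funeneg.
- by move=> x _; rewrite lee_fin.
- exact/measurable_EFinP.
- apply: (@filterS _ _ (ae_filter_ringOfSetsType mu) _ _ _ gf) => x gfx _.
  by rewrite funenegE -EFinN -EFin_max lee_fin ge_max g0 lerNl gfx.
Qed.

Section nonlocal_term.
Context {R : realType} {N : nat}.
#[local] Opaque lebesgue_rV.
Local Notation leb := (@lebesgue_rV R N).
Implicit Types (x y : 'rV[R]_N) (u eta : 'rV[R]_N -> R) (V : set 'rV[R]_N).
Implicit Type z : 'rV[R]_N * 'rV[R]_N.

Lemma enorm_sym x y : enorm (x - y) = enorm (y - x).
Proof.
by rewrite /enorm; congr Num.sqrt; apply: eq_bigr => i _; rewrite !mxE; ring.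
Qed.

Lemma measurable_mu_density (p s : R) : measurable_fun setT (@mu_density R N p s).
Proof.
apply: (measurableT_comp (measurable_powR _)).
apply: (measurableT_comp (f := @enorm R N)).
  exact: continuous_measurable_rV (@enorm_continuous R N).
apply: measurable_fun_rV => i.
rewrite [X in measurable_fun _ X](_ : _ = fun z => z.1 ord0 i - z.2 ord0 i); last first.
  by apply/funext => z; rewrite !mxE.
by apply: measurable_funB;
  [apply: (measurableT_comp (measurable_coord i))|apply: (measurableT_comp (measurable_coord i))].
Qed.

Definition tail (p s : R) V u x : \bar R :=
  (\int[leb]_(y in ~` V) (`|u y| `^ (p - 1) / enorm (x - y) `^ (N%:R + p * s))%:E)%E.

Lemma tail_ge0 p s V u x : (0 <= tail p s V u x)%E.
Proof. by apply: integral_ge0 => y _; rewrite lee_fin mulr_ge0 ?invr_ge0 ?powR_ge0. Qed.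

Section exterior.
Variables (p s : R) (V : set 'rV[R]_N) (u phi : 'rV[R]_N -> R).
Hypotheses (mV : measurable V) (mu : measurable_fun setT u).
Hypotheses (mphi : measurable_fun setT phi) (phi0 : forall x, 0 <= phi x).

(** The bound of the nonlocal integrand when [x] lies in [V] and [y] does not. *)
Definition exterior_density x y : R :=
  ((fun y => `|u y| `^ (p - 1)) \_ (~` V)) y * phi x * mu_density p s (x, y).

Lemma exterior_density_ge0 x y : 0 <= exterior_density x y.
Proof.
rewrite /exterior_density mulr_ge0 ?powR_ge0// mulr_ge0// patchE.
by case: ifP => // _; exact: powR_ge0.
Qed.

Lemma measurable_exterior_density :
  measurable_fun setT (fun z => exterior_density z.1 z.2).
Proof.
have mVc : measurable (~` V) by exact: measurableC.
apply: measurable_funM; last first.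
  by rewrite (_ : (fun _ => _) = @mu_density R N p s); [exact: measurable_mu_density|apply/funext => -[]].
apply: measurable_funM; last exact: (measurableT_comp mphi).
apply: (measurableT_comp (f := (fun y => `|u y| `^ (p - 1)) \_ (~` V))) => //.
apply/(measurable_restrictT _ mVc); apply: (measurable_funS measurableT) => //.
by apply: measurable_fun_powR; exact: measurableT_comp.
Qed.

Lemma inner_exterior_integral x :
  (\int[leb]_y (exterior_density x y)%:E = (phi x)%:E * tail p s V u x)%E.
Proof.
have mVc : measurable (~` V) by exact: measurableC.
rewrite /tail -ge0_integralZl//; last 3 first.
- apply: (measurable_funS measurableT) => //; apply/measurable_EFinP.
  apply: measurable_funM; first by apply: measurable_fun_powR; exact: measurableT_comp.
  rewrite [X in measurable_fun _ X](_ : _ = fun y => mu_density p s (x, y)).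
    exact: (measurableT_comp (measurable_mu_density p s)).
  by apply/funext => y; rewrite /mu_density powRN.
- by move=> y _; rewrite lee_fin mulr_ge0 ?invr_ge0 ?powR_ge0.
- by rewrite lee_fin.
rewrite [RHS]integral_mkcond; apply: eq_integral => y _.
rewrite /exterior_density !patchE; case: ifP => _; last by rewrite !mul0r.
by rewrite /mu_density powRN /= -EFinM; congr EFin; ring.
Qed.

Lemma exterior_integral :
  (\int[leb \x leb]_z (exterior_density z.1 z.2)%:E =
   \int[leb]_x ((phi x)%:E * tail p s V u x))%E.
Proof.
rewrite fubini_tonelli1//; last 2 first.
- by apply/measurable_EFinP; exact: measurable_exterior_density.
- by move=> z; rewrite lee_fin exterior_density_ge0.
by apply: eq_integral => x _; exact: inner_exterior_integral.
Qed.

Lemma exterior_integral_swap :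
  (\int[leb \x leb]_z (exterior_density z.2 z.1)%:E =
   \int[leb]_x ((phi x)%:E * tail p s V u x))%E.
Proof.
rewrite fubini_tonelli2//; last 2 first.
- apply/measurable_EFinP.
  exact: (measurableT_comp measurable_exterior_density (@measurable_swap _ _ _ _)).
- by move=> z; rewrite lee_fin exterior_density_ge0.
by apply: eq_integral => x _; exact: inner_exterior_integral.
Qed.

Lemma exterior_integral_sum :
  (\int[leb \x leb]_z (exterior_density z.1 z.2 + exterior_density z.2 z.1)%:E =
   2%:E * \int[leb]_x ((phi x)%:E * tail p s V u x))%E.
Proof.
rewrite -[2]/(1 + 1) EFinD ge0_muleDl// !mul1e.
rewrite -{1}exterior_integral -exterior_integral_swap.
apply: ge0_integral_EFinD.
- exact: measurable_exterior_density.
- exact: (measurableT_comp measurable_exterior_density (@measurable_swap _ _ _ _)).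
- by move=> z; exact: exterior_density_ge0.
- by move=> z; exact: exterior_density_ge0.
Qed.

Lemma exterior_integral_le (S : \bar R) : (0 <= S)%E ->
  (forall x, phi x != 0 -> (tail p s V u x <= S)%E) ->
  (\int[leb]_x ((phi x)%:E * tail p s V u x) <= S * \int[leb]_x (phi x)%:E)%E.
Proof.
move=> S0 tS.
have mphiE : measurable_fun setT (EFin \o phi) by exact/measurable_EFinP.
rewrite -ge0_integralZl//; last by move=> x _; rewrite lee_fin.
apply: ge0_le_integral => //.
- by move=> x _; rewrite mule_ge0 ?lee_fin ?tail_ge0.
- rewrite (_ : (fun x => _) = fubini_F leb (fun z => (exterior_density z.1 z.2)%:E)).
    apply: measurable_fun_fubini_tonelli_F => [|z].
      by apply/measurable_EFinP; exact: measurable_exterior_density.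
    by rewrite lee_fin exterior_density_ge0.
  by apply/funext => x; rewrite -inner_exterior_integral.
- exact: measurable_funeM.
- move=> x _; have [->|h] := eqVneq (phi x) 0; first by rewrite mul0e mule0.
  by rewrite muleC lee_wpmul2r ?lee_fin// tS.
Qed.

End exterior.

(** The negative part of the integrand is dominated by [G], the sum of a kernel on
    [V `*` V] and of [exterior_density] with its variables in both orders. *)
Lemma nonlocal_term_estimate (p q beta s M : R) V u eta phi (S : \bar R) :
  1 < p -> p < q -> beta = q - p + 1 -> 0 <= M -> measurable V ->
  measurable_fun setT u -> {ae leb, forall x, V x -> 0 < u x <= M} ->
  measurable_fun setT eta -> (forall x, 0 <= eta x) ->
  (forall x, ~ V x -> eta x = 0) -> (0 <= S)%E ->
  (forall x, eta x != 0 -> (tail p s V u x <= S)%E) ->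
  (forall x, phi x = clip M V u x `^ beta * eta x `^ p) ->
  (- (((p - 1) `^ (p - 1))%:E *
      \int[leb \x leb]_(z in V `*` V) ((u z.1 `^ q + u z.2 `^ q) *
         `|eta z.1 - eta z.2| `^ p * mu_density p s z)%:E +
      2%:E * S * \int[leb]_(x in V) (u x `^ beta * eta x `^ p)%:E) <=
   \int[leb \x leb]_z (`|u z.1 - u z.2| `^ (p - 2) * (u z.1 - u z.2)
            * (phi z.1 - phi z.2) * mu_density p s z)%:E)%E.
Proof.
move=> p1 pq betaE M0 mV mu uM meta eta0 eta_out S0 tS phiE0.
have p0 : 0 < p by rewrite (lt_trans ltr01).
have mcl := measurable_clip M mV mu.
have mphi : measurable_fun setT phi.
  rewrite (funext phiE0).
  by apply: measurable_funM; exact: measurable_fun_powR.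
have phi0 x : 0 <= phi x by rewrite phiE0 mulr_ge0 ?powR_ge0.
have phi_out x : ~ V x -> phi x = 0.
  by move=> nV; rewrite phiE0 (eta_out _ nV) [X in _ * X]powR0 ?mulr0 ?gt_eqF.
have mVV : measurable (V `*` V) by exact: measurableX.
have m1 (f : 'rV[R]_N -> R) : measurable_fun setT f -> measurable_fun setT (fun z => f z.1).
  by move=> mf; apply: (measurableT_comp mf).
have m2 (f : 'rV[R]_N -> R) : measurable_fun setT f -> measurable_fun setT (fun z => f z.2).
  by move=> mf; apply: (measurableT_comp mf).
have mmu := measurable_mu_density p s.
have mu0 z : 0 <= mu_density p s z by exact: powR_ge0.
pose C : R := (p - 1) `^ (p - 1); have C0 : 0 <= C by exact: powR_ge0.
pose k z := (u z.1 `^ q + u z.2 `^ q) * `|eta z.1 - eta z.2| `^ p * mu_density p s z.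
have k0 z : 0 <= k z by rewrite !mulr_ge0// ?addr_ge0 ?powR_ge0.
have mk : measurable_fun setT k.
  apply: measurable_funM => //; apply: measurable_funM.
    have mq := measurable_fun_powR q mu.
    exact: (measurable_funD (m1 _ mq) (m2 _ mq)).
  apply: (measurableT_comp (measurable_powR p)); apply: measurableT_comp => //.
  exact: (measurable_funB (m1 _ meta) (m2 _ meta)).
pose G1 z := C * (k \_ (V `*` V)) z.
have mkV : measurable_fun setT (k \_ (V `*` V)).
  by apply/(measurable_restrictT _ mVV); exact: (measurable_funS measurableT).
have kV0 z : 0 <= (k \_ (V `*` V)) z by rewrite patchE; case: ifP.
have mG1 : measurable_fun setT G1 by exact: measurable_funM.
have G10 z : 0 <= G1 z by exact: mulr_ge0.
pose ext := exterior_density p s V u phi.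
have ext0 x y : 0 <= ext x y by exact: exterior_density_ge0.
have mext : measurable_fun setT (fun z => ext z.1 z.2) by exact: measurable_exterior_density.
have mext' : measurable_fun setT (fun z => ext z.2 z.1).
  exact: (measurableT_comp mext (@measurable_swap _ _ _ _)).
have ext_sum : (\int[leb \x leb]_z (ext z.1 z.2 + ext z.2 z.1)%:E =
    2%:E * \int[leb]_x ((phi x)%:E * tail p s V u x))%E.
  exact: exterior_integral_sum.
have ext_in x y : V y -> ext x y = 0.
  by move=> Vy; rewrite /ext /exterior_density patchE memNset ?mul0r//=; exact.
have ext_out x y : ~ V y -> ext x y = `|u y| `^ (p - 1) * phi x * mu_density p s (x, y).
  by move=> Vy; rewrite /ext /exterior_density patchE mem_set.
(* From here on only the two values of [ext] matter. *)
clearbody ext.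
pose G z := G1 z + (ext z.1 z.2 + ext z.2 z.1).
have intG : (\int[leb \x leb]_z (G z)%:E = C%:E * \int[leb \x leb]_(z in V `*` V) (k z)%:E +
    2%:E * \int[leb]_x ((phi x)%:E * tail p s V u x))%E.
  have E1 : (\int[leb \x leb]_z (G1 z)%:E = C%:E * \int[leb \x leb]_(z in V `*` V) (k z)%:E)%E.
    exact: ge0_integral_restrict_scale mVV mk k0 C0.
  rewrite -E1 -ext_sum.
  apply: (ge0_integral_EFinD _ mG1 (measurable_funD mext mext') G10) => z.
  by apply: addr_ge0; exact: ext0.
have phiE : (\int[leb]_(x in V) (u x `^ beta * eta x `^ p)%:E = \int[leb]_x (phi x)%:E)%E.
  rewrite (integral_clip (k := fun t x => t `^ beta * eta x `^ p) mV _ _ uM); last 2 first.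
  - by apply: measurable_funM; exact: measurable_fun_powR.
  - by rewrite -(funext phiE0).
  under eq_integral do rewrite -phiE0.
  rewrite integral_mkcond; apply: eq_integral => x _.
  rewrite patchE; case: ifPn => // /negP nV; rewrite phi_out//.
  by apply: contra_not nV => /mem_set.
apply: (@le_trans _ _ (- (\int[leb \x leb]_z (G z)%:E))%E).
  rewrite leeN2 intG; apply: leeD => //; rewrite phiE -muleA.
  apply: lee_wpmul2l => //; apply: exterior_integral_le => //.
  move=> x phix; apply: tS; apply: contra_neq phix => eta0x.
  by rewrite phiE0 eta0x [X in _ * X]powR0 ?mulr0 ?gt_eqF.
apply: ae_lower_bound_integral.
- apply: measurable_funM => //; apply: measurable_funM; last first.
    exact: (measurable_funB (m1 _ mphi) (m2 _ mphi)).
  have md : measurable_fun setT (fun z => u z.1 - u z.2).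
    exact: (measurable_funB (m1 _ mu) (m2 _ mu)).
  apply: measurable_funM => //; apply: (measurableT_comp (measurable_powR _)).
  exact: measurableT_comp.
- exact: (measurable_funD mG1 (measurable_funD mext mext')).
- by move=> z; apply: addr_ge0; [exact: G10|apply: addr_ge0; exact: ext0].
have ae1 := ae_fst leb uM; have ae2 := ae_snd leb uM.
apply: (@filterS2 _ _ (ae_filter_ringOfSetsType (leb \x leb)%E) _ _ _ _ ae1 ae2) => -[x y] /= hx hy.
rewrite /G /G1 /=; have [Vx|Vx] := pselect (V x); have [Vy|Vy] := pselect (V y).
- rewrite (ext_in _ _ Vy) (ext_in _ _ Vx) !addr0 patchE mem_set//.
  have /andP[ux uxM] := hx Vx; have /andP[uy uyM] := hy Vy.
  rewrite !phiE0 !clip_id ?hx ?hy// mulrA -mulNr ler_wpM2r//.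
  rewrite betaE /C mulrA.
  exact: nonlocal_lower_bound (ltW ux) (ltW uy) (eta0 x) (eta0 y).
- rewrite (ext_in _ _ Vx) (ext_out _ _ Vy) patchE memNset; last by case.
  rewrite mulr0 add0r addr0 (phi_out _ Vy) subr0 -mulNr ler_wpM2r// -mulNr ler_wpM2r//.
  by apply: exterior_lower_bound => //; have /andP[/ltW] := hx Vx.
- rewrite (ext_in _ _ Vy) (ext_out _ _ Vx) patchE memNset; last by case.
  rewrite mulr0 !add0r (phi_out _ Vx) sub0r mulrN -mulNr.
  have -> : mu_density p s (y, x) = mu_density p s (x, y).
    by rewrite /mu_density /= enorm_sym.
  rewrite -mulNr ler_wpM2r// -mulNr ler_wpM2r// -mulrN opprB distrC.
  by apply: exterior_lower_bound => //; have /andP[/ltW] := hy Vy.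
- by rewrite (phi_out _ Vx) (phi_out _ Vy) subr0 mulr0 mul0r oppr_le0; apply: addr_ge0; [exact: G10|apply: addr_ge0; exact: ext0].
Qed.

End nonlocal_term.

(** * The energy estimate *)

Section bounded_functions.
Context {d : measure_display} {T : measurableType d} {R : realType}.
Variable mu : {measure set T -> \bar R}.

Lemma Lfun_oo_bounded (f : T -> R) : f \in Lfun mu +oo%E ->
  exists2 M : R, 0 <= M & {ae mu, forall x, `|f x| <= M}.
Proof.
rewrite inE => /andP[_]; rewrite inE /= /finite_norm unlock.
case: ifPn => [mu0 foo|].
  have [M hM] := ess_supr_bounded (f := fun x => `|f x|) foo.
  exists (Num.max 0 M); first by rewrite le_max lexx.
  apply: (@filterS _ _ (ae_filter_ringOfSetsType mu) _ _ _ hM) => x fx.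
  by rewrite le_max fx orbT.
rewrite -leNgt => mu0 _; exists 0 => //; exists setT; split => //.
by apply/eqP; rewrite eq_le mu0 measure_ge0.
Qed.

Lemma integrable_Lfun_oo_support (f : T -> R) K : measurable K -> (mu K < +oo)%E ->
  (forall x, ~ K x -> f x = 0) -> f \in Lfun mu +oo%E ->
  mu.-integrable setT (EFin \o f).
Proof.
move=> mK Koo f0 foo; have mf := Lfun_measurable foo.
have [M M0 fM] := Lfun_oo_bounded foo.
apply/integrableP; split; first exact/measurable_EFinP.
apply: (@le_lt_trans _ _ (\int[mu]_x ((M * \1_K x)%:E))%E).
  apply: ae_ge0_le_integral => //.
  - by apply/measurable_EFinP; exact: measurableT_comp.
  - by move=> x _; rewrite lee_fin mulr_ge0.
  - by apply/measurable_EFinP; exact: measurable_funM.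
  - apply: (@filterS _ _ (ae_filter_ringOfSetsType mu) _ _ _ fM) => x fx _.
    rewrite lee_fin indicE; case: (boolP (x \in K)) => [_|/negP nK]; first by rewrite mulr1.
    by rewrite f0 ?normr0 ?mulr0//; apply: contra_not nK => /mem_set.
under eq_integral do rewrite EFinM.
rewrite ge0_integralZl//; last by apply/measurable_EFinP.
by rewrite integral_indic// setIT lte_mul_pinfty.
Qed.

End bounded_functions.

Section potential_term.
Context {R : realType} {N : nat}.
#[local] Opaque lebesgue_rV.
Local Notation leb := (@lebesgue_rV R N).

Lemma powR_potential (p q beta t : R) : beta = q - p + 1 -> 0 < t ->
  `|t| `^ (p - 2) * t * t `^ beta = t `^ q.
Proof.
move=> betaE t0; rewrite (gtr0_norm t0) -{2}(powRr1 (ltW t0)).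
rewrite -!powRD ?(gt_eqF t0) ?implybT//.
by congr (_ `^ _); rewrite betaE; ring.
Qed.

Lemma potential_term_eq (p q beta M : R) (V : set 'rV[R]_N) (g u eta : 'rV[R]_N -> R) :
  1 < p -> p < q -> beta = q - p + 1 -> 0 <= M -> measurable V -> (leb V < +oo)%E ->
  measurable_fun setT u -> {ae leb, forall x, V x -> 0 < u x <= M} ->
  Lp_loc +oo%E V g -> test_function V eta -> (forall x, 0 <= eta x) ->
  (\int[leb]_(x in V) (g x * u x `^ q * eta x `^ p)%:E)%E \is a fin_num /\
  (\int[leb]_(x in V) (g x * `|u x| `^ (p - 2) * u x *
     (clip M V u x `^ beta * eta x `^ p))%:E =
   \int[leb]_(x in V) (g x * u x `^ q * eta x `^ p)%:E)%E.
Proof.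
move=> p1 pq betaE M0 mV Voo mu uM gloc teta eta0.
have p0 : 0 < p by rewrite (lt_trans ltr01).
have q0 : 0 < q by rewrite (lt_trans p0).
have [seta ceta etaV] := teta.
have meta := measurable_smooth seta; have mcl := measurable_clip M mV mu.
have mK := measurable_compact_rV ceta.
pose gK := g \_ (spt eta); have LgK : gK \in Lfun leb +oo%E by exact: gloc.
have mgK := Lfun_measurable LgK.
have igK : leb.-integrable setT (EFin \o gK).
  apply: (integrable_Lfun_oo_support mK (lebesgue_compact_lty ceta) _ LgK) => x nK.
  by rewrite /gK patchE memNset.
have etap_out x : ~ spt eta x -> eta x `^ p = 0.
  by move=> nK; rewrite (off_spt nK) powR0 ?gt_eqF.
have gKE x (c : R) : g x * c * eta x `^ p = gK x * c * eta x `^ p.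
  rewrite /gK patchE; case: ifPn => // /negP nK.
  by rewrite etap_out ?mulr0//; apply: contra_not nK => /mem_set.
have E : (\int[leb]_(x in V) (g x * u x `^ q * eta x `^ p)%:E =
    \int[leb]_(x in V) (gK x * (clip M V u x `^ q * eta x `^ p))%:E)%E.
  under eq_integral do rewrite gKE -mulrA.
  apply: (integral_clip (k := fun t x => gK x * (t `^ q * eta x `^ p)) mV _ _ uM).
  - by apply: measurable_funM => //; apply: measurable_funM; exact: measurable_fun_powR.
  - by apply: measurable_funM => //; apply: measurable_funM; exact: measurable_fun_powR.
split.
  rewrite E; apply: integrable_fin_num => //.
  apply: (integrableS (E := setT)) => //.
  apply: integrable_bounded_fun => //.
    by apply: measurable_funM; exact: measurable_fun_powR.
  apply: bounded_funM; apply: bounded_powR => //; [exact: ltW| | |exact: ltW|].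
  - by move=> x; have /andP[] := clip_bounds V u x M0.
  - by exists M => x; have /andP[? ?] := clip_bounds V u x M0; rewrite ger0_norm.
  - by have [B _ etaB] := test_function_bounded teta; exists B.
transitivity (\int[leb]_(x in V) (gK x * (`|u x| `^ (p - 2) * u x *
     clip M V u x `^ beta) * eta x `^ p)%:E)%E.
  by apply: eq_integral => x _; rewrite -gKE; congr EFin; ring.
transitivity (\int[leb]_(x in V) (gK x * u x `^ q * eta x `^ p)%:E)%E; last first.
  by apply: eq_integral => x _; rewrite gKE.
apply: ae_eq_integral => //.
- apply: (measurable_funS measurableT) => //; apply/measurable_EFinP.
  apply: measurable_funM; last exact: measurable_fun_powR.
  apply: measurable_funM => //; apply: measurable_funM; last exact: measurable_fun_powR.
  by apply: measurable_funM => //; apply: measurable_fun_powR; exact: measurableT_comp.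
- apply: (measurable_funS measurableT) => //; apply/measurable_EFinP.
  apply: measurable_funM; last exact: measurable_fun_powR.
  by apply: measurable_funM => //; exact: measurable_fun_powR.
- apply: (@filterS _ _ (ae_filter_ringOfSetsType leb) _ _ _ uM) => x uMx Vx.
  have ux := uMx Vx; rewrite clip_id// (powR_potential betaE)//.
  by have /andP[] := ux.
Qed.

End potential_term.

(** [X] may be infinite, and then so is the right-hand side.  Otherwise [B] is not
    [-oo] by its lower bound and not [+oo] by the second inequality, and the
    estimate is linear arithmetic in which [e * B >= - X] because [e <= 1]. *)
Lemma absorb_terms {R : realType} (k c e : R) (I1 I2 A B Ig X : \bar R) :
  0 < k -> 0 < e <= 1 -> A \is a fin_num -> I2 \is a fin_num ->
  Ig \is a fin_num -> (0 <= X)%E ->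
  ((k^-1)%:E * I1 <= A + c%:E * I2)%E -> (A + e%:E * B - Ig <= 0)%E ->
  ((- X) <= B)%E ->
  (I1 <= (k * c)%:E * I2 + k%:E * Ig + k%:E * X)%E.
Proof.
move=> k0 /andP[e0 e1]; case: A => // a _; case: I2 => // i2 _; case: Ig => // ig _.
case: X => [x|_ _ _ _|//]; last first.
  by rewrite gt0_muley ?lte_fin// addey ?leey.
rewrite lee_fin => x0 h1 h2 h3; case: B h2 h3 => [b||]; last by [].
- rewrite -!EFinM -!EFinD -EFinN !lee_fin => h2 h3.
  case: I1 h1 => [i1||_]; last by rewrite leNye.
  + rewrite -!EFinM -!EFinD !lee_fin => h1.
    have ex : - x <= e * b by nra.
    have h4 : k^-1 * i1 <= ig + x + c * i2 by lra.
    have := ler_wpM2l (ltW k0) h4; rewrite mulrA mulfV ?gt_eqF// mul1r.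
    by move=> /le_trans; apply; lra.
  + by rewrite gt0_muley ?lte_fin ?invr_gt0.
- by rewrite gt0_muley ?lte_fin.
Qed.

Lemma distribute_terms {R : realType} (k l C : R) (I3 S I4 : \bar R) :
  0 <= k / l -> 0 <= C -> (0 <= I3)%E -> (0 <= S)%E -> (0 <= I4)%E ->
  ((k / l)%:E * (C%:E * I3 + 2%:E * S * I4) =
   (C * k / l)%:E * I3 + (2 * k / l)%:E * (S * I4))%E.
Proof.
move=> k0 C0 I30 S0 I40; rewrite ge0_muleDr ?mule_ge0 ?lee_fin//.
rewrite -(muleA 2%:E S) !(muleA (k / l)%:E) -!EFinM.
by congr (_%:E * _ + _%:E * _)%E; ring.
Qed.

Theorem theorem3p4 (R : realType) (p : R) (hp : 1 < p) :
  exists2 C : R, 0 < C &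
  forall (N : nat) (s eps : R) (Omega Omega' : set 'rV[R]_N)
    (H : 'rV[R]_N -> R) (g u : 'rV[R]_N -> R) (Du : 'rV[R]_N -> 'rV[R]_N),
  (2 <= N)%N -> 0 < s < 1 ->
  bounded_C1_domain Omega ->
  finsler_minkowski H ->
  0 < eps <= 1 ->
  Lp_loc +oo%E Omega g ->
  open Omega' -> Omega' ⋐ Omega ->
  W1p_loc Omega p u Du ->
  Lp_on +oo%E setT u ->
  weak_subsolution H p s eps g Omega u Du ->
  {ae lebesgue_rV, forall x, Omega' x -> 0 < u x} ->
  forall (q : R) (eta : 'rV[R]_N -> R),
  p < q ->
  test_function Omega' eta ->
  (forall x, 0 <= eta x) ->
  (\int[lebesgue_rV]_(x in Omega')
      (u x `^ (q - p) * H (eta x *: Du x) `^ p)%:E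
   <= ((p / (q - p + 1)) `^ p)%:E *
        \int[lebesgue_rV]_(x in Omega')
          (u x `^ q * H (grad eta x) `^ p)%:E
      + (p / (q - p + 1))%:E *
        \int[lebesgue_rV]_(x in Omega')
          (g x * u x `^ q * eta x `^ p)%:E
      + (C * p / (q - p + 1))%:E *
        \int[lebesgue_rV \x lebesgue_rV]_(z in Omega' `*` Omega')
          ((u z.1 `^ q + u z.2 `^ q) * `|eta z.1 - eta z.2| `^ p
             * mu_density p s z)%:E
      + (2 * p / (q - p + 1))%:E *
        ereal_sup [set \int[lebesgue_rV]_(y in ~` Omega')
            (`|u y| `^ (p - 1) / enorm (x - y) `^ (N%:R + p * s))%:E
          | x in spt eta] *
        \int[lebesgue_rV]_(x in Omega')
          (u x `^ (q - p + 1) * eta x `^ p)%:E)%E.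
Proof.
have C0 : 0 < (p - 1) `^ (p - 1) by rewrite powR_gt0// subr_gt0.
exists ((p - 1) `^ (p - 1)) => // N s eps Omega V H g u Du _ _ _ HH eps01 gloc oV VO
  uloc uoo [_ _ sub] upos q eta pq teta eta0.
have p0 : 0 < p by rewrite (lt_trans ltr01).
have [cV VsubO] := VO.
have mV : measurable V by exact: open_measurable_rV.
have Voo : (lebesgue_rV V < +oo)%E.
  rewrite (le_lt_trans _ (lebesgue_compact_lty cV))// le_measure// ?inE//.
    exact: measurable_compact_rV.
  exact: subset_closure.
have Lu : u \in Lfun (@lebesgue_rV R N) +oo%E by move: uoo; rewrite /Lp_on patch_setT.
have mu := Lfun_measurable Lu.
have [M M0 uM0] := Lfun_oo_bounded Lu.
have uM : {ae lebesgue_rV, forall x, V x -> 0 < u x <= M}.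
  apply: (@filterS2 _ _ (ae_filter_ringOfSetsType lebesgue_rV) _ _ _ _ uM0 upos) => x ux uVx Vx.
  by rewrite uVx//= (le_trans _ ux)// ler_norm.
have wu := uloc V oV VO; have [_ _ Lw] := wu.
have gV : Lp_loc +oo%E V g.
  by move=> K cK KV; apply: gloc => // x /KV /subset_closure /VsubO.
have [seta ceta etaV] := teta.
have meta := measurable_smooth seta.
have eta_out x : ~ V x -> eta x = 0.
  by move=> nV; apply: off_spt; apply: contra_not nV; exact: etaV.
set beta := q - p + 1; have betaE : beta = q - p + 1 by [].
have b1 : 1 < beta by rewrite betaE ltrDr subr_gt0.
clearbody beta.
have b0 : 0 < beta by rewrite (lt_trans ltr01).
have test := power_test_function hp b1 M0 oV cV mu uM wu teta eta0.
have phi0 : {ae lebesgue_rV, forall x, 0 <= clip M V u x `^ beta * eta x `^ p}.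
  by apply: nearW => x; rewrite mulr_ge0 ?powR_ge0.
have weak := sub V _ _ oV VO test phi0.
have [finA finI2 hA] := local_term_estimate HH hp pq betaE M0 oV cV mu uM Lw teta eta0.
have [finIg Ig] := potential_term_eq hp pq betaE M0 mV Voo mu uM gV teta eta0.
rewrite Ig in weak.
set S := ereal_sup _; set I4 := (\int[_]_(x in V) (u x `^ beta * eta x `^ p)%:E)%E.
(* The supremum over an empty support is [-oo]; then [eta = 0], the integral [I4]
   vanishes, and [0] serves as a nonnegative bound of the tail. *)
have [S0 [S00 tS SE]] : exists S0 : \bar R, [/\ (0 <= S0)%E,
    forall x, eta x != 0 -> (tail p s V u x <= S0)%E & (S * I4 = S0 * I4)%E].
  have [[x0 Kx0]|K0] := pselect (spt eta !=set0).
    have tS x : spt eta x -> (tail p s V u x <= S)%E.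
      by move=> Kx; apply: ereal_sup_ubound; exists x.
    exists S; split => //; first exact: (le_trans (tail_ge0 _ _ _ _ _) (tS _ Kx0)).
    by move=> x /eqP etax; apply: tS; apply: contrapT => /off_spt.
  have etaN x : eta x = 0 by apply: off_spt => Kx; apply: K0; exists x.
  exists 0%E; split => // [x|]; first by rewrite etaN eqxx.
  rewrite /I4 (_ : (fun x => _) = cst 0%E) ?integral0 ?mule0//.
  by apply/funext => x; rewrite etaN powR0 ?gt_eqF// mulr0.
have hB := nonlocal_term_estimate (s := s) hp pq betaE M0 mV mu uM meta eta0 eta_out S00 tS (fun x => erefl).
have I30 : (0 <= \int[lebesgue_rV \x lebesgue_rV]_(z in V `*` V)
    ((u z.1 `^ q + u z.2 `^ q) * `|eta z.1 - eta z.2| `^ p * mu_density p s z)%:E)%E.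
  by apply: integral_ge0 => z _; rewrite lee_fin !mulr_ge0 ?addr_ge0 ?powR_ge0.
have I40 : (0 <= I4)%E.
  by apply: integral_ge0 => x _; rewrite lee_fin mulr_ge0 ?powR_ge0.
set X := (X in (- X <= _)%E) in hB.
have X0 : (0 <= X)%E.
  by rewrite adde_ge0// !mule_ge0// lee_fin ltW.
have k0 : 0 < p / beta by rewrite divr_gt0.
have := absorb_terms (k := p / beta) (c := (beta / p) `^ (1 - p)) k0 eps01 finA finI2 finIg X0.
rewrite invf_div => /(_ _ _ hA weak hB).
have -> : p / beta * (beta / p) `^ (1 - p) = (p / beta) `^ p.
  rewrite -[in LHS](invf_div p beta) -(powR_inv1 (ltW k0)) -powRrM mulN1r opprB.
  by rewrite mulr_powRB1// ltW.
rewrite /X (distribute_terms (ltW k0) (ltW C0) I30 S00 I40) -SE.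
by rewrite (muleA (2 * p / beta)%:E S I4) addeA.
Qed.
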